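(* Let $A=(a_{i,j})_{1\le i<j\le n}$ be a collection of integers satisfying (a) $a_{i,i+1}+a_{i+1,i+2}\le a_{i,i+2}$ for $1\le i\le n-2$ and (b) $a_{i,j}+a_{i+1,j+1}\le a_{i,j+1}+a_{i+1,j}$ for $1\le i<j-1\le n-2$, and let $S=\sigma(A)$. Then the commutative algebra $\mathcal Q^S=\bigoplus_\lambda(L_\lambda^S)^*$ (sum over all integral dominant weights) is generated by its components $(L_{\omega_k}^S)^*$, $1\le k\le n-1$; that is, there is a surjection $R\twoheadrightarrow\mathcal Q^S$ mapping $X_{i_1,\dots,i_k}$ to $(e_{i_1,\dots,i_k}^S)^*$. The zero set in $\mathbb P$ of the kernel of this surjection is $F^S\subset\mathbb P$.
   Context: Fix $n\ge2$ and $\mathfrak g=\mathfrak{sl}_n(\mathbb C)$ with Cartan subalgebra $\mathfrak h$, simple roots $\alpha_1,\dots,\alpha_{n-1}$ and fundamental weights $\omega_1,\dots,\omega_{n-1}$; $(a_1,\dots,a_{n-1})$ denotes the weight $\sum a_k\omega_k$. The subalgebra $\mathfrak n_-$ is spanned by negative root vectors $f_{i,j}$, $1\le i<j\le n$, of weight $-\alpha_{i,j}=-(\alpha_i+\dots+\alpha_{j-1})$ ($f_{i,j}e_i=e_j$ in the tautological representation $V=\mathbb C^n$). $L_\lambda$ is the irreducible representation with highest weight $\lambda$ and highest weight vector $v_\lambda$; $L_{\omega_k}=\wedge^kV$ has basis $e_{i_1,\dots,i_k}=e_{i_1}\wedge\dots\wedge e_{i_k}$ ($i_1<\dots<i_k$),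 $v_{\omega_k}=e_{1,\dots,k}$. Plücker setting. $\mathbb P=\mathbb P(L_{\omega_1})\times\dots\times\mathbb P(L_{\omega_{n-1}})$ has homogeneous coordinate ring $R=\mathbb C[\{X_{i_1,\dots,i_k}\}]$ ($1\le k\le n-1$, $1\le i_1<\dots<i_k\le n$), $X_{i_1,\dots,i_k}$ being the coordinate corresponding to $e_{i_1,\dots,i_k}$. $F=SL_n/B\subset\mathbb P$ is the variety of complete flags in the Plücker embedding, $I\subset R$ its ideal of Plücker relations. For integers $S=(s_{i_1,\dots,i_k})$, $\mathrm{grad}^S$ is the grading on $R$ with $\mathrm{grad}^SX_{i_1,\dots,i_k}=s_{i_1,\dots,i_k}$, $\mathrm{in}_{\mathrm{grad}^S}I$ is the ideal spanned by the nonzero components of minimal grading of elements of $I$, and $F^S\subset\mathbb P$ is the subvariety defined by $\mathrm{in}_{\mathrm{grad}^S}I$. Definition of $\sigma$: $T(i_1,\dots,i_k)\in\mathbb R^{\{1\le i<j\le n\}}$ has coordinate $1$ at each pair $(l,i_l)$ with $1\le l\le k$, $i_l>l$, and all other coordinates $0$; $\sigma(A)_{i_1,\dots,i_k}=\sum_{i<j}a_{i,j}T(i_1,\dots,i_k)_{i,j}$. Degenerate representation. For $\lambda=(a_1,\dots,a_{n-1})$ let $U_\lambda=L_{\omega_1}^{\otimes a_1}\otimes\dots\otimes L_{\omega_{n-1}}^{\otimes a_{n-1}}$; $L_\lambda\subset U_\lambda$ is the subrepresentation generated by $v_{\omega_1}^{\otimes a_1}\otimes\dots\otimes v_{\omega_{n-1}}^{\otimes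 a_{n-1}}=v_\lambda$. Setting $\mathrm{grad}^Se_{i_1,\dots,i_k}=s_{i_1,\dots,i_k}$ grades $U_\lambda$; $(U_\lambda)_{\le m}$ is spanned by homogeneous elements of degree $\le m$, $(L_\lambda)_m=L_\lambda\cap(U_\lambda)_{\le m}$, $L_\lambda^S=\bigoplus_m(L_\lambda)_m/(L_\lambda)_{m-1}$. $v_\lambda^S$ is the image of $v_\lambda\in(L_\lambda)_0$ in $(L_\lambda^S)_0$. $e^S_{i_1,\dots,i_k}$ is the image of $e_{i_1,\dots,i_k}$ in $(L_{\omega_k}^S)_{s_{i_1,\dots,i_k}}$; these form a basis of $L_{\omega_k}^S$, and $(e^S_{i_1,\dots,i_k})^*$ is the dual basis of $(L_{\omega_k}^S)^*$. $L_\lambda^S$ inherits an $\mathfrak h$-weight decomposition from $L_\lambda$. Action. $\Phi_n$ is the associative algebra generated by $\varphi_{i,j}$, $1\le i<j\le n$, with relations $\varphi_{i_1,j_1}\varphi_{i_2,j_2}=0$ whenever $i_1>i_2$ and $\varphi_{i,j_1}\varphi_{i,j_2}=\varphi_{i,j_2}\varphi_{i,j_1}$. Let $\mathfrak c(k)\subset\mathfrak h^*$ be the cone generated by $-\alpha_i$, $i\ge k$, and $L_\lambda(k)$ the sum of weight subspaces of $L_\lambda$ of weights $\mu$ with $\mu-\lambda\in\mathfrak c(k)$. $\Phi_n$ acts on $L_\lambda$: for a weight vector $v$, $\varphi_{i,j}v=f_{i,j}v$ if $v\in L_\lambda(i)$ and $\varphi_{i,j}v=0$ otherwise. For $S=\sigma(A)$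 as in the claim, $\varphi_{i,j}$ maps $(L_\lambda)_m$ into $(L_\lambda)_{m+a_{i,j}}$, inducing maps $(L_\lambda^S)_m\to(L_\lambda^S)_{m+a_{i,j}}$ and a $\Phi_n$-module structure on $L_\lambda^S$. Tensor products. On $L_\lambda^S\otimes L_\mu^S$ the algebra $\Phi_n$ acts as follows: for weight vectors $v_1,v_2$ of weights $\nu_1,\nu_2$, $\varphi_{i,j}(v_1\otimes v_2)=\varphi_{i,j}(v_1)\otimes v_2+v_1\otimes\varphi_{i,j}(v_2)$ if $\nu_1+\nu_2-(\lambda+\mu)\in\mathfrak c(i)$, and $\varphi_{i,j}(v_1\otimes v_2)=0$ otherwise. The $\Phi_n$-submodule of $L_\lambda^S\otimes L_\mu^S$ generated by $v_\lambda^S\otimes v_\mu^S$ is isomorphic to $L_{\lambda+\mu}^S$ via $v_{\lambda+\mu}^S\mapsto v_\lambda^S\otimes v_\mu^S$. The dual surjections $(L_\lambda^S)^*\otimes(L_\mu^S)^*\twoheadrightarrow(L_{\lambda+\mu}^S)^*$ define the commutative algebra structure on $\mathcal Q^S=\bigoplus_\lambda(L_\lambda^S)^*$. *)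

(* Defs.v *)
From HB Require Import structures.
From mathcomp Require Import all_boot all_order all_algebra.
From mathcomp Require Import mpoly.
From mathcomp Require Import boolp classical_sets.

Set Implicit Arguments.
Unset Strict Implicit.
Unset Printing Implicit Defensive.
Import Order.TTheory GRing.Theory Num.Theory.
Local Open Scope ring_scope.

(** * Linear algebra *)

(** Finite external direct sums of finite-dimensional spaces. *)
Section FiniteDirectSum.
Variables (K : fieldType) (I : finType) (V : I -> vectType K).

Definition dprodv : Type := {dffun forall i, V i}.
Definition dprodv_fun (x : dprodv) i : V i := x i.
Definition dprodv_of (f : forall i, V i) : dprodv := finfun f.

Lemma dprodv_ofE f i : dprodv_fun (dprodv_of f) i = f i.
Proof. exact: ffunE. Qed.

Lemma dprodvP (x y : dprodv) : (forall i, dprodv_fun x i = dprodv_fun y i) -> x = y.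
Proof. by move=> e; apply/ffunP. Qed.

HB.instance Definition _ := Choice.copy dprodv {dffun forall i, V i}.

Let add (x y : dprodv) := dprodv_of (fun i => dprodv_fun x i + dprodv_fun y i).
Let opp (x : dprodv) := dprodv_of (fun i => - dprodv_fun x i).
Let zero := dprodv_of (fun i => 0).
Let scale (c : K) (x : dprodv) := dprodv_of (fun i => c *: dprodv_fun x i).

Let addA : associative add.
Proof. by move=> x y z; apply: dprodvP => i; rewrite !dprodv_ofE addrA. Qed.
Let addC : commutative add.
Proof. by move=> x y; apply: dprodvP => i; rewrite !dprodv_ofE addrC. Qed.
Let add0 : left_id zero add.
Proof. by move=> x; apply: dprodvP => i; rewrite !dprodv_ofE add0r. Qed.
Let addN : left_inverse zero opp add.
Proof. by move=> x; apply: dprodvP => i; rewrite !dprodv_ofE addNr. Qed.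

HB.instance Definition _ := GRing.isZmodule.Build dprodv addA addC add0 addN.

Let scaleA a b x : scale a (scale b x) = scale (a * b) x.
Proof. by apply: dprodvP => i; rewrite !dprodv_ofE scalerA. Qed.
Let scale1 : left_id 1 scale.
Proof. by move=> x; apply: dprodvP => i; rewrite !dprodv_ofE scale1r. Qed.
Let scaleDr : right_distributive scale +%R.
Proof. by move=> a x y; apply: dprodvP => i; rewrite !dprodv_ofE scalerDr. Qed.
Let scaleDl x : {morph scale^~ x : a b / a + b}.
Proof. by move=> a b; apply: dprodvP => i; rewrite !dprodv_ofE scalerDl. Qed.

HB.instance Definition _ :=
  GRing.Zmodule_isLmodule.Build K dprodv scaleA scale1 scaleDr scaleDl.

Lemma dprodvD x y i : dprodv_fun (x + y) i = dprodv_fun x i + dprodv_fun y i.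
Proof. exact: dprodv_ofE. Qed.

Lemma dprodvZ c x i : dprodv_fun (c *: x) i = c *: dprodv_fun x i.
Proof. exact: dprodv_ofE. Qed.

Lemma dprodv_linear i : linear (dprodv_fun^~ i).
Proof. by move=> c x y; rewrite dprodvD dprodvZ. Qed.

Import VectorInternalTheory.

Fact dprodv_vect_axiom :
  Vector.axiom (\sum_(j < #|I|) dim (V (enum_val j))) dprodv.
Proof.
pose F (x : dprodv) := \mxrow_(j < #|I|) v2r (dprodv_fun x (enum_val j)).
pose G (r : 'rV_(\sum_(j < #|I|) dim (V (enum_val j)))) : dprodv :=
  dprodv_of (fun i =>
    ecast i (V i) (enum_rankK i) (r2v (submxrow r (enum_rank i)))).
have GE r j : dprodv_fun (G r) (enum_val j) = r2v (submxrow r j).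
  rewrite dprodv_ofE; move: (enum_rankK (enum_val j)).
  by rewrite enum_valK => e; rewrite eq_axiomK.
exists F.
  move=> c x y; apply/rowP => j.
  by rewrite !mxE dprodv_linear linearP !mxE.
exists G => [x|r].
  apply: dprodvP => i; rewrite -(enum_rankK i) GE.
  by rewrite /F mxrowK v2rK.
rewrite /F -[RHS]submxrowK; apply: eq_mxrow => j.
by rewrite GE r2vK.
Qed.

HB.instance Definition _ := Lmodule_hasFinDim.Build K dprodv dprodv_vect_axiom.

End FiniteDirectSum.

(** External direct sums over an arbitrary index type: families of finite
    support. *)
Section DirectSum.
Variables (K : nzRingType) (I : eqType) (V : I -> lmodType K).

Record dsum : Type := Dsum {
  dsum_fun :> forall i, V i;
  _ : exists s : seq I, forall i, i \notin s -> dsum_fun i = 0 }.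

Lemma dsum_supp (x : dsum) : exists s : seq I, forall i, i \notin s -> x i = 0.
Proof. by case: x. Qed.

Lemma dsumP (x y : dsum) : (forall i, x i = y i) -> x = y.
Proof.
case: x y => [f hf] [g hg] /= e.
have {}e : f = g by exact: functional_extensionality_dep.
by case: _ / e hg => hg; rewrite (Prop_irrelevance hf hg).
Qed.

HB.instance Definition _ := gen_eqMixin dsum.
HB.instance Definition _ := gen_choiceMixin dsum.

Let add_supp (x y : dsum) :
  exists s : seq I, forall i, i \notin s -> x i + y i = 0.
Proof.
have [[s hs] [t ht]] := (dsum_supp x, dsum_supp y).
exists (s ++ t) => i; rewrite mem_cat negb_or => /andP[/hs-> /ht->].
exact: addr0.
Qed.
Let opp_supp (x : dsum) : exists s : seq I, forall i, i \notin s -> - x i = 0.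
Proof. by have [s hs] := dsum_supp x; exists s => i /hs->; rewrite oppr0. Qed.
Let zero_supp : exists s : seq I, forall i, i \notin s -> (0 : V i) = 0.
Proof. by exists [::]. Qed.
Let scale_supp (c : K) (x : dsum) :
  exists s : seq I, forall i, i \notin s -> c *: x i = 0.
Proof. by have [s hs] := dsum_supp x; exists s => i /hs->; rewrite scaler0. Qed.

Let add x y := Dsum (add_supp x y).
Let opp x := Dsum (opp_supp x).
Let zero := Dsum zero_supp.
Let scale c x := Dsum (scale_supp c x).

Let addA : associative add.
Proof. by move=> x y z; apply: dsumP => i; exact: addrA. Qed.
Let addC : commutative add.
Proof. by move=> x y; apply: dsumP => i; exact: addrC. Qed.
Let add0 : left_id zero add.
Proof. by move=> x; apply: dsumP => i; exact: add0r. Qed.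
Let addN : left_inverse zero opp add.
Proof. by move=> x; apply: dsumP => i; exact: addNr. Qed.

HB.instance Definition _ := GRing.isZmodule.Build dsum addA addC add0 addN.

Let scaleA a b x : scale a (scale b x) = scale (a * b) x.
Proof. by apply: dsumP => i; exact: scalerA. Qed.
Let scale1 : left_id 1 scale.
Proof. by move=> x; apply: dsumP => i; exact: scale1r. Qed.
Let scaleDr : right_distributive scale +%R.
Proof. by move=> a x y; apply: dsumP => i; exact: scalerDr. Qed.
Let scaleDl x : {morph scale^~ x : a b / a + b}.
Proof. by move=> a b; apply: dsumP => i; exact: scalerDl. Qed.

HB.instance Definition _ :=
  GRing.Zmodule_isLmodule.Build K dsum scaleA scale1 scaleDr scaleDl.

Fact dsum_in_supp i (v : V i) : exists s : seq I, forall j, j \notin s ->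
  dfwith (fun j => 0 : V j) v j = 0.
Proof.
by exists [:: i] => j; rewrite inE => h; rewrite dfwith_out // eq_sym.
Qed.
Definition dsum_in i (v : V i) : dsum := Dsum (dsum_in_supp v).

End DirectSum.

(** The quotient [V / W] of nested subspaces [W <= V] of an ambient space,
    carried by the complement [V :\: W]; [quot_map V W] restricts to the
    projection of [V] onto [V / W], and [quot_rep] picks representatives. *)
Section Quotient.
Variables (K : fieldType) (U : vectType K) (V W : {vspace U}).

Definition quotv : Type := subvs_of (V :\: W)%VS.
HB.instance Definition _ := Vector.on quotv.

Definition quot_map : 'Hom(U, quotv) :=
  (linfun (vsproj (V :\: W)%VS) \o addv_pi1 V W)%VF.
Definition quot_rep (q : quotv) : U := vsval q.

Lemma quot_rep_mem q : quot_rep q \in V.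
Proof. exact: subvP (diffvSl V W) _ (subvsP q). Qed.

Lemma quot_repK q : quot_map (quot_rep q) = q.
Proof.
rewrite /quot_map comp_lfunE lfunE /= /quot_rep -[RHS]vsvalK; congr vsproj.
by rewrite /addv_pi1 daddv_pi_id ?subvsP // capv_diff.
Qed.

Lemma quot_map_eq0 x : (W <= V)%VS -> x \in V -> (quot_map x == 0) = (x \in W).
Proof.
move=> sWV xV; rewrite /quot_map comp_lfunE lfunE /=.
have xVW : x \in (V + W)%VS by exact: subvP (addvSl V W) _ xV.
rewrite -(inj_eq subvs_inj) vsprojK ?memv_pi // linear0.
rewrite -[in RHS](addv_pi1_pi2 xVW).
apply/eqP/idP => [->|].
  by rewrite add0r memv_pi2.
move=> x12W; apply/eqP; rewrite -memv0 -(capv_diff V W) memv_cap memv_pi /=.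
by rewrite -[X in X \in W](addrK (addv_pi2 V W x)) rpredB ?memv_pi2.
Qed.

End Quotient.

(** The tensor product, as matrices of coordinates in the standard bases. *)
Section Tensor.
Variables (K : fieldType) (V W : vectType K).

Definition tens : Type := 'M[K]_(\dim {:V}, \dim {:W}).
HB.instance Definition _ := Vector.on tens.

Definition tensv (v : V) (w : W) : tens :=
  \matrix_(i, j) (coord (vbasis {:V}) i v * coord (vbasis {:W}) j w).

(** The linear map induced by a bilinear one. *)
Definition tens_lift (Z : lmodType K) (beta : V -> W -> Z) (M : tens) : Z :=
  \sum_i \sum_j M i j *: beta (vbasis {:V})`_i (vbasis {:W})`_j.

Lemma tens_liftE (Z : lmodType K) (beta : V -> W -> Z) v w :
  (forall w, linear (beta^~ w)) -> (forall v, linear (beta v)) ->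
  tens_lift beta (tensv v w) = beta v w.
Proof.
move=> linl linr; rewrite /tens_lift.
have lin_expand (A : vectType K) (h : A -> Z) : linear h -> forall x,
    h x = \sum_i coord (vbasis {:A}) i x *: h (vbasis {:A})`_i.
  move=> hlin x; pose hL : {linear A -> Z} := HB.pack h
    (GRing.isLinear.Build _ _ _ _ h hlin).
  rewrite -[LHS]/(hL x) [in LHS](coord_vbasis (memvf x)) linear_sum /=.
  by apply: eq_bigr => i _; exact: (linearZ_LR hL).
rewrite (lin_expand _ _ (linl w)); apply: eq_bigr => i _.
rewrite (lin_expand _ _ (linr _)) scaler_sumr; apply: eq_bigr => j _.
by rewrite mxE scalerA.
Qed.

Definition tens_map (f : 'End(V)) (g : 'End(W)) : tens -> tens :=
  tens_lift (fun v w => tensv (f v) (g w)).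

End Tensor.

Section GeneratedSubmodule.
Local Open Scope classical_set_scope.
Variables (K : fieldType) (V : vectType K) (ops : set 'End(V)).

Definition stable (W : {vspace V}) := forall f, ops f -> (f @: W <= W)%VS.

Definition is_gensub (v : V) (W : {vspace V}) :=
  [/\ v \in W, stable W
    & forall W' : {vspace V}, v \in W' -> stable W' -> (W <= W')%VS].

(** The smallest subspace containing [v] and stable under [ops]. *)
Definition gensub (v : V) : {vspace V} := xget 0%VS (is_gensub v).

Lemma gensubP v : is_gensub v (gensub v).
Proof.
pose P d := `[< exists W : {vspace V}, [/\ v \in W, stable W & \dim W = d] >].
have exP : exists d, P d.
  exists (\dim {:V}); apply/asboolP; exists fullv; split => //.
    exact: memvf.
  by move=> f _; exact: subvf.
case: (ex_minnP exP) => d /asboolP [W [vW sW dW]] min_d.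
suff: is_gensub v W by exact: xgetI.
split=> // W' vW' sW'; apply/capv_idPl/eqP; rewrite eqEdim capvSl /= dW.
apply: min_d; apply/asboolP; exists (W :&: W')%VS; split=> //.
  by rewrite memv_cap vW vW'.
move=> f hf; rewrite subv_cap.
by rewrite (subv_trans (limgS f (capvSl W W')) (sW f hf))
           (subv_trans (limgS f (capvSr W W')) (sW' f hf)).
Qed.

End GeneratedSubmodule.

(** * Exterior powers

    Indices are 0-based: [i : 'I_n] stands for the index i+1 in {1, ..., n}, and
    [k : 'I_n.-1] for the fundamental weight omega_(k+1) and the simple root
    alpha_(k+1). *)

Section Exterior.
Variables (K : fieldType) (n : nat).

Definition ksub k := {I : {set 'I_n} | #|I| == k}.

(** [kth I c] is the [c]-th smallest element of [I]. *)
Definition kth k (I : ksub k) (c : 'I_k) : 'I_n :=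
  enum_val (cast_ord (esym (eqP (valP I))) c).

Fact ksub_std_card (k : 'I_n.-1) : #|[set i : 'I_n | i <= k]%N| == k.+1.
Proof.
have hk : (k.+1 <= n)%N by apply: leq_trans (ltn_ord k) (leq_pred n).
rewrite -sum1dep_card (eq_bigl (fun i : 'I_n => (i < k.+1)%N)) //.
by rewrite -(big_ord_widen n (fun=> 1%N) hk) sum1_card card_ord.
Qed.
Definition ksub_std (k : 'I_n.-1) : ksub k.+1 :=
  exist (fun I : {set 'I_n} => #|I| == k.+1) _ (ksub_std_card k).

(** Coefficient at [e_J] of [g e_I], for [g] acting on the [k]-th exterior
    power of [K^n] as a group element, resp. as a Lie algebra element. *)
Definition ext_grp k (g : 'M[K]_n) (J I : ksub k) : K :=
  \det (\matrix_(c, d < k) g (kth J c) (kth I d)).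

Definition ext_lie k (X : 'M[K]_n) (J I : ksub k) : K :=
  \sum_(e < k) \det (\matrix_(c, d < k)
    if d == e then X (kth J c) (kth I d) else (kth J c == kth I d)%:R).

(** The pairs (k, I) with I a (k+1)-subset index the Pluecker coordinates. *)
Definition pidx : finType := {k : 'I_n.-1 & ksub k.+1}.

(** The coordinates, all 0 or 1, of the point T(I). *)
Definition Tpt (x : pidx) (i j : 'I_n) : bool :=
  [exists c : 'I_(tag x).+1,
    [&& c == i :> nat, kth (tagged x) c == j & (c < kth (tagged x) c)%N]].

Definition sigma (a : nat -> nat -> int) (x : pidx) : int :=
  \sum_(i < n) \sum_(j < n | (i < j)%N) a i j * (Tpt x i j : nat)%:Z.

End Exterior.

(** * Weights *)

Section Weights.
Variables (K : numFieldType) (n : nat).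

(** Dominant integral weights, and weights, in coordinates with respect to
    the fundamental weights (i.e. by their values on the simple coroots). *)
Definition dweight := {ffun 'I_n.-1 -> nat}.
Definition weight := 'rV[K]_n.-1.

Definition dw0 : dweight := [ffun _ => 0%N].
Definition omega (k : 'I_n.-1) : dweight := [ffun j => (j == k : nat)].
Definition wt_of (l : dweight) : weight := \row_k (l k)%:R.

(** The restriction to the Cartan subalgebra of the coordinate [eps_i]. *)
Definition eps (i : nat) : weight := \row_k ((i == k)%:R - (i == k.+1)%:R).

Definition alpha (i : 'I_n.-1) : weight := eps i - eps i.+1.

Definition in_cone (k : nat) (d : weight) : Prop :=
  exists c : 'I_n.-1 -> K, (forall i, 0 <= c i) /\
    d = \sum_(i < n.-1 | (k <= i)%N) c i *: - alpha i.

End Weights.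

(** * The representations [L_lambda] *)

Section Representations.
Variables (K : numFieldType) (n : nat).
Implicit Types (l : dweight n) (X : 'M[K]_n).

(** [U_lambda] has one tensor factor for each position [(k, r)], [r < l k],
    and its standard basis consists of the choices of a basis vector [e_I] at
    each position. *)
Definition tpos l : finType := {k : 'I_n.-1 & 'I_(l k)}.
Definition tbasis l : finType := {dffun forall p : tpos l, ksub n (tag p).+1}.
Definition Urep l : vectType K := {ffun tbasis l -> K^o}.

Definition ebasis l (b : tbasis l) : Urep l :=
  [ffun b' : tbasis l => (b' == b)%:R].

Definition vhw l : Urep l := ebasis [ffun p => ksub_std (tag p)].

Definition lie_act l X : 'End(Urep l) := linfun (fun u : Urep l =>
  [ffun b' : tbasis l => \sum_b u b * \sum_(p : tpos l)
     ext_lie X (b' p) (b p) * \prod_(q | q != p) (b' q == b q)%:R]).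

Definition Lrep l : {vspace Urep l} :=
  gensub [set lie_act l X | X in [set X | \tr X = 0]]%classic (vhw l).

(** [e_I] in [U_(omega_k)], whose tensor product has a single factor. *)
Definition evec (k : 'I_n.-1) (I : ksub n k.+1) : Urep (omega k) :=
  [ffun b : tbasis (omega k) => [forall p, val (b p) == val I]%:R].

Definition wt_basis l (b : tbasis l) : weight K n :=
  \sum_p \sum_(i in val (b p)) eps K n i.

Definition wt_proj l (nu : weight K n) : 'End(Urep l) := linfun (fun u : Urep l =>
  [ffun b : tbasis l => if wt_basis b == nu then u b else 0]).

(** The weights of [U_lambda]. *)
Definition wts l : seq (weight K n) := undup (codom (@wt_basis l)).

(** The action of [varphi_(i,j)] ([f_(i,j) = E_(j,i)]). *)
Definition phi l (i j : 'I_n) : 'End(Urep l) :=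
  (lie_act l (delta_mx j i) \o
   \sum_(nu <- wts l | `[< in_cone i (nu - wt_of K l) >]) wt_proj l nu)%VF.

End Representations.

(** * The degenerate representations [L_lambda^S] *)

Section Degenerate.
Variables (K : numFieldType) (n : nat) (s : pidx n -> int).
Implicit Type l : dweight n.

Definition deg l (b : tbasis l) : int :=
  \sum_p s (Tagged (fun k : 'I_n.-1 => ksub n k.+1) (b p)).

Definition Ufil l (m : int) : {vspace Urep K l} :=
  (\sum_(b : tbasis l | (deg b <= m)%R) <[ebasis K b]>)%VS.

Definition Lfil l (m : int) : {vspace Urep K l} := (Lrep K l :&: Ufil l m)%VS.

(** The filtration only jumps at the degrees of the basis vectors, so that
    these are the only graded components that need to be summed. *)
Definition degs l : finType := seq_sub (codom (@deg l)).

Lemma Ufil_jump l m : m \notin codom (@deg l) -> Ufil l m = Ufil l (m - 1).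
Proof.
move=> hm; apply: eq_bigl => b; rewrite le_eqVlt -ltzD1 subrK.
by case: eqP => // e; rewrite -e codom_f in hm.
Qed.

Definition grcomp l (m : int) : vectType K := quotv (Lfil l m) (Lfil l (m - 1)).
Definition gr l : vectType K := dprodv (fun d : degs l => grcomp l (ssval d)).

(** The image in degree [m] of an element of [(L_lambda)_m]. *)
Definition symb l (m : int) (x : Urep K l) : gr l :=
  dprodv_of (fun d : degs l =>
    if ssval d == m then quot_map (Lfil l (ssval d)) (Lfil l (ssval d - 1)) x
    else 0).

(** The map of graded spaces induced by a map shifting the filtration by [c]. *)
Definition gr_map l (c : int) (f : 'End(Urep K l)) : 'End(gr l) :=
  linfun (fun y : gr l =>
    \sum_(d : degs l) symb (ssval d + c) (f (quot_rep (dprodv_fun y d)))).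

Lemma symb_linear l m : linear (@symb l m).
Proof.
move=> c x y; apply: dprodvP => d; rewrite dprodvD dprodvZ !dprodv_ofE.
by case: eqP => _; rewrite ?linearP // scaler0 addr0.
Qed.

Lemma Lfil_sub l m : (Lfil l (m - 1) <= Lfil l m)%VS.
Proof.
apply: capvS => //; apply/subv_sumP => b hb.
apply: (sumv_sup b) => //; apply: le_trans hb _.
by rewrite lerBlDr lerDl.
Qed.

(** [gr l] is the direct sum of the [Lfil l m / Lfil l (m - 1)]. *)
Lemma symb_eq0 l m x :
  x \in Lfil l m -> (symb m x == 0) = (x \in Lfil l (m - 1)).
Proof.
move=> hx; have [hm|hm] := boolP (m \in codom (@deg l)); last first.
  rewrite {1}/Lfil -(Ufil_jump hm) -/(Lfil l m) hx; apply/eqP/dprodvP => d.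
  rewrite dprodv_ofE; case: eqP => [e|_]; last by rewrite dprodv_ofE.
  by rewrite -e ssvalP in hm.
pose d0 : degs l := SeqSub hm.
rewrite -(quot_map_eq0 (Lfil_sub l m) hx).
apply/eqP/eqP => [/(congr1 (fun y => dprodv_fun y d0))|h].
  by rewrite !dprodv_ofE eqxx.
apply: dprodvP => d; rewrite !dprodv_ofE; case: eqP => // ->; exact: h.
Qed.

Lemma gr_sum l (y : gr l) :
  y = \sum_(d : degs l) symb (ssval d) (quot_rep (dprodv_fun y d)).
Proof.
apply: dprodvP => d.
have sumE (F : degs l -> gr l) :
    dprodv_fun (\sum_i F i) d = \sum_i dprodv_fun (F i) d.
  apply: (big_morph (fun y => dprodv_fun y d)) => [u v|]; first exact: dprodvD.
  exact: dprodv_ofE.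
rewrite sumE (bigD1 d) //= big1 => [|d' nd]; rewrite dprodv_ofE.
  by rewrite eqxx quot_repK addr0.
by rewrite ifN // (inj_eq val_inj) eq_sym.
Qed.

Lemma gr_map_symb l c (f : 'End(Urep K l)) :
    (forall p x, x \in Lfil l p -> f x \in Lfil l (p + c)) ->
  forall m x, x \in Lfil l m -> gr_map c f (symb m x) = symb (m + c) (f x).
Proof.
move=> hf m x hx; pose sL p : {linear Urep K l -> gr l} :=
  HB.pack (@symb l p) (GRing.isLinear.Build _ _ _ _ _ (@symb_linear l p)).
have symb0 p : @symb l p 0 = 0 by exact: (linear0 (sL p)).
have symbB p u v : @symb l p (u - v) = symb p u - symb p v.
  exact: (linearB (sL p)).
pose g (y : gr l) : gr l :=
  \sum_(d : degs l) symb (ssval d + c) (f (quot_rep (dprodv_fun y d))).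
have g_lin : linear g.
  move=> k y z; rewrite /g scaler_sumr -big_split /=; apply: eq_bigr => d _.
  by rewrite -symb_linear /quot_rep dprodvD dprodvZ !linearP.
pose gL : {linear gr l -> gr l} :=
  HB.pack g (GRing.isLinear.Build _ _ _ _ g g_lin).
rewrite -[LHS]/(linfun gL (symb m x)) lfunE /= /g.
have fil_symb y : y \in Lfil l (m - 1) -> symb (m + c) (f y) = 0.
  move=> hy; have hy' := subvP (Lfil_sub l m) _ hy.
  apply/eqP; rewrite symb_eq0 ?hf // addrAC; exact: hf.
have [hm|hm] := boolP (m \in codom (@deg l)); last first.
  rewrite big1 => [|d _].
    by rewrite fil_symb // -symb_eq0 //; apply/eqP/dprodvP => d;
      rewrite !dprodv_ofE; case: eqP => // e; rewrite -e ssvalP in hm.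
  rewrite dprodv_ofE; case: eqP => [e|_]; first by rewrite -e ssvalP in hm.
  by rewrite /quot_rep !linear0 symb0.
rewrite (bigD1 (SeqSub hm)) //= big1 => [|d nd].
  rewrite addr0 dprodv_ofE /= eqxx; apply/eqP; rewrite -subr_eq0 -symbB -linearB.
  have hr := quot_rep_mem (quot_map (Lfil l m) (Lfil l (m - 1)) x).
  apply/eqP/fil_symb; rewrite -(quot_map_eq0 (Lfil_sub l m)) ?rpredB //.
  by rewrite linearB /= quot_repK subrr.
rewrite dprodv_ofE ifN; first by rewrite /quot_rep !linear0 symb0.
by rewrite -(inj_eq val_inj) in nd.
Qed.

Definition vhwS l : gr l := symb 0 (vhw K l).

Definition wt_projS l (nu : weight K n) : 'End(gr l) := gr_map 0 (wt_proj l nu).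

Definition evecS (k : 'I_n.-1) (I : ksub n k.+1) : gr (omega k) :=
  symb (s (Tagged (fun k : 'I_n.-1 => ksub n k.+1) I)) (evec K I).

Definition dual l : vectType K := 'Hom(gr l, K^o).

(** The basis dual to the [evecS I]. *)
Definition edual (k : 'I_n.-1) (I : ksub n k.+1) : dual (omega k) := linfun
  (coord [tuple evecS (enum_val i) | i < #|{: ksub n k.+1}|] (enum_rank I)
     : gr (omega k) -> K^o).

End Degenerate.

(** * The algebra [Q^S], for [S = sigma A] *)

Section QAlgebra.
Variables (K : numFieldType) (n : nat) (a : nat -> nat -> int).
Implicit Types l m r : dweight n.

Local Notation S := (@sigma n a).
Local Notation gr l := (gr K S l).

Definition phiS l (i j : 'I_n) : 'End(gr l) := gr_map S (a i j) (phi K l i j).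

(** The action of [varphi_(i,j)] on a tensor product: the Leibniz rule on the
    sum of the tensor products of weight spaces whose total weight [nu] has
    [nu - (l + m)] in the i-th cone, and 0 on the others. *)
Definition phi_tens l m (i j : 'I_n) : 'End(tens (gr l) (gr m)) :=
  linfun (fun M : tens (gr l) (gr m) =>
    let N := \sum_(nu1 <- wts K l)
      \sum_(nu2 <- wts K m |
            `[< in_cone i (nu1 + nu2 - (wt_of K l + wt_of K m)) >])
        tens_map (wt_projS S l nu1) (wt_projS S m nu2) M in
    tens_map (phiS l i j) \1%VF N + tens_map \1%VF (phiS m i j) N).

(** A module over the algebra presented by the [varphi_(i,j)] is a space with
    operators, so that submodules are the subspaces stable under the operators
    and morphisms are the linear maps commuting with them.
    [theta] is the isomorphism of [L_r^S], for [r = l + m], with the submodule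
    of [L_l^S (x) L_m^S] generated by the tensor product of the highest weight
    vectors, mapping the highest weight vector to that tensor product. *)
Definition is_comul l m r (theta : 'Hom(gr r, tens (gr l) (gr m))) : Prop :=
  [/\ lker theta = 0%VS,
      limg theta = gensub
        [set f | exists i j : 'I_n, (i < j)%N /\ f = phi_tens l m i j]%classic
        (tensv (vhwS K S l) (vhwS K S m)),
      theta (vhwS K S r) = tensv (vhwS K S l) (vhwS K S m)
    & forall i j : 'I_n, (i < j)%N -> forall x,
        theta (phiS r i j x) = phi_tens l m i j (theta x)].

(** Such a [theta] is unique when it exists. *)
Definition comul l m r : 'Hom(gr r, tens (gr l) (gr m)) :=
  xget 0 (@is_comul l m r).

Definition dual_mul l m r (f : dual K S l) (g : dual K S m) : dual K S r :=
  linfun (fun x : gr r =>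
    tens_lift (fun v w => f v * g w : K^o) (comul l m r x) : K^o).

Definition QS : Type := dsum (dual K S).
HB.instance Definition _ := GRing.Lmodule.on QS.

Definition qin l (f : dual K S l) : QS := dsum_in f.

(** A pair [(l, m)] with [l + m = r] is encoded by [p] with [p k = l k]. *)
Definition splitting r : finType := {dffun forall k : 'I_n.-1, 'I_(r k).+1}.
Definition split1 r (p : splitting r) : dweight n := [ffun k => p k : nat].
Definition split2 r (p : splitting r) : dweight n := [ffun k => r k - p k]%N.

Lemma splitK r (p : splitting r) k : (split1 p k + split2 p k)%N = r k.
Proof. by rewrite !ffunE subnKC // -ltnS. Qed.

Definition qmul_fun (x y : QS) r : dual K S r :=
  \sum_(p : splitting r) dual_mul r (x (split1 p)) (y (split2 p)).

Fact qmul_supp (x y : QS) :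
  exists s : seq (dweight n), forall r, r \notin s -> qmul_fun x y r = 0.
Proof.
have null (r : dweight n) (f : gr r -> K^o) : f =1 (fun=> 0) -> linfun f = 0.
  by move=> /funext ->.
have null_lift (l m : dweight n) (M : tens (gr l) (gr m)) beta :
    (forall v w, beta v w = 0) -> tens_lift beta M = 0 :> K^o.
  by move=> b0; apply: big1 => i _; apply: big1 => j _; rewrite b0 scaler0.
have [[s hs] [t ht]] := (dsum_supp x, dsum_supp y).
exists [seq [ffun k => (l k + m k)%N] | l <- s, m <- t] => r hr.
apply: big1 => p _; apply: null => v; apply: null_lift => v1 v2.
have [sp|/hs->] := boolP (split1 p \in s); last by rewrite zero_lfunE mul0r.
have [tp|/ht->] := boolP (split2 p \in t); last by rewrite zero_lfunE mulr0.
case/negP: hr; apply/allpairsP; exists (split1 p, split2 p); split=> //=.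
by apply/ffunP => k; rewrite ffunE splitK.
Qed.

Definition qmul (x y : QS) : QS := Dsum (qmul_supp x y).

Definition qone : QS :=
  qin (linfun (coord [tuple vhwS K S (dw0 n)] ord0 : gr (dw0 n) -> K^o)).

(** The basis element [(e_I^S)^*] of the component [(L_(omega_k)^S)^*]. *)
Definition qvar (x : pidx n) : QS := qin (edual K S (tagged x)).

Definition subalgebra (P : set QS) : Prop :=
  [/\ P qone, forall c x y, P x -> P y -> P (c *: x + y)
    & forall x y, P x -> P y -> P (qmul x y)].

End QAlgebra.

(** * The Pluecker embedding and its Groebner degenerations *)

(** The coordinate ring of [P], with one variable [Xv x] for each [x]. *)
Notation pring K n := {mpoly K[#|pidx n|]}.

Section Pluecker.
Local Open Scope classical_set_scope.
Variables (K : fieldType) (n : nat).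
Implicit Types (p q : pring K n) (J : set (pring K n)).

Definition Xv (x : pidx n) : pring K n := 'X_(enum_rank x).
Definition peval (z : pidx n -> K) p : K := p.@[fun i => z (enum_val i)].

(** Points of [P] are families of lines; a rescaling of each block of
    coordinates of [z] represents the same point as [z]. *)
Definition ext (k : 'I_n.-1) : vectType K := {ffun ksub n k.+1 -> K^o}.
Definition point : Type := forall k, {W : {vspace ext k} | \dim W == 1%N}.

Definition coords (z : pidx n -> K) (k : 'I_n.-1) : ext k :=
  [ffun I => z (Tagged (fun k : 'I_n.-1 => ksub n k.+1) I)].

Definition represents (z : pidx n -> K) (P : point) : Prop :=
  forall k, coords z k != 0 /\ coords z k \in val (P k).

Definition vanishes p (P : point) : Prop :=
  forall z, represents z P -> peval z p = 0.

Definition zeros J : set point := [set P | forall p, J p -> vanishes p P].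

Definition vanishing_ideal (Z : set point) : set (pring K n) :=
  [set p | forall P, Z P -> vanishes p P].

(** The orbit of the point of highest weight vectors under [SL_n]. *)
Definition flag_variety : set point :=
  [set P | exists g : 'M[K]_n, \det g = 1 /\
    forall k, val (P k) =
      <[ [ffun J => ext_grp g J (ksub_std k)] : ext k ]>%VS].

(** All polynomials vanishing on the flag variety, i.e. on its multicone. *)
Definition pluecker_ideal : set (pring K n) := vanishing_ideal flag_variety.

Section Grading.
Variable s : pidx n -> int.

Definition mgrade (m : 'X_{1..#|pidx n|}) : int :=
  \sum_i s (enum_val i) * (m i)%:Z.

Definition gcomp (d : int) p : pring K n :=
  \sum_(m <- msupp p | mgrade m == d) p@_m *: 'X_[m].

(** [q] is the nonzero component of [p] of minimal grading. *)
Definition is_initial p q : Prop :=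
  exists d, [/\ q = gcomp d p, q != 0 & forall e, e < d -> gcomp e p = 0].

Definition ideal_span (G : set (pring K n)) : set (pring K n) :=
  [set p | exists t : seq (pring K n * pring K n),
    (forall cq, cq \in t -> G cq.2) /\ p = \sum_(cq <- t) cq.1 * cq.2].

Definition initial_ideal J : set (pring K n) :=
  ideal_span [set q | exists2 p, J p & is_initial p q].

Definition FS : set point := zeros (initial_ideal pluecker_ideal).

End Grading.
End Pluecker.

(* Main.v *)
(** With a_{i,i} = 0, conditions (a) and (b) say that a is submodular, which is
    why phi_{i,j} raises the degree by at most a_{i,j}; for strictly submodular
    a, a jump by exactly a_{i,j} forces T(I) to change by the coordinate (i,j).
    Order the factors of a monomial in the f_{i,j} by i.  Comparing with the
    strictly submodular a_{i,j} = (j - i)^2 shows that the monomials whose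
    exponents are the contents of semistandard tableaux act on the highest
    weight vector in a triangular way, also with respect to the given grading.
    The coordinates of products of minors satisfy Garnir relations, which
    express all of them through the semistandard ones.  Hence these monomials
    give a basis of L_lambda, L_lambda is spanned by the SL_n-orbit of its
    highest weight vector, each (L_lambda)_m is spanned by the monomials of
    degree at most m, and L_lambda^S is generated by its highest weight vector.

    The embedding of L_lambda^S into the graded space U_lambda commutes with the
    operators, so by this generation the comultiplication is the restriction of
    U_(lambda+mu) = U_lambda (x) U_mu.  Therefore coordinates multiply by
    juxtaposition of tensors, and Q^S is the quotient of R by the polynomials
    vanishing on the graded spaces of the L_lambda inside U_lambda.  As the
    Pluecker ideal consists of the polynomials vanishing on the L_lambda, that
    kernel is the initial ideal. *)

From HB Require Import structures.
Require Import Defs.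
From mathcomp Require Import all_boot all_order all_algebra fingroup perm.
From mathcomp Require Import mpoly classical_sets reals complex.
From mathcomp Require Import boolp zify ring.
From mathcomp Require Import fintype finset.

Set Implicit Arguments.
Unset Strict Implicit.
Unset Printing Implicit Defensive.
Import Order.TTheory GRing.Theory Num.Theory.
Local Open Scope ring_scope.

(** * Degrees of columns *)

(** No dimension or character formula enters. A vector in the hull of the [uvec l h] is determined
    by its semistandard coordinates, because the Garnir relations hold on it; the semistandard
    monomials realize every choice of these coordinates and lie in the hull, so they span it. The
    hull is described dually, by the linear relations that the [uvec l h] satisfy: closure under the
    Lie algebra then means that a polynomial in one variable that vanishes identically has vanishing
    linear coefficient.

    The obstacle is that the given [a] is only weakly submodular, so several tableaux of equal
    degree can occur in one monomial and the degree selects no leading term. Leading terms are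
    therefore taken for an auxiliary strict grading, and the filtration is treated with the
    lexicographic order: given degree first, auxiliary degree second.

    Contents of tableaux are compared through all gradings [h] at once, each [h] acting as a probe,
    which replaces bookkeeping with multisets. The comultiplication is a choice among maps with
    given properties, so such a map has to be constructed; the common shape of the operators in
    coordinates on both sides yields both its existence and its uniqueness. *)

Section ColumnDegree.
Implicit Types (a : nat -> nat -> int) (s xs ys : seq nat).

Definition offdiag a (c x : nat) : int := if (c < x)%N then a c x else 0.

(** [sigma a] as a function of the sorted list of entries, see [sigma_coldeg]. The argument [c] is
    the row of the head, which recursion on the list has to carry along. *)
Fixpoint coldeg a c s : int :=
  if s is x :: s' then offdiag a c x + coldeg a c.+1 s' else 0.

Lemma offdiag_id a c : offdiag a c c = 0.
Proof. by rewrite /offdiag ltnn. Qed.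

Lemma coldeg_iota a i s : coldeg a 0 (iota 0 i ++ s) = coldeg a i s.
Proof.
suff H c : coldeg a c (iota c i ++ s) = coldeg a (c + i) s by rewrite H.
elim: i c => [|i IH] c /=; first by rewrite addn0.
by rewrite offdiag_id add0r IH addnS.
Qed.

Lemma coldeg_nth a c s :
  coldeg a c s = \sum_(e < size s) offdiag a (c + e)%N (nth 0%N s e).
Proof.
elim: s c => [|x s IH] c /=; first by rewrite big_ord0.
rewrite big_ord_recl addn0 IH; congr (_ + _); apply: eq_bigr => e _.
by rewrite /= /bump /= add1n addnS.
Qed.

(** The hypotheses (a) and (b) of the theorem for indices below [n], merged by
    putting zeros on the diagonal. *)
Definition submod n a := forall c x, (c < x)%N -> (x.+1 < n)%N ->
  offdiag a c x + offdiag a c.+1 x.+1 <= offdiag a c x.+1 + offdiag a c.+1 x.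

Definition ssubmod n a := forall c x, (c < x)%N -> (x.+1 < n)%N ->
  offdiag a c x + offdiag a c.+1 x.+1 < offdiag a c x.+1 + offdiag a c.+1 x.

Lemma ssubmodW n a : ssubmod n a -> submod n a.
Proof. by move=> ha c x h1 h2; apply/ltW/ha. Qed.

(** The inequalities for adjacent columns x, x+1, ..., y-1 telescope. *)
Lemma submodE n a c x y : submod n a -> (c < x)%N -> (x < y)%N -> (y < n)%N ->
  offdiag a c x + offdiag a c.+1 y <= offdiag a c y + offdiag a c.+1 x.
Proof.
move=> ha cx; elim: y => // y IH; rewrite ltnS leq_eqVlt => /orP[/eqP<-|xy] yn.
  exact: ha.
have := IH xy (ltnW yn); have := ha c y (ltn_trans cx xy) yn; lia.
Qed.

Lemma ssubmodE n a c x y : ssubmod n a -> (c < x)%N -> (x < y)%N -> (y < n)%N ->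
  offdiag a c x + offdiag a c.+1 y < offdiag a c y + offdiag a c.+1 x.
Proof.
move=> ha cx; elim: y => // y IH; rewrite ltnS leq_eqVlt => /orP[/eqP<-|xy] yn.
  exact: ha.
have := IH xy (ltnW yn); have := ha c y (ltn_trans cx xy) yn; lia.
Qed.

(** The right side is the degree of the unsorted column [j :: xs ++ ys]. Sorting lets [j] pass the
    entries of [xs] one at a time, and each passage is one exchange inequality [submodE]. *)
Lemma coldeg_insert n a c xs j ys : submod n a -> path ltn c xs ->
  all (ltn^~ j) xs -> (j < n)%N ->
  coldeg a c (xs ++ j :: ys) <= offdiag a c j + coldeg a c.+1 (xs ++ ys).
Proof.
move=> ha; elim: xs c => //= x xs IH c /andP[cx hp] /andP[xj hall] jn.
have hp' : path ltn c.+1 xs.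
  by case: xs hp {IH hall} => //= y xs /andP[xy ->]; rewrite andbT; lia.
have := IH _ hp' hall jn; have := submodE ha cx xj jn; lia.
Qed.

(** A single passage already makes the inequality strict. *)
Lemma coldeg_insert_lt n a c x xs j ys : ssubmod n a -> path ltn c (x :: xs) ->
  all (ltn^~ j) (x :: xs) -> (j < n)%N ->
  coldeg a c (x :: xs ++ j :: ys) < offdiag a c j + coldeg a c.+1 (x :: xs ++ ys).
Proof.
move=> ha /= /andP[cx hp] /andP[xj hall] jn.
have hp' : path ltn c.+1 xs.
  by case: xs hp {hall} => //= y xs /andP[xy ->]; rewrite andbT; lia.
have := coldeg_insert ys (ssubmodW ha) hp' hall jn.
have := ssubmodE ha cx xj jn; lia.
Qed.

End ColumnDegree.

(** * Columns as sorted lists, and replacement of one entry *)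

Section Columns.
Variable n : nat.
Implicit Types (a : nat -> nat -> int).

Definition vals (k : nat) (I : ksub n k) : seq nat := map val (enum (val I)).

Lemma enum_sorted (A : {set 'I_n}) : sorted ltn (map val (enum A)).
Proof.
apply: (subseq_sorted ltn_trans _ (iota_ltn_sorted 0 n)).
have -> : enum A = [seq x <- enum 'I_n | x \in A] by rewrite [in RHS]enumT.
by rewrite -val_enum_ord map_subseq // filter_subseq.
Qed.

Lemma vals_sorted k (I : ksub n k) : sorted ltn (vals I).
Proof. exact: enum_sorted. Qed.

Lemma size_vals k (I : ksub n k) : size (vals I) = k.
Proof. by rewrite size_map -cardE (eqP (valP I)). Qed.

Lemma mem_vals k (I : ksub n k) (i : 'I_n) : (val i \in vals I) = (i \in val I).
Proof. by rewrite mem_map ?mem_enum //; exact: val_inj. Qed.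

Lemma vals_ltn k (I : ksub n k) x : x \in vals I -> (x < n)%N.
Proof. by case/mapP => i _ ->; exact: ltn_ord. Qed.

Lemma valsP k (I : ksub n k) x :
  x \in vals I -> exists2 i : 'I_n, i \in val I & x = val i.
Proof. by case/mapP => i; rewrite mem_enum; exists i. Qed.

Lemma kth_vals k (I : ksub n k) (c : 'I_k) : kth I c = nth 0%N (vals I) c :> nat.
Proof.
rewrite /kth /enum_val -(nth_map _ 0%N) //= -cardE.
by rewrite (eqP (valP I)).
Qed.

Lemma kth_mem k (I : ksub n k) c : kth I c \in val I.
Proof. exact: enum_valP. Qed.

Lemma kth_inj k (I : ksub n k) : injective (kth I).
Proof. by move=> c d /enum_val_inj /cast_ord_inj. Qed.

Lemma mem_kth k (I : ksub n k) i : i \in val I -> exists c, i = kth I c.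
Proof.
move=> iI; exists (cast_ord (eqP (valP I)) (enum_rank_in iI i)).
by rewrite /kth cast_ordK enum_rankK_in.
Qed.

Lemma kth_mono k (I : ksub n k) (c d : 'I_k) : (kth I c < kth I d)%N = (c < d)%N.
Proof.
have H (e f : 'I_k) : (e < f)%N -> (kth I e < kth I f)%N.
  move=> ef; rewrite !kth_vals.
  apply: (sorted_ltn_nth ltn_trans) (vals_sorted I) _ _ _ _ ef;
  by rewrite inE size_vals.
case: (ltngtP c d) => [/H->//|/H h|/val_inj->]; last by rewrite ltnn.
by apply/negbTE; rewrite -leqNgt ltnW.
Qed.

Lemma kth_ge k (I : ksub n k) (c : 'I_k) : (c <= kth I c)%N.
Proof.
case: c => c; elim: c => // c IH hc; apply: leq_ltn_trans (IH (ltnW hc)) _.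
by rewrite kth_mono.
Qed.

Lemma ksub_inj k (I J : ksub n k) : kth I =1 kth J -> I = J.
Proof.
move=> e; apply/val_inj/setP => i; apply/idP/idP => /mem_kth[c ->].
  by rewrite e kth_mem.
by rewrite -e kth_mem.
Qed.

Lemma ksub_leq k (I : ksub n k) : (k <= n)%N.
Proof. by rewrite -(eqP (valP I)) -[X in (_ <= X)%N]card_ord max_card. Qed.

Lemma sigmaE a (k : 'I_n.-1) (I : ksub n k.+1) :
  sigma a (Tagged (fun k : 'I_n.-1 => ksub n k.+1) I) =
  \sum_(c < k.+1) offdiag a c (kth I c).
Proof.
pose x : pidx n := Tagged (fun k : 'I_n.-1 => ksub n k.+1) I.
have TE i j : (Tpt x i j : nat) =
    (\sum_(c < k.+1) [&& c == i :> nat, kth I c == j & (c < kth I c)%N])%N.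
  rewrite /Tpt /=; case: existsP => [[c hc]|H].
    rewrite (bigD1 c) //= hc big1 ?addn0 // => d dc.
    apply/eqP; rewrite eqb0; apply: contra dc => /andP[/eqP e _].
    by case/andP: hc => /eqP e' _; apply/eqP/val_inj; rewrite /= e e'.
  by rewrite big1 // => c _; apply/eqP; rewrite eqb0; apply/negP => h; apply: H; exists c.
rewrite /sigma.
under eq_bigr => i _ do under eq_bigr => j _ do
  rewrite -/x TE (big_morph Posz PoszD (erefl _)) mulr_sumr.
under eq_bigr => i _ do rewrite exchange_big /=.
rewrite exchange_big /=; apply: eq_bigr => c _.
have cn : (c < n)%N by apply: leq_trans (ltn_ord c) (ksub_leq I).
rewrite (bigD1 (Ordinal cn)) //= [X in _ + X]big1 ?addr0; last first.
  move=> i /eqP ni; apply: big1 => j _; case: eqP => [e|_]; last by rewrite mulr0.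
  by case: ni; apply/val_inj; rewrite /= e.
rewrite eqxx /offdiag; case: ltnP => h.
  rewrite (bigD1 (kth I c)) //= eqxx mulr1 big1 ?addr0 // => j /andP[_ /negbTE].
  by rewrite eq_sym => ->; rewrite mulr0.
by apply: big1 => j _; rewrite andbF mulr0.
Qed.

Lemma sigma_coldeg a (k : 'I_n.-1) (I : ksub n k.+1) :
  sigma a (Tagged (fun k : 'I_n.-1 => ksub n k.+1) I) = coldeg a 0 (vals I).
Proof.
rewrite sigmaE coldeg_nth size_vals; apply: eq_bigr => c _.
by rewrite add0n kth_vals.
Qed.

Lemma kth_eq k (I : ksub n k) (f : 'I_k -> 'I_n) :
  (forall c d : 'I_k, (c < d)%N -> (f c < f d)%N) -> (forall c, f c \in val I) ->
  forall c, kth I c = f c.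
Proof.
move=> fm fI.
have f_inj : injective f.
  move=> c d e; apply/val_inj; case: (ltngtP c d) => // /fm; by rewrite e ltnn.
have fE : f @: setT = val I.
  apply/eqP; rewrite eqEcard (eqP (valP I)) card_imset // cardsT card_ord leqnn andbT.
  by apply/subsetP => _ /imsetP[c _ ->].
have e : vals I = map (fun c => val (f c)) (enum 'I_k).
  apply: (irr_sorted_eq ltn_trans ltnn (vals_sorted I)) => [|x].
    rewrite sorted_map; have := iota_ltn_sorted 0 k.
    rewrite -val_enum_ord sorted_map; apply: sub_sorted => c d; exact: fm.
  apply/idP/mapP => [/valsP[y]|[c _ ->]]; last by rewrite mem_vals.
  by rewrite -fE => /imsetP[c _ ->] ->; exists c; rewrite ?mem_enum.
move=> c; apply/val_inj; rewrite /= kth_vals e (nth_map c) ?size_enum_ord //.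
by rewrite nth_ord_enum.
Qed.

Section Move.
Variables (k : nat) (I I' : ksub n k) (i j : 'I_n).
Hypotheses (iI : i \in val I) (jI : j \notin val I) (ij : (i < j)%N).
Hypothesis (eI' : val I' = j |: (val I :\ i)).
Hypothesis low : forall x : 'I_n, (x < i)%N -> x \in val I.

Let xs := [seq x <- vals I | (i < x < j)%N].
Let ys := [seq x <- vals I | (j < x)%N].

(** By [low] the entry [i] stands in row [i]. Replacing it by [j] moves up by one row exactly the
    entries [xs] strictly between [i] and [j], and leaves all others in place. *)
Lemma move_split : vals I = iota 0 i ++ (i : nat) :: xs ++ ys /\
  vals I' = iota 0 i ++ xs ++ (j : nat) :: ys.
Proof.
have sxs : sorted ltn xs by apply: (sorted_filter ltn_trans); exact: vals_sorted.
have sys : sorted ltn ys by apply: (sorted_filter ltn_trans); exact: vals_sorted.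
have pj : path ltn j ys.
  by rewrite (path_sortedE ltn_trans) sys andbT; apply/allP => x;
     rewrite mem_filter => /andP[].
have sxy : sorted ltn (xs ++ ys).
  rewrite sorted_pairwise ?pairwise_cat; last exact: ltn_trans.
  rewrite -!(sorted_pairwise ltn_trans) sxs sys !andbT.
  by apply/allrelP => x y; rewrite !mem_filter /= => /andP[/andP[_ h] _] /andP[h' _];
     apply: ltn_trans h h'.
have sxjy : sorted ltn (xs ++ (j : nat) :: ys).
  rewrite sorted_pairwise ?pairwise_cat; last exact: ltn_trans.
  rewrite -!(sorted_pairwise ltn_trans) sxs /= pj !andbT.
  apply/allrelP => x y; rewrite inE !mem_filter /= => /andP[/andP[_ h] _].
  by case/predU1P => [->//|/andP[h' _]]; apply: ltn_trans h h'.
have siota s : sorted ltn s -> all (leq i) s -> sorted ltn (iota 0 i ++ s).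
  move=> ss hs; rewrite sorted_pairwise ?pairwise_cat; last exact: ltn_trans.
  rewrite -!(sorted_pairwise ltn_trans) ss iota_ltn_sorted !andbT.
  apply/allrelP => x y; rewrite mem_iota add0n => /andP[_ h] /(allP hs) h'.
  exact: leq_trans h h'.
have irr : irreflexive ltn by exact: ltnn.
split; apply: (irr_sorted_eq ltn_trans irr (vals_sorted _)).
- apply: siota.
    rewrite /= (path_sortedE ltn_trans) sxy andbT; apply/allP => x.
    by rewrite mem_cat !mem_filter => /orP[/andP[/andP[]]//|/andP[h _]];
       apply: ltn_trans ij h.
  rewrite /= leqnn; apply/allP => x.
  by rewrite mem_cat !mem_filter => /orP[/andP[/andP[/ltnW]]//|/andP[h _]];
     apply: ltnW; apply: ltn_trans ij h.
- move=> x; rewrite mem_cat inE mem_cat !mem_filter mem_iota add0n /=.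
  case: (ltngtP x i) => h /=; rewrite ?orbF.
  + have xn : (x < n)%N by apply: ltn_trans h (ltn_ord i).
    by rewrite -[x]/(val (Ordinal xn)) mem_vals low.
  + case: (ltngtP x j) => h' //=; rewrite ?orbF // h' mem_vals; exact/negbTE.
  + by rewrite h mem_vals.
- apply: siota => //; apply/allP => x.
  rewrite mem_cat inE !mem_filter => /or3P[/andP[/andP[/ltnW]]//|/eqP->|/andP[h _]].
    exact: ltnW.
  by apply: ltnW; apply: ltn_trans ij h.
- move=> x; rewrite mem_cat mem_cat inE !mem_filter mem_iota add0n /=.
  have memE : (x \in vals I') = (x == j) || ((x != i) && (x \in vals I)).
    have [xn|xn] := ltnP x n; last first.
      have hv k' (L : ksub n k') : x \in vals L = false.
        by apply/negP => /vals_ltn; rewrite ltnNge xn.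
      by rewrite !hv andbF orbF; apply/esym/negP => /eqP e; move: xn; rewrite e leqNgt ltn_ord.
    by rewrite -[x]/(val (Ordinal xn)) !mem_vals eI' !inE.
  rewrite memE; case: (ltngtP x i) => h /=; rewrite ?orbF.
  + have xn : (x < n)%N by apply: ltn_trans h (ltn_ord i).
    by rewrite -[x]/(val (Ordinal xn)) mem_vals low ?orbT.
  + by case: (ltngtP x j) => h' /=; rewrite ?orbF ?orbT ?andbT.
  + by rewrite h [(j < i)%N]ltnNge (ltnW ij) orbF.
Qed.

Let path_xs : path ltn i xs.
Proof.
rewrite (path_sortedE ltn_trans) sorted_filter ?vals_sorted ?andbT //; last exact: ltn_trans.
by apply/allP => x; rewrite mem_filter => /andP[/andP[]].
Qed.

Let all_xs : all (ltn^~ (j : nat)) xs.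
Proof. by apply/allP => x; rewrite mem_filter => /andP[/andP[]]. Qed.

(** Writing [j] in the place of [i] would change the degree by exactly [a i j]; sorting the column
    afterwards can only lower it. *)
Lemma move_le a : submod n a -> coldeg a 0 (vals I') <= a i j + coldeg a 0 (vals I).
Proof.
move=> ha; have [-> ->] := move_split; rewrite !coldeg_iota /= offdiag_id add0r.
by have := coldeg_insert ys ha path_xs all_xs (ltn_ord j); rewrite {1}/offdiag ij.
Qed.

(** Under strictness equality leaves no entry between [i] and [j], so the replacement needs no
    sorting. *)
Lemma move_eq a : ssubmod n a ->
  coldeg a 0 (vals I') = a i j + coldeg a 0 (vals I) ->
  exists zs, vals I = iota 0 i ++ (i : nat) :: zs /\
             vals I' = iota 0 i ++ (j : nat) :: zs.
Proof.
move=> ha; have [-> ->] := move_split.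
rewrite !coldeg_iota /= !offdiag_id !add0r.
move: path_xs all_xs; case: xs => [|x xs'] pxs axs /= e; first by exists ys.
move: e; have := coldeg_insert_lt ys ha pxs axs (ltn_ord j).
by rewrite [offdiag a i j]/offdiag ij /= => /lt_eqF/eqP.
Qed.

End Move.
End Columns.

(** * Minors and Garnir relations *)

Section Garnir.
Variable K : comNzRingType.

Lemma sum_perm_det k (Z : 'M[K]_k) :
  \sum_(s : 'S_k) (-1) ^+ s * (\prod_t Z (s t) t) = \det Z.
Proof. by rewrite -det_tr; apply: eq_bigr => s _; congr (_ * _); apply: eq_bigr => t _; rewrite mxE. Qed.

End Garnir.

Section GarnirField.
Variable K : fieldType.

Lemma det_mul_narrow k m (Y : 'M[K]_(k, m)) (V : 'M_(m, k)) : (m < k)%N ->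
  \det (Y *m V) = 0.
Proof.
move=> mk; apply/eqP; rewrite -[_ == 0]negbK -unitfE -unitmxE -row_full_unit.
by rewrite /row_full neq_ltn (leq_ltn_trans (mulmx_max_rank _ _)).
Qed.

Variables (c m m' : nat).
Variables (P : 'M[K]_(c, c + m)) (Y : 'M[K]_(c.+1 + m, c + m)).
Variables (E : 'M[K]_(c + m, c.+1 + m')) (Q : 'M[K]_(m', c.+1 + m')).

(** The product of the minors of two columns of heights c+m and c+1+m' that exchange the c+1+m rows
    of [Y]. The first keeps its upper rows [P], the second its lower rows [Q]; [E] adapts the row
    length to the second minor. *)
Definition garnir_term (s : 'S_(c.+1 + m)) : K :=
  \det (col_mx P (dsubmx (row_perm s Y))) *
  \det (col_mx (usubmx (row_perm s Y) *m E) Q).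

(** Expanding both determinants turns the alternating sum into a combination of
    determinants of [Y *m V], with more rows than the rank of [Y]. *)
Lemma garnir_sum : \sum_(s : 'S_(c.+1 + m)) (-1) ^+ s * garnir_term s = 0.
Proof.
pose C (t : 'S_(c + m)) (r : 'S_(c.+1 + m')) : K := (-1) ^+ t * (-1) ^+ r *
  ((\prod_i P i (t (lshift m i))) * \prod_i Q i (r (rshift c.+1 i))).
pose V (t : 'S_(c + m)) (r : 'S_(c.+1 + m')) : 'M[K]_(c + m, c.+1 + m) :=
  row_mx (\matrix_(x, i) E x (r (lshift m' i)))
         (\matrix_(x, i) (x == t (rshift c i))%:R).
transitivity (\sum_(s : 'S_(c.+1 + m)) \sum_t \sum_r
    C t r * ((-1) ^+ s * \prod_i (Y *m V t r) (s i) i)).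
  apply: eq_bigr => s _; rewrite /garnir_term /determinant big_distrlr mulr_sumr.
  apply: eq_bigr => t _; rewrite mulr_sumr; apply: eq_bigr => r _.
  rewrite !big_split_ord /=.
  under eq_bigr do rewrite col_mxEu.
  under [X in _ * (_ * (_ * X) * _)]eq_bigr do rewrite col_mxEd !mxE.
  under [X in _ * (_ * (_ * (X * _)))]eq_bigr do rewrite col_mxEu mxE.
  under [X in _ * (_ * (_ * (_ * X)))]eq_bigr do rewrite col_mxEd.
  rewrite /C.
  have -> : \prod_i (Y *m V t r) (s (lshift m i)) (lshift m i) =
     \prod_i \sum_j usubmx (row_perm s Y) i j * E j (r (lshift m' i)).
    apply: eq_bigr => i _; rewrite mxE; apply: eq_bigr => j _.
    by rewrite row_mxEl !mxE.
  have -> : \prod_i (Y *m V t r) (s (rshift c.+1 i)) (rshift c.+1 i) =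
     \prod_i Y (s (rshift c.+1 i)) (t (rshift c i)).
    apply: eq_bigr => i _; rewrite mxE (bigD1 (t (rshift c i))) //=.
    rewrite row_mxEr mxE eqxx mulr1 big1 ?addr0 // => j /negbTE ne.
    by rewrite row_mxEr mxE ne mulr0.
  set a1 := (-1) ^+ s; set a2 := (-1) ^+ t; set a3 := (-1) ^+ r.
  set b1 := \prod_i _; set b2 := \prod_i _; set b3 := \prod_i _; set b4 := \prod_i _.
  by ring.
rewrite exchange_big big1 // => t _; rewrite exchange_big big1 // => r _.
by rewrite -mulr_sumr sum_perm_det det_mul_narrow ?mulr0 // addSn.
Qed.

(** By counting, such an [s] preserves both blocks of rows, so its permutation matrix is block
    diagonal. The determinants of the two blocks multiply to the sign of [s], which cancels against
    the sign in front. *)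
Lemma garnir_block (s : 'S_(c.+1 + m)) :
  (forall t : 'I_m, c.+1 <= s (rshift c.+1 t))%N ->
  (-1) ^+ s * garnir_term s =
  \det (col_mx P (dsubmx Y)) * \det (col_mx (usubmx Y *m E) Q).
Proof.
move=> hs.
pose M := perm_mx s : 'M[K]_(c.+1 + m).
have dl0 : dlsubmx M = 0.
  apply/matrixP => i j; rewrite !mxE; case: eqP => // e.
  by have := hs i; rewrite e /= leqNgt ltn_ord.
have ur0 : ursubmx M = 0.
  apply/matrixP => i j; rewrite !mxE; case: eqP => // e.
  pose T := [set rshift c.+1 t | t : 'I_m].
  have sT : s @: T = T.
    have cT : #|s @: T| = #|T| by apply: card_imset; exact: perm_inj.
    apply/eqP; rewrite eqEcard cT leqnn andbT.
    apply/subsetP => _ /imsetP[_ /imsetP[t _ ->] ->].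
    have := hs t; case: (split_ordP (s (rshift c.+1 t))) => u -> /=.
      by rewrite leqNgt ltn_ord.
    by move=> _; apply/imsetP; exists u.
  have : s (lshift m i) \in s @: T by rewrite sT e; apply/imsetP; exists j.
  rewrite mem_imset; last exact: perm_inj.
  by case/imsetP => u _ /eqP; rewrite eq_lrshift.
have eM : M = block_mx (ulsubmx M) 0 0 (drsubmx M) by rewrite -ur0 -dl0 submxK.
have sM : (-1) ^+ s = \det (ulsubmx M) * \det (drsubmx M).
  by rewrite -det_perm -/M {1}eM det_ublock.
have eY : row_perm s Y = col_mx (ulsubmx M *m usubmx Y) (drsubmx M *m dsubmx Y).
  rewrite row_permE -/M {1}eM -{1}[Y]vsubmxK mul_block_col !mul0mx.
  by rewrite addr0 add0r.
rewrite /garnir_term eY col_mxKu col_mxKd.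
have -> : col_mx P (drsubmx M *m dsubmx Y) =
    block_mx 1%:M 0 0 (drsubmx M) *m col_mx P (dsubmx Y).
  by rewrite mul_block_col !mul0mx mul1mx addr0 add0r.
have -> : col_mx (ulsubmx M *m usubmx Y *m E) Q =
    block_mx (ulsubmx M) 0 0 1%:M *m col_mx (usubmx Y *m E) Q.
  by rewrite mul_block_col !mul0mx mul1mx addr0 add0r mulmxA.
rewrite !det_mulmx !det_ublock !det1 mul1r mulr1.
have : (-1) ^+ s * (-1) ^+ s = 1 :> K by rewrite -expr2 sqrr_sign.
rewrite {2}sM => e1.
rewrite -[RHS]mul1r -[X in _ = X * _]e1; move: (_ ^+ _) (\det _) (\det _) (\det _) (\det _).
by move=> x1 x2 x3 x4 x5; ring.
Qed.

End GarnirField.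

(** * Cauchy-Binet and the exchange relation for two columns *)

Section Minors.
Variables (n : nat).

Lemma inj_sort k (f : 'I_k -> 'I_n) : injective f ->
  exists (I : ksub n k) (s : 'S_k), forall c, f c = kth I (s c).
Proof.
move=> fi; have cI : #|[set f c | c : 'I_k]| == k by rewrite card_imset ?card_ord.
pose I : ksub n k := exist (fun I : {set 'I_n} => #|I| == k) _ cI.
have h c : exists d, f c == kth I d.
  have /mem_kth[d ->] : f c \in val I by apply/imsetP; exists c.
  by exists d.
pose s0 c := xchoose (h c).
have hs c : f c = kth I (s0 c) by apply/eqP; exact: xchooseP (h c).
have s0i : injective s0 by move=> c d e; apply: fi; rewrite !hs e.
by exists I, (perm s0i) => c; rewrite permE hs.
Qed.

Lemma sum_inj_ksub (V : nmodType) k (F : {ffun 'I_k -> 'I_n} -> V) :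
  (forall f : {ffun 'I_k -> 'I_n}, ~ injective f -> F f = 0) ->
  \sum_f F f = \sum_(I : ksub n k) \sum_(s : 'S_k) F [ffun c => kth I (s c)].
Proof.
move=> F0; pose G (x : ksub n k * 'S_k) : {ffun 'I_k -> 'I_n} := [ffun c => kth x.1 (x.2 c)].
have Gi : injective G.
  move=> [I s] [J t] /ffunP e; have {}e c : kth I (s c) = kth J (t c).
    by have := e c; rewrite !ffunE.
  have IJ : I = J.
    apply/val_inj/setP => x; apply/idP/idP => /mem_kth[c ->].
      by rewrite -[c](permKV s) e kth_mem.
    by rewrite -[c](permKV t) -e kth_mem.
  congr (_, _) => //; apply/permP => c; apply: (@kth_inj _ _ I); rewrite e IJ //.
rewrite pair_bigA /=.
rewrite (bigID (mem (G @: setT))) /= [X in _ + X]big1 ?addr0; last first.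
  move=> f nf; apply: F0 => fi; case/negP: nf; have [I [s e]] := inj_sort fi.
  by apply/imsetP; exists (I, s) => //; apply/ffunP => c; rewrite ffunE e.
rewrite big_imset /=; last by move=> x y _ _; exact: Gi.
by apply: eq_big => [x|x _]; rewrite ?inE.
Qed.

Section Ring.
Variable K : comNzRingType.
Implicit Types (h : 'I_n -> nat -> K).

Definition rowdet h k (f : 'I_k -> 'I_n) : K := \det (\matrix_(r < k, s < k) h (f r) s).
Definition minor h k (I : ksub n k) : K := rowdet h (kth I).

Lemma eq_rowdet h k (f g : 'I_k -> 'I_n) : f =1 g -> rowdet h f = rowdet h g.
Proof. by move=> e; congr (\det _); apply/matrixP => r s; rewrite !mxE e. Qed.

Lemma rowdet_perm h k (f : 'I_k -> 'I_n) (s : 'S_k) :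
  rowdet h (f \o s) = (-1) ^+ s * rowdet h f.
Proof.
rewrite /rowdet -det_perm -det_mulmx -row_permE; congr (\det _).
by apply/matrixP => i j; rewrite !mxE.
Qed.

Lemma rowdet_ninj h k (f : 'I_k -> 'I_n) : ~ injective f -> rowdet h f = 0.
Proof.
move=> nf; have [r1 [r2 [ne e]]] : exists r1 r2, r1 != r2 /\ f r1 = f r2.
  apply: contra_notP nf => nf r1 r2 e; apply/eqP; apply/negPn/negP => ne.
  by apply: nf; exists r1, r2.
by apply: (determinant_alternate ne) => s; rewrite !mxE e.
Qed.

(** Both sides are the expansion over all maps from the rows to ['I_n]: the non-injective ones
    contribute nothing, and an injective one is a subset together with a permutation. *)
Lemma cauchy_binet k (A : 'I_k -> 'I_n -> K) h :
  \sum_(I : ksub n k) \det (\matrix_(c < k, d < k) A c (kth I d)) * minor h I =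
  \det (\matrix_(c < k, s < k) \sum_x A c x * h x s).
Proof.
transitivity (\sum_(f : {ffun 'I_k -> 'I_n}) (\prod_c A c (f c)) * rowdet h f).
  rewrite sum_inj_ksub => [|f nf]; last by rewrite rowdet_ninj ?mulr0.
  apply: eq_bigr => I _; rewrite mulr_suml; apply: eq_bigr => s _.
  rewrite (@eq_rowdet _ _ _ (kth I \o s)) => [|c]; last by rewrite ffunE.
  rewrite rowdet_perm mulrCA mulrA; congr (_ * _); congr (_ * _).
  by apply: eq_bigr => c _; rewrite mxE ffunE.
under eq_bigr do rewrite /rowdet /determinant mulr_sumr.
rewrite exchange_big; apply: eq_bigr => s _ /=.
under [X in _ = _ * X]eq_bigr do rewrite mxE.
rewrite bigA_distr_bigA mulr_sumr; apply: eq_bigr => f _.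
rewrite mulrCA big_split; congr (_ * (_ * _)).
by apply: eq_bigr => c _; rewrite mxE.
Qed.

End Ring.

Definition colsum k (I : ksub n k) : nat := (\sum_(c < k) kth I c)%N.

Section TwoColumns.
Variable K : numFieldType.
Implicit Types (h : 'I_n -> nat -> K).

Lemma rowdet_sort k (I0 : ksub n k) (f : 'I_k -> 'I_n) :
  exists I : ksub n k, exists e : K, (forall h, rowdet h f = e * minor h I) /\
    (e != 0 -> (\sum_c f c = colsum I)%N).
Proof.
have [fi|nf] := EM (injective f); last first.
  by exists I0, 0; split=> [h|]; rewrite ?eqxx // rowdet_ninj ?mul0r.
have [I [s e]] := inj_sort fi; exists I, ((-1) ^+ s); split=> [h|_].
  by rewrite -rowdet_perm; apply: eq_rowdet.
by rewrite /colsum [RHS](reindex_inj (@perm_inj _ s)); apply: eq_bigr => c _; rewrite e.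
Qed.

(** Let T be the tail and S its image. The sets S minus T and T minus S have equal size, and the
    largest value [th0] of [y] on the first lies below all values on the second; the first is
    nonempty because of [t0]. *)
Lemma sum_tail_lt c m (y : 'I_(c + m) -> nat) (s : 'S_(c + m)) (t0 : 'I_m) :
  (forall i j : 'I_(c + m), (i < j)%N -> (y i < y j)%N) ->
  (s (rshift c t0) < c)%N ->
  (\sum_(t < m) y (s (rshift c t)) < \sum_(t < m) y (rshift c t))%N.
Proof.
move=> ym st0; pose T := [set rshift c t | t : 'I_m].
have -> : (\sum_(t < m) y (rshift c t) = \sum_(i in T) y i)%N.
  rewrite big_imset /=; last by move=> x y' _ _; exact: rshift_inj.
  by apply: eq_bigl => t; rewrite ?inE.
have -> : (\sum_(t < m) y (s (rshift c t)) = \sum_(i in s @: T) y i)%N.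
  rewrite big_imset /=; last by move=> x y' _ _; exact: perm_inj.
  rewrite big_imset /=; last by move=> x y' _ _; exact: rshift_inj.
  by apply: eq_bigl => t; rewrite ?inE.
set S := s @: T.
have memT i : (i \in T) = (c <= i)%N.
  apply/imsetP/idP => [[t _ ->]|]; first by rewrite /= leq_addr.
  by case: (split_ordP i) => t -> /=; [rewrite leqNgt ltn_ord|exists t].
rewrite (big_setID T) [X in (_ < X)%N](big_setID S) /= setIC ltn_add2l.
have cST : #|S :\: T| = #|T :\: S|.
  have cS : #|S| = #|T| by rewrite card_imset //; exact: perm_inj.
  by apply/eqP; rewrite -(eqn_add2l #|S :&: T|) cardsID setIC cardsID cS.
have mem0 : s (rshift c t0) \in S :\: T.
  by rewrite inE memT -ltnNge st0 /=; apply/imset_f/imset_f.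
pose th0 := (\max_(i in S :\: T) y i)%N.
apply: (@leq_ltn_trans (#|S :\: T| * th0)).
  by rewrite -sum_nat_const; apply: leq_sum => i iS; apply: leq_bigmax_cond.
have gt_th0 i : i \in T -> (th0 < y i)%N.
  have cp : (0 < #|S :\: T|)%N by apply/card_gt0P; exists (s (rshift c t0)).
  move=> iT; have [j] := eq_bigmax_cond y cp.
  rewrite inE memT -ltnNge /th0 => /andP[jc _] ->; apply: ym.
  by apply: leq_trans jc _; rewrite -memT.
rewrite cST; apply: (@leq_trans (#|T :\: S| * th0.+1)).
  rewrite ltn_pmul2l // -cST; apply/card_gt0P; by exists (s (rshift c t0)).
rewrite -sum_nat_const; apply: leq_sum => i; rewrite inE => /andP[_ iT]; exact: gt_th0.
Qed.

(** The Garnir relation at the violating row c: rows 0 to c of [J] and the rows of [I] from c on are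
    exchanged. Permutations preserving the two groups reproduce the given product; every other one
    brings a smaller total into the first column, while the total over both columns is constant. *)
Lemma two_columns p q (I : ksub n p) (J : ksub n q) (ci : 'I_p) (cj : 'I_q) :
  (q <= p)%N -> ci = cj :> nat -> (kth J cj < kth I ci)%N ->
  exists (T : finType) (e : T -> K) (I' : T -> ksub n p) (J' : T -> ksub n q),
  (forall h, minor h I * minor h J =
     \sum_t e t * (minor h (I' t) * minor h (J' t))) /\
  forall t, e t != 0 -> (colsum (I' t) < colsum I)%N /\
     (colsum (I' t) + colsum (J' t) = colsum I + colsum J)%N.
Proof.
move=> qp eij viol.
have [m em] : exists m, p = (ci + m)%N.
  by exists (p - ci)%N; rewrite subnKC // ltnW.
have [m' em'] : exists m', q = (ci.+1 + m')%N.
  by exists (q - ci.+1)%N; rewrite subnKC // eij.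
have [c [ec1 ec2]] : exists c, c = nat_of_ord ci /\ c = nat_of_ord cj by exists ci.
rewrite -ec1 in em em'.
subst p q; clear eij.
have m_gt0 : (0 < m)%N by have := ltn_ord ci; rewrite -ec1; lia.
pose y (t : 'I_(c.+1 + m)) := match split t with
  | inl t => kth J (lshift m' t) | inr t => kth I (rshift c t) end.
have yl t : y (lshift m t) = kth J (lshift m' t) by rewrite /y (unsplitK (inl t)).
have yr t : y (rshift c.+1 t) = kth I (rshift c t) by rewrite /y (unsplitK (inr t)).
(* The violation says exactly that the last exchanged entry of [J] precedes the first one of [I], so
   the exchanged entries form one increasing chain. *)
have y_mono (i j : 'I_(c.+1 + m)) : (i < j)%N -> (y i < y j)%N.
  case: (split_ordP i) => i' ->; case: (split_ordP j) => j' ->; rewrite ?yl ?yr /=.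
  - by rewrite kth_mono.
  - move=> _; apply: leq_ltn_trans (leq_trans viol _).
      by rewrite leqNgt kth_mono /= -leqNgt -ec2 -ltnS.
    by rewrite leqNgt kth_mono /= -leqNgt -ec1 leq_addr.
  - by move=> h; have := ltn_ord j'; lia.
  - by rewrite kth_mono /=; lia.
pose f1 (s : 'S_(c.+1 + m)) (r : 'I_(c + m)) := match split r with
  | inl r => kth I (lshift m r) | inr r => y (s (rshift c.+1 r)) end.
pose f2 (s : 'S_(c.+1 + m)) (r : 'I_(c.+1 + m')) := match split r with
  | inl r => y (s (lshift m r)) | inr r => kth J (rshift c.+1 r) end.
pose P h : 'M[K]_(c, c + m) := \matrix_(r, s) h (kth I (lshift m r)) s.
pose Y h : 'M[K]_(c.+1 + m, c + m) := \matrix_(t, s) h (y t) s.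
pose E : 'M[K]_(c + m, c.+1 + m') := \matrix_(s, s') (s == s' :> nat)%:R.
pose Q h : 'M[K]_(m', c.+1 + m') := \matrix_(r, s) h (kth J (rshift c.+1 r)) s.
have YE h t (s' : 'I_(c.+1 + m')) :
    \sum_j Y h t j * E j s' = h (y t) s'.
  have hs : (s' < c + m)%N by apply: leq_trans (ltn_ord s') qp.
  rewrite (bigD1 (Ordinal hs)) //= !mxE eqxx mulr1 big1 ?addr0 // => j ne.
  rewrite !mxE; case: eqP => [e|]; last by rewrite mulr0.
  by case/eqP: ne; apply/val_inj.
have termE h s : garnir_term (P h) (Y h) E (Q h) s = rowdet h (f1 s) * rowdet h (f2 s).
  rewrite /garnir_term /rowdet; congr (_ * _); congr (\det _); apply/matrixP => r k; rewrite !mxE.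
    by rewrite /f1; case: splitP => j _; rewrite !mxE.
  rewrite /f2; case: splitP => j _; rewrite !mxE //.
  by rewrite -YE; apply: eq_bigr => x _; rewrite !mxE.
pose H := [pred s : 'S_(c.+1 + m) | [forall t : 'I_m, c.+1 <= s (rshift c.+1 t)]%N].
have blockE h s : H s ->
    (-1) ^+ s * garnir_term (P h) (Y h) E (Q h) s = minor h I * minor h J.
  move=> /forallP hs; rewrite garnir_block // /minor /rowdet; congr (_ * _); congr (\det _).
    apply/matrixP => r k; rewrite !mxE; case: split_ordP => j ->; rewrite !mxE //.
    by rewrite yr.
  apply/matrixP => r k; rewrite !mxE; case: split_ordP => j ->; rewrite !mxE //.
  rewrite -yl -YE; apply: eq_bigr => x _; by rewrite !mxE.
have [I' hI'] := fin_all_exists (fun s => rowdet_sort I (f1 s)).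
have [e1 {}hI'] := fin_all_exists hI'.
have [J' hJ'] := fin_all_exists (fun s => rowdet_sort J (f2 s)).
have [e2 {}hJ'] := fin_all_exists hJ'.
(* The given product occurs once for each block-preserving permutation; characteristic zero allows
   division by their number. *)
pose N : K := #|H|%:R.
have N0 : N != 0.
  rewrite pnatr_eq0 -lt0n; apply/card_gt0P; exists 1%g; rewrite inE.
  by apply/forallP => t; rewrite perm1 /= leq_addr.
exists 'S_(c.+1 + m), (fun s => if H s then 0 else - N^-1 * ((-1) ^+ s * (e1 s * e2 s))), I', J'.
split=> [h|s].
  have := garnir_sum (P h) (Y h) E (Q h); rewrite (bigID H) /=.
  under eq_bigr => s hs do rewrite blockE //.
  rewrite sumr_const -[in X in X + _]mulr_natl => /(canRL (addrK _)).
  rewrite sub0r => e.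
  apply: (mulfI N0); rewrite -/N in e; rewrite e.
  rewrite [in RHS](bigID H) /= [X in _ = _ * (X + _)]big1 => [|s ->]; last by rewrite mul0r.
  rewrite add0r mulr_sumr -sumrN; apply: eq_bigr => s /negbTE ->.
  rewrite termE (hI' s).1 (hJ' s).1 !mulrA mulrN mulfV // mulN1r.
  by rewrite !mulNr; congr (- _); rewrite -!mulrA; congr (_ * (_ * _)); rewrite mulrCA.
case: ifP => [|/negbT]; first by rewrite eqxx.
case/forallPn => t0; rewrite -ltnNge => ht0 e0.
have n1 : e1 s != 0 by apply: contra_neq e0 => ->; rewrite mul0r !mulr0.
have n2 : e2 s != 0 by apply: contra_neq e0 => ->; rewrite !mulr0.
rewrite -((hI' s).2 n1) -((hJ' s).2 n2).
have s1 : (\sum_r f1 s r = \sum_(r < c) kth I (lshift m r) +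
    \sum_(t < m) y (s (rshift c.+1 t)))%N.
  rewrite big_split_ord /=; congr (_ + _)%N; apply: eq_bigr => r _.
    by rewrite /f1 (unsplitK (inl r)).
  by rewrite /f1 (unsplitK (inr r)).
have s2 : (\sum_r f2 s r = \sum_(t < c.+1) y (s (lshift m t)) +
    \sum_(t < m') kth J (rshift c.+1 t))%N.
  rewrite big_split_ord /=; congr (_ + _)%N; apply: eq_bigr => r _.
    by rewrite /f2 (unsplitK (inl r)).
  by rewrite /f2 (unsplitK (inr r)).
have s3 : (colsum I = \sum_(r < c) kth I (lshift m r) +
    \sum_(t < m) y (rshift c.+1 t))%N.
  by rewrite /colsum big_split_ord /=; congr (_ + _)%N; apply: eq_bigr => r _; rewrite yr.
have s4 : (colsum J = \sum_(t < c.+1) y (lshift m t) +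
    \sum_(t < m') kth J (rshift c.+1 t))%N.
  by rewrite /colsum big_split_ord /=; congr (_ + _)%N; apply: eq_bigr => r _; rewrite yl.
have s5 : (\sum_t y (s t) = \sum_t y t :> nat)%N.
  by rewrite [RHS](reindex_inj (@perm_inj _ s)).
rewrite !big_split_ord /= in s5.
have lt := @sum_tail_lt c.+1 m (fun t => y t) s t0 y_mono ht0.
rewrite s1 s2 s3 s4. clear -s5 lt; move: s5 lt.
move: (\sum_(i < c.+1) y (s _))%N (\sum_(i < m) y (s _))%N.
move: (\sum_(i < c.+1) y _)%N (\sum_(i < m) y _)%N => a1 a2 a3 a4 e l.
by rewrite ltn_add2l l; split=> //; rewrite -!addnA; congr addn; rewrite !addnA [(a4 + a3)%N]addnC e [(a1 + a2)%N]addnC.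
Qed.

End TwoColumns.
End Minors.

(** * The Lie algebra action and straightening *)

Section PolyCoef.

Lemma poly_vanish (K : numDomainType) (p : {poly K}) : (forall t, p.[t] = 0) -> p = 0.
Proof.
move=> h; apply/eqP/negPn/negP => p0.
have := max_poly_roots p0 (rs := [seq i%:R | i <- iota 0 (size p)]).
rewrite size_map size_iota ltnn => H; apply/notF/H.
  by apply/allP => _ /mapP[i _ ->]; apply/eqP/h.
rewrite map_inj_uniq ?iota_uniq // => i j /eqP.
by rewrite eqr_nat => /eqP.
Qed.

Variable K : comNzRingType.

Lemma coef1_prod (I : finType) (p : I -> {poly K}) :
  (\prod_i p i)`_1 = \sum_i (p i)`_1 * \prod_(j | j != i) (p j)`_0.
Proof.
have c0 (r : seq I) (P : pred I) :
    (\prod_(i <- r | P i) p i)`_0 = \prod_(i <- r | P i) (p i)`_0.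
  by apply: (big_morph (fun q : {poly K} => q`_0)) => [q1 q2|]; rewrite ?coef1 ?coef0M.
suff H r : uniq r -> (\prod_(i <- r) p i)`_1 =
    \sum_(i <- r) (p i)`_1 * \prod_(j <- r | j != i) (p j)`_0.
  by apply: H; exact: index_enum_uniq.
elim: r => [|x r IH] /=; first by rewrite !big_nil coef1.
case/andP => xr ur; rewrite !big_cons eqxx /= coefM !big_ord_recl big_ord0 /= addr0.
rewrite c0 IH // addrC; congr (_ * _ + _).
  rewrite big_seq [RHS]big_seq_cond; apply: eq_bigl => i.
  by case: eqP => [->|]; rewrite ?andbT ?andbF //; exact/negbTE.
rewrite mulr_sumr big_seq [RHS]big_seq; apply: eq_bigr => i ir.
rewrite big_cons; case: eqP => [e|_] /=; first by rewrite e ir in xr.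
by rewrite mulrCA.
Qed.

End PolyCoef.

Section Update.
Variables (n : nat) (l : dweight n).
Implicit Types (b : tbasis l) (p q : tpos l).

Definition upd b p (I : ksub n (tag p).+1) : tbasis l :=
  [ffun q => dfwith b I q].

Lemma upd_in b p (I : ksub n (tag p).+1) : upd b I p = I.
Proof. by rewrite ffunE dfwith_in. Qed.

Lemma upd_out b p (I : ksub n (tag p).+1) q : q != p -> upd b I q = b q.
Proof. by move=> qp; rewrite ffunE dfwith_out // eq_sym. Qed.

Lemma updP b b' p : (forall q, q != p -> b q = b' q) -> b = upd b' (b p).
Proof.
move=> h; apply/ffunP => q; have [->|qp] := eqVneq q p; first by rewrite upd_in.
by rewrite upd_out // h.
Qed.

Lemma prod_upd (R : comNzRingType) (F : forall p, ksub n (tag p).+1 -> R) b p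
    (I : ksub n (tag p).+1) :
  \prod_q F q (upd b I q) = F p I * \prod_(q | q != p) F q (b q).
Proof.
rewrite (bigD1 p) //= upd_in; congr (_ * _); apply: eq_bigr => q qp.
by rewrite upd_out.
Qed.

Lemma sum_upd (R : nmodType) (F : forall p, ksub n (tag p).+1 -> R) b p
    (I : ksub n (tag p).+1) :
  \sum_q F q (upd b I q) = F p I + \sum_(q | q != p) F q (b q).
Proof.
rewrite (bigD1 p) //= upd_in; congr (_ + _); apply: eq_bigr => q qp.
by rewrite upd_out.
Qed.

End Update.

(** [u b] has type [K^o]; [cf u b] keeps the ring operations in [K]. *)
Definition cf (K : numFieldType) n (l : dweight n) (u : Urep K l) (b : tbasis l) : K := u b.
Arguments cf {K n l} u b.

Section LieAction.
Variables (K : numFieldType) (n : nat).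
Implicit Types (l : dweight n) (X : 'M[K]_n) (h : 'I_n -> nat -> K).

Lemma sum_agree l (b' : tbasis l) p (F : tbasis l -> K) :
  \sum_b F b * \prod_(q | q != p) (b' q == b q)%:R =
  \sum_(I : ksub n (tag p).+1) F (upd b' I).
Proof.
rewrite (partition_big (fun b : tbasis l => b p) predT) //=; apply: eq_bigr => I _.
rewrite (bigD1 (upd b' I)) /=; last by rewrite upd_in.
rewrite big1 ?mulr1 => [|q qp]; last by rewrite upd_out ?eqxx.
rewrite big1 ?addr0 // => b /andP[/eqP bI nb].
have [q qp ne] : exists2 q, q != p & b' q != b q.
  apply: contra_notP (negP nb) => H; apply/eqP; rewrite -bI.
  apply: updP => q qp; apply/esym/eqP/negPn/negP => ne; apply: H; by exists q.
by rewrite (bigD1 q) //= (negbTE ne) mul0r mulr0.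
Qed.

Lemma cfP l (u v : Urep K l) : cf u =1 cf v -> u = v.
Proof. by move=> e; apply/ffunP. Qed.

Lemma cfD l (u v : Urep K l) b : cf (u + v) b = cf u b + cf v b.
Proof. exact: ffunE. Qed.

Lemma cfZ l c (u : Urep K l) b : cf (c *: u) b = c * cf u b.
Proof. exact: ffunE. Qed.

Lemma cf0 l b : cf (0 : Urep K l) b = 0.
Proof. exact: ffunE. Qed.

Lemma cf_sum l I (r : seq I) (P : pred I) (F : I -> Urep K l) b :
  cf (\sum_(i <- r | P i) F i) b = \sum_(i <- r | P i) cf (F i) b.
Proof. by apply: (big_morph (cf^~ b)) => [u v|]; rewrite ?cfD ?cf0. Qed.

Lemma cf_ebasis l (b b' : tbasis l) : cf (ebasis K b) b' = (b' == b)%:R.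
Proof. exact: ffunE. Qed.

Lemma urepE l (u : Urep K l) : u = \sum_b cf u b *: ebasis K b.
Proof.
apply: cfP => b; rewrite cf_sum (bigD1 b) //= cfZ cf_ebasis eqxx mulr1.
by rewrite big1 ?addr0 // => b' ne; rewrite cfZ cf_ebasis eq_sym (negbTE ne) mulr0.
Qed.

Lemma linfun_sum l (G : tbasis l -> tbasis l -> K) (u : Urep K l) b' :
  cf (linfun (fun u : Urep K l => [ffun b' => \sum_b cf u b * G b' b] : Urep K l) u) b' =
  \sum_b cf u b * G b' b.
Proof.
pose f (u : Urep K l) : Urep K l := [ffun b' => \sum_b cf u b * G b' b].
have f_lin : linear f.
  move=> c x y; apply/cfP => b; rewrite cfD cfZ /cf !ffunE mulr_sumr -big_split /=.
  by apply: eq_bigr => b1 _; rewrite -/(cf _ _) cfD cfZ mulrDl mulrA.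
pose fL : {linear Urep K l -> Urep K l} := HB.pack f (GRing.isLinear.Build _ _ _ _ f f_lin).
by rewrite -[LHS]/(cf (linfun fL u) b') lfunE /= /cf ffunE.
Qed.

Lemma lie_actE l X (u : Urep K l) b' :
  cf (lie_act l X u) b' = \sum_p \sum_I ext_lie X (b' p) I * cf u (upd b' I).
Proof.
rewrite [LHS](linfun_sum (fun b' b : tbasis l => \sum_(p : tpos l)
  ext_lie X (b' p) (b p) * \prod_(q | q != p) (b' q == b q)%:R)).
under eq_bigr do rewrite mulr_sumr.
rewrite exchange_big /=; apply: eq_bigr => p _.
under eq_bigr do rewrite mulrA.
rewrite (@sum_agree l b' p (fun b => cf u b * ext_lie X (b' p) (b p))).
by apply: eq_bigr => I _; rewrite upd_in mulrC.
Qed.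

(** The image of the highest weight vector under the matrix with columns [h _ s], invertible or not.
    Columns are indexed by [nat], so minors of every size use their own index [s] without a cast
    into ['I_n]. *)
Definition uvec l h : Urep K l := [ffun b : tbasis l => \prod_p minor h (b p)].

Lemma cf_uvec l h b : cf (uvec l h) b = \prod_p minor h (b p).
Proof. exact: ffunE. Qed.

Definition mulXh X h : 'I_n -> nat -> K := fun i s => \sum_x X i x * h x s.

(** The line (1 + tX)h as a matrix over the polynomials in t, whose linear coefficients compute the
    action of X. *)
Definition pencil X h : 'I_n -> nat -> {poly K} :=
  fun i s => (h i s)%:P + mulXh X h i s *: 'X.

Lemma pencil_horner X h k (I : ksub n k) t :
  (minor (pencil X h) I).[t] = minor (fun i s => h i s + t * mulXh X h i s) I.
Proof.
rewrite -[LHS]/(horner_eval t _) /minor /rowdet -det_map_mx; congr (\det _).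
by apply/matrixP => i j; rewrite !mxE /= /horner_eval !hornerE mulrC.
Qed.

Lemma pencil_coef0 X h k (I : ksub n k) : (minor (pencil X h) I)`_0 = minor h I.
Proof.
rewrite -horner_coef0 pencil_horner; congr (\det _).
by apply/matrixP => i j; rewrite !mxE mul0r addr0.
Qed.

(** [cauchy_binet] expands along rows, whereas [ext_lie] marks a column; in the product belonging to
    a permutation, marking a column or its row is the same. *)
Lemma ext_lie_rows X k (J I : ksub n k) :
  ext_lie X J I = \sum_(e < k) \det (\matrix_(c, d < k)
    if c == e then X (kth J c) (kth I d) else (kth J c == kth I d)%:R).
Proof.
rewrite /ext_lie /determinant exchange_big [RHS]exchange_big.
apply: eq_bigr => s _; rewrite (reindex_inj (@perm_inj _ s)) /=.
apply: eq_bigr => e _; congr (_ * _); apply: eq_bigr => c _.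
by rewrite !mxE (inj_eq perm_inj).
Qed.

(** The derivative of a minor is a sum over the row that is differentiated, and each summand is a
    Cauchy-Binet expansion in the minors of [h]. *)
Lemma pencil_coef1 X h k (J : ksub n k) :
  (minor (pencil X h) J)`_1 = \sum_I ext_lie X J I * minor h I.
Proof.
under eq_bigr do rewrite ext_lie_rows mulr_suml.
rewrite exchange_big /=.
pose A (e c : 'I_k) x : K := if c == e then X (kth J c) x else (kth J c == x)%:R.
transitivity (\sum_e \det (\matrix_(c < k, s < k) \sum_x A e c x * h x s)); last first.
  by apply: eq_bigr => e _; rewrite -cauchy_binet.
transitivity (\sum_e \det (\matrix_(c < k, s < k)
    if c == e then mulXh X h (kth J c) s else h (kth J c) s)); last first.
  apply: eq_bigr => e _; congr (\det _); apply/matrixP => c s; rewrite !mxE /A.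
  case: eqP => // _; rewrite (bigD1 (kth J c)) //= eqxx mul1r big1 ?addr0 // => x.
  by rewrite eq_sym => /negbTE ->; rewrite mul0r.
rewrite /minor /rowdet /determinant coef_sum exchange_big; apply: eq_bigr => s _ /=.
have sgn_coef (q : {poly K}) : ((-1) ^+ s * q)`_1 = (-1) ^+ s * q`_1.
  by rewrite !mulr_sign; case: (s : bool); rewrite ?coefN.
rewrite sgn_coef coef1_prod mulr_sumr; apply: eq_bigr => e _; congr (_ * _).
rewrite [RHS](bigD1 e) //= !mxE eqxx /pencil coefD coefC coefZ coefX mulr1 add0r.
congr (_ * _); apply: eq_bigr => c /negbTE ce; rewrite !mxE ce.
by rewrite coefD coefC coefZ coefX mulr0 addr0.
Qed.

Lemma lie_uvec l X h b :
  cf (lie_act l X (uvec l h)) b = (\prod_p minor (pencil X h) (b p))`_1.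
Proof.
rewrite lie_actE coef1_prod; apply: eq_bigr => p _.
rewrite pencil_coef1 mulr_suml; apply: eq_bigr => I _; rewrite -mulrA; congr (_ * _).
rewrite cf_uvec (prod_upd (fun q => @minor n K h (tag q).+1)); congr (_ * _).
by apply: eq_bigr => q _; rewrite pencil_coef0.
Qed.

(** [u] lies in the span of the [uvec l h], for [h] in [G]: it satisfies every
    linear relation that they satisfy. *)
Definition in_hull l (G : ('I_n -> nat -> K) -> Prop) (u : Urep K l) : Prop :=
  forall f : tbasis l -> K, (forall h, G h -> \sum_b f b * cf (uvec l h) b = 0) ->
    \sum_b f b * cf u b = 0.

Lemma in_hull_lie l G X (u : Urep K l) :
  (forall h t, G h -> G (fun i s => h i s + t * mulXh X h i s)) ->
  in_hull G u -> in_hull G (lie_act l X u).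
Proof.
move=> GX hu f hf.
pose f' (b : tbasis l) : K := \sum_b' f b' * cf (lie_act l X (ebasis K b)) b'.
have f'E v : \sum_b f b * cf (lie_act l X v) b = \sum_b f' b * cf v b.
  rewrite [in LHS](urepE v) linear_sum.
  under eq_bigr do rewrite cf_sum mulr_sumr.
  rewrite exchange_big; apply: eq_bigr => b _ /=; rewrite mulr_suml.
  by apply: eq_bigr => b' _; rewrite linearZ /= cfZ mulrA mulrAC.
rewrite f'E; apply: hu => h Gh; rewrite -f'E.
pose P : {poly K} := \sum_b f b *: \prod_p minor (pencil X h) (b p).
have P0 : P = 0.
  apply: poly_vanish => t; rewrite horner_sum -[RHS](hf _ (GX h t Gh)).
  apply: eq_bigr => b _; rewrite hornerZ cf_uvec horner_prod; congr (_ * _).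
  by apply: eq_bigr => p _; rewrite pencil_horner.
transitivity (P`_1); last by rewrite P0 coef0.
by rewrite coef_sum; apply: eq_bigr => b _; rewrite coefZ lie_uvec.
Qed.

Lemma in_hull_lincomb l G c (u v : Urep K l) :
  in_hull G u -> in_hull G v -> in_hull G (c *: u + v).
Proof.
move=> hu hv f hf; under eq_bigr do rewrite cfD cfZ mulrDr.
rewrite big_split /= hv // addr0.
under eq_bigr do rewrite mulrCA.
by rewrite -mulr_sumr hu // mulr0.
Qed.

End LieAction.

Section Subspaces.
Variables (K : fieldType) (V : vectType K) (P : V -> Prop).
Hypothesis P0 : P 0.
Hypothesis Plin : forall c u v, P u -> P v -> P (c *: u + v).

(** A subspace of greatest dimension inside [P] is all of [P]. This turns a predicate into a
    [vspace], to which the minimality of [gensub] applies. *)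
Lemma pred_vspace : exists W : {vspace V}, forall u, u \in W <-> P u.
Proof.
pose Q d := `[< exists W : {vspace V}, (forall u, u \in W -> P u) /\ \dim W = d >].
have exQ : exists d, Q d.
  exists 0%N; apply/asboolP; exists 0%VS; rewrite dimv0; split=> // u.
  by rewrite memv0 => /eqP ->.
have bQ d : Q d -> (d <= \dim {:V})%N.
  by move=> /asboolP[W [_ <-]]; exact/dimvS/subvf.
case: (ex_maxnP exQ bQ) => d /asboolP[W [WP dW]] maxd; exists W => u; split; first exact: WP.
move=> Pu; apply/negPn/negP => uW.
have : Q (\dim (W + <[u]>)).
  apply/asboolP; exists (W + <[u]>)%VS; split=> // _ /memv_addP[w wW [_ /vlineP[c ->] ->]].
  by rewrite addrC; apply: Plin => //; exact: WP.
move=> /maxd; rewrite leqNgt -dW => /negP; apply.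
rewrite ltn_neqAle dimvS ?addvSl // andbT; apply: contra uW => /eqP e.
have : (W == W + <[u]>)%VS by rewrite eqEdim addvSl /= e.
by move/eqP->; apply: subvP (addvSr _ _) _ (memv_line u).
Qed.

End Subspaces.

(** * Straightening into semistandard tableaux *)

Section Straightening.
Variables (K : numFieldType) (n : nat).
Implicit Types (l : dweight n).

(** Orders the columns of a tableau by decreasing length, so that [std b] below
    means that [b] is semistandard. *)
Definition pos_rank l (p : tpos l) : nat :=
  ((n - tag p) * (\sum_k l k) + tagged p)%N.

Lemma tagged_lt l (p : tpos l) : (tagged p < \sum_k l k)%N.
Proof. by rewrite (bigD1 (tag p)) //=; apply: leq_trans (ltn_ord _) (leq_addr _ _). Qed.

Lemma tag_ltn l (p : tpos l) : (tag p < n)%N.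
Proof. by apply: leq_trans (ltn_ord _) (leq_pred n). Qed.

Lemma pos_rank_tag l (p q : tpos l) :
  (pos_rank p < pos_rank q)%N -> (tag q <= tag p)%N.
Proof.
have [//|lt] := leqP (tag q) (tag p); rewrite ltnNge => /negP[]; rewrite /pos_rank.
have := tagged_lt q; have := tag_ltn q; set B := (\sum_k _)%N => h1 h2.
have : ((n - tag q).+1 * B <= (n - tag p) * B)%N by rewrite leq_mul2r; lia.
by rewrite mulSn; lia.
Qed.

Lemma pos_rank_inj l : injective (@pos_rank l).
Proof.
move=> p q e.
have et : tag p = tag q.
  have B := tagged_lt p; have B' := tagged_lt q.
  move: e B B'; rewrite /pos_rank; set B := (\sum_k _)%N => e B1 B2.
  have e' : (n - tag p = n - tag q)%N.
    have := congr1 (fun x => x %/ B)%N e.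
    have B0 : (0 < B)%N by apply: leq_ltn_trans B1.
    by rewrite /= !divnMDl // !divn_small // !addn0.
  apply: ord_inj; have := tag_ltn p; have := tag_ltn q; lia.
move: p q et e => [k i] [k' i'] /= et; subst k'; rewrite /pos_rank /= => /addnI e.
by congr existT; apply/val_inj.
Qed.

Definition std l (b : tbasis l) : bool :=
  [forall p, forall q, (pos_rank p < pos_rank q)%N ==>
    [forall c : 'I_(tag p).+1, forall d : 'I_(tag q).+1,
      (c == d :> nat) ==> (kth (b p) c <= kth (b q) d)%N]].

Lemma stdP l (b : tbasis l) :
  reflect (forall (p q : tpos l) (c : 'I_(tag p).+1) (d : 'I_(tag q).+1),
     (pos_rank p < pos_rank q)%N -> c = d :> nat -> (kth (b p) c <= kth (b q) d)%N)
    (std b).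
Proof.
apply: (iffP idP) => [h p q c d pq cd|h].
  move/forallP: h => /(_ p)/forallP/(_ q)/implyP/(_ pq)/forallP/(_ c)/forallP/(_ d).
  by rewrite cd eqxx.
apply/forallP => p; apply/forallP => q; apply/implyP => pq.
apply/forallP => c; apply/forallP => d; apply/implyP => /eqP; exact: h.
Qed.

(** The termination measure: an exchange between columns [p] and [q] with [pos_rank p < pos_rank q]
    keeps the sum of all entries and shifts part of it from [p] to [q], so this number grows. *)
Definition weighted_sum l (b : tbasis l) : nat :=
  (\sum_p pos_rank p * colsum (b p))%N.

Lemma straighten1 l (b : tbasis l) : ~~ std b ->
  exists (T : finType) (e : T -> K) (b' : T -> tbasis l),
    (forall h, cf (uvec l h) b = \sum_t e t * cf (uvec l h) (b' t)) /\
    forall t, e t != 0 -> (weighted_sum b < weighted_sum (b' t))%N.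
Proof.
case/forallPn => p /forallPn[q]; rewrite negb_imply => /andP[pq].
case/forallPn => c /forallPn[d]; rewrite negb_imply -ltnNge => /andP[/eqP cd viol].
have qp : q != p by apply: contraTneq pq => ->; rewrite ltnn.
have [T [e [I' [J' [eIJ lt]]]]] :=
  @two_columns n K _ _ (b p) (b q) c d (pos_rank_tag pq) cd viol.
exists T, e, (fun t => upd (upd b (I' t)) (J' t)); split=> [h|t /lt[lt1 lt2]].
  rewrite cf_uvec (bigD1 p) //= (bigD1 q) //= mulrA eIJ mulr_suml.
  apply: eq_bigr => t _; rewrite -!mulrA; congr (_ * _).
  rewrite cf_uvec [RHS](bigD1 p) //= [X in _ = _ * X](bigD1 q) //= upd_in.
  rewrite upd_out 1?eq_sym // upd_in; congr (_ * (_ * _)).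
  by apply: eq_bigr => x /andP[xp xq]; rewrite !upd_out.
rewrite /weighted_sum (bigD1 p) //= (bigD1 q) //= [X in (_ < X)%N](bigD1 p) //=.
rewrite [X in (_ < _ + X)%N](bigD1 q) //= upd_in upd_out 1?eq_sym // upd_in.
have -> : (\sum_(x | (x != p) && (x != q)) pos_rank x * colsum (upd (upd b (I' t)) (J' t) x) =
   \sum_(x | (x != p) && (x != q)) pos_rank x * colsum (b x))%N.
  by apply: eq_bigr => x /andP[xp xq]; rewrite !upd_out.
rewrite !addnA ltn_add2r.
move: lt1 lt2 pq; move: (colsum _) (colsum _) (colsum _) (colsum _) (pos_rank _) (pos_rank _).
clear; move=> x1 x2 y1 y2 r1 r2; nia.
Qed.

(** There are finitely many tableaux, so among those without such an expression one has the greatest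
    [weighted_sum], and [straighten1] contradicts its choice. The coefficients are independent of
    [h]; hence the relation passes to the whole hull. *)
Lemma straighten l (b : tbasis l) : exists c : tbasis l -> K,
  forall h, cf (uvec l h) b = \sum_(b' | std b') c b' * cf (uvec l h) b'.
Proof.
pose good b := `[< exists c : tbasis l -> K,
  forall h, cf (uvec l h) b = \sum_(b' | std b') c b' * cf (uvec l h) b' >].
apply/asboolP; rewrite -/(good b); apply/negPn/negP => nb.
case: (arg_maxnP (P := fun b => ~~ good b) (@weighted_sum l) nb) => b1 /negP nb1 max1.
apply: nb1; apply/asboolP.
have [sb|sb] := boolP (std b1).
  exists (fun b' => (b' == b1)%:R) => h; rewrite (bigD1 b1) //= eqxx mul1r.
  by rewrite big1 ?addr0 // => b' /andP[_ /negbTE ->]; rewrite mul0r.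
have [T [e [b' [eb lt]]]] := straighten1 sb.
have /fin_all_exists[c hc] (t : T) : exists c : tbasis l -> K, forall h,
    e t * cf (uvec l h) (b' t) = \sum_(b'' | std b'') c b'' * cf (uvec l h) b''.
  have [->|nt] := eqVneq (e t) 0.
    by exists (fun=> 0) => h; rewrite mul0r big1 // => *; rewrite mul0r.
  have : good (b' t).
    by apply/negPn/negP => /max1 /(leq_trans (lt _ nt)); rewrite ltnn.
  case/asboolP => c hc; exists (fun b'' => e t * c b'') => h; rewrite hc mulr_sumr.
  by apply: eq_bigr => *; rewrite mulrA.
exists (fun b'' => \sum_t c t b'') => h; rewrite eb.
under eq_bigr do rewrite hc.
by rewrite exchange_big; apply: eq_bigr => b'' _; rewrite mulr_suml.
Qed.

Lemma hull_std0 l (u : Urep K l) : in_hull (fun=> True) u ->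
  (forall b, std b -> cf u b = 0) -> u = 0.
Proof.
move=> hu u0; apply/cfP => b; rewrite cf0; have [c hc] := straighten b.
(* The straightening relation for [b], read as a functional that kills every [uvec l h]. *)
have := hu (fun b' => (b' == b)%:R - if std b' then c b' else 0).
have sumE (v : Urep K l) :
    \sum_b' ((b' == b)%:R - (if std b' then c b' else 0)) * cf v b' =
    cf v b - \sum_(b' | std b') c b' * cf v b'.
  under eq_bigr do rewrite mulrBl.
  rewrite big_split /= sumrN (bigD1 b) //= eqxx mul1r big1 ?addr0 => [|b' /negbTE ->]; last first.
    by rewrite mul0r.
  congr (_ - _); rewrite [RHS]big_mkcond; apply: eq_bigr => b' _.
  by case: ifP => _; rewrite ?mul0r.
rewrite sumE => e; apply/eqP; move: e => /(_ _)/eqP.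
rewrite subr_eq0 => e; apply/eqP; rewrite (eqP (e _)) => [|h _].
  by apply: big1 => b' sb'; rewrite u0 ?mulr0.
by rewrite sumE -hc subrr.
Qed.

End Straightening.

(** * Weights and root operators *)

Section Cones.
Variables (K : numFieldType) (n : nat).
Implicit Types (l : dweight n) (d : weight K n).

(** The basis of the dual of the weight space dual to the simple roots, by its
    values on the fundamental weights. *)
Definition coroot_mx : 'M[K]_n.-1 :=
  \matrix_(k, r) ((minn k.+1 r.+1)%:R - (k.+1 * r.+1)%:R / n%:R).

Definition root_coef (r : 'I_n.-1) d : K := (d *m coroot_mx) 0 r.

Lemma root_coefD r d d' : root_coef r (d + d') = root_coef r d + root_coef r d'.
Proof. by rewrite /root_coef mulmxDl mxE. Qed.

Lemma root_coefN r d : root_coef r (- d) = - root_coef r d.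
Proof. by rewrite /root_coef mulNmx mxE. Qed.

Lemma root_coef_sum r (I : Type) (s : seq I) (P : pred I) (F : I -> weight K n) :
  root_coef r (\sum_(i <- s | P i) F i) = \sum_(i <- s | P i) root_coef r (F i).
Proof. by rewrite /root_coef mulmx_suml summxE. Qed.

Lemma sum_pick m (F : nat -> K) i :
  \sum_(k < m) (i == k :> nat)%:R * F k = if (i < m)%N then F i else 0.
Proof.
case: ifP => im.
  rewrite (bigD1 (Ordinal im)) //= eqxx mul1r big1 ?addr0 // => k /eqP ne.
  by case: eqP => [e|]; rewrite ?mul0r //; case: ne; apply/val_inj.
rewrite big1 // => k _; case: eqP => [e|]; last by rewrite mul0r.
by rewrite e ltn_ord in im.
Qed.

Lemma root_coef_eps r i : (i < n)%N ->
  root_coef r (eps K n i) = (i <= r)%N%:R - r.+1%:R / n%:R.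
Proof.
(* [g] extends the entries of [coroot_mx] to the indices 0 and n, where it vanishes; [eps] then
   becomes a difference of consecutive values without boundary cases. *)
move=> ii; pose g (k : nat) : K := (minn k r.+1)%:R - (k * r.+1)%:R / n%:R.
have n0 : n%:R != 0 :> K by rewrite pnatr_eq0; case: n ii.
have rn := ltn_ord r.
have gn : g n = 0 by rewrite /g natrM mulrAC divff // mul1r (minn_idPr _) ?subrr //; lia.
have g0 : g 0%N = 0 by rewrite /g min0n mul0n mul0r subrr.
rewrite /root_coef mxE.
transitivity (\sum_(k < n.-1) (i == k :> nat)%:R * g k.+1 -
              \sum_(k < n.-1) (i == k.+1 :> nat)%:R * g k.+1).
  by rewrite -sumrB; apply: eq_bigr => k _; rewrite !mxE mulrBl.
rewrite (sum_pick _ (fun k => g k.+1)).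
have -> : \sum_(k < n.-1) (i == k.+1 :> nat)%:R * g k.+1 = g i.
  case: i ii => [|i] ii; first by rewrite g0 big1 // => k _; rewrite mul0r.
  under eq_bigr do rewrite eqSS.
  by rewrite (sum_pick _ (fun k => g k.+1)) ifT //; lia.
have -> : (if (i < n.-1)%N then g i.+1 else 0) = g i.+1.
  by case: ltnP => // h; rewrite -gn; congr g; lia.
have e : (minn i.+1 r.+1 = minn i r.+1 + (i <= r))%N by lia.
rewrite /g e mulSn !natrD mulrDl; move: (_%:R / _) (_%:R / _) (_%:R) (_%:R).
by move=> x1 x2 x3 x4; ring.
Qed.

Lemma root_coef_alpha r i : root_coef r (alpha K i) = (i == r)%:R.
Proof.
have := ltn_ord i => ii.
rewrite /alpha root_coefD root_coefN !root_coef_eps; try lia.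
rewrite opprB addrACA [- _ + _]addrC addrACA.
rewrite -val_eqE /=; case: (ltngtP i r) => h /=; ring.
Qed.

Lemma root_expand d : d = \sum_r root_coef r d *: alpha K r.
Proof.
pose A : 'M[K]_n.-1 := \matrix_i alpha K i.
have AP : A *m coroot_mx = 1%:M.
  apply/matrixP => i r; have := root_coef_alpha r i.
  rewrite /root_coef !mxE => <-; apply: eq_bigr => k _.
  by rewrite !mxE.
rewrite -[LHS]mulmx1 -(mulmx1C AP) mulmxA mulmx_sum_row.
by apply: eq_bigr => r _; rewrite rowK.
Qed.

Lemma in_coneP k d : in_cone k d <->
  forall r, root_coef r d <= 0 /\ ((r < k)%N -> root_coef r d = 0).
Proof.
split=> [[c [c0 ->]] r|H].
  have -> : root_coef r (\sum_(i < n.-1 | (k <= i)%N) c i *: - alpha K i) =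
      if (k <= r)%N then - c r else 0.
    rewrite root_coef_sum.
    have E i : root_coef r (c i *: - alpha K i) = - (i == r)%:R * c i.
      by rewrite /root_coef -scalemxAl mxE -/(root_coef _ _) root_coefN root_coef_alpha mulrC.
    under eq_bigr do rewrite E.
    case: leqP => h.
      rewrite (bigD1 r) //= eqxx mulN1r big1 ?addr0 // => i /andP[_ /negbTE ->].
      by rewrite oppr0 mul0r.
    rewrite big1 // => i ki; have /negbTE -> : i != r.
      by apply: contraTneq ki => ->; rewrite -ltnNge.
    by rewrite oppr0 mul0r.
  by case: leqP => // h; split=> //; rewrite oppr_le0.
exists (fun r => - root_coef r d); split=> [r|].
  by rewrite oppr_ge0; case: (H r).
rewrite {1}[d]root_expand (bigID (fun r : 'I__ => (k <= r)%N)) /= addrC big1 ?add0r.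
  by apply: eq_bigr => r _; rewrite scalerN scaleNr opprK.
by move=> r; rewrite -ltnNge => /(H r).2 ->; rewrite scale0r.
Qed.

Lemma big_tpos (R : nmodType) l (F : 'I_n.-1 -> R) :
  \sum_(p : tpos l) F (tag p) = \sum_k F k *+ l k.
Proof.
rewrite -(sig_big_dep predT (fun _ => predT) (fun k (i : 'I_(l k)) => F k)) /=.
by apply: eq_bigr => k _; rewrite sumr_const card_ord.
Qed.

Definition count_le r k (I : ksub n k) : nat := #|[set x in val I | x <= r]%N|.

Lemma count_le_min r k (I : ksub n k) : (count_le r I <= minn k r.+1)%N.
Proof.
have le_k : (count_le r I <= k)%N.
  rewrite -[X in (_ <= X)%N](eqP (valP I)); apply: subset_leq_card.
  by apply/subsetP => x; rewrite inE => /andP[].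
rewrite leq_min le_k /=.
rewrite /count_le; pose A := [set x in val I | (x <= r)%N].
have f_inj : {in A &, injective (fun x : 'I_n => inord x : 'I_r.+1)}.
  move=> x y; rewrite !inE => /andP[_ hx] /andP[_ hy] /(congr1 val) /=.
  by rewrite !inordK // => /val_inj.
by rewrite -(card_in_imset f_inj) -[X in (_ <= X)%N]card_ord max_card.
Qed.

(** Each entry at most r contributes 1 to the coefficient, up to the constant (r+1)/n per entry;
    these constants cancel against those of the fundamental weights. What remains is the number of
    small entries that each column lacks. *)
Lemma root_coef_wt l (b : tbasis l) r :
  root_coef r (wt_basis K b - wt_of K l) =
  - \sum_(p : tpos l) (minn (tag p).+1 r.+1 - count_le r (b p))%N%:R.
Proof.
rewrite root_coefD root_coefN; apply/eqP; rewrite subr_eq; apply/eqP.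
have -> : root_coef r (wt_of K l) =
    \sum_(p : tpos l) ((minn (tag p).+1 r.+1)%:R - ((tag p).+1 * r.+1)%:R / n%:R).
  rewrite (big_tpos _ (fun k => (minn k.+1 r.+1)%:R - (k.+1 * r.+1)%:R / n%:R : K)).
  by rewrite /root_coef mxE; apply: eq_bigr => k _; rewrite !mxE mulr_natl.
rewrite -sumrN -big_split /= root_coef_sum; apply: eq_bigr => p _.
rewrite root_coef_sum.
under eq_bigr do rewrite root_coef_eps ?ltn_ord //.
rewrite sumrB sumr_const (eqP (valP (b p))) natrB ?count_le_min // opprB addrA.
rewrite subrK; congr (_ - _).
  rewrite -natr_sum; congr (_%:R).
  rewrite /count_le -sum1dep_card big_mkcond [RHS]big_mkcond /=.
  by apply: eq_bigr => x _; case: (x \in _) => //=; case: (_ <= _)%N.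
by rewrite -[LHS]mulr_natl natrM mulrA.
Qed.

(** The cone condition on weights in combinatorial form, see [in_cone_low]: every column still
    contains all indices below [i] that it has in the highest weight tableau. *)
Definition low i l (b : tbasis l) : bool :=
  [forall p : tpos l, forall x : 'I_n, (x < i)%N ==> (x <= tag p)%N ==> (x \in val (b p))].

Lemma lowP i l (b : tbasis l) :
  reflect (forall (p : tpos l) (x : 'I_n), (x < i)%N -> (x <= tag p)%N -> x \in val (b p)) (low i b).
Proof.
apply: (iffP idP) => [/forallP h p x xi xp|h].
  by have /forallP/(_ x) := h p; rewrite xi xp.
by apply/forallP => p; apply/forallP => x; apply/implyP => xi; apply/implyP; exact: h.
Qed.

Lemma count_le_full r k (I : ksub n k) : (r < k)%N ->
  (count_le r I = r.+1) <-> (forall x : 'I_n, (x <= r)%N -> x \in val I).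
Proof.
move=> rk; have rn : (r < n)%N by apply: leq_trans rk (ksub_leq I).
have cA : #|[set x : 'I_n | (x <= r)%N]| = r.+1.
  rewrite -sum1dep_card (eq_bigl (fun i : 'I_n => (i < r.+1)%N)) //.
  by rewrite -(big_ord_widen n (fun=> 1%N) rn) sum1_card card_ord.
split=> [e x xr|h].
  suff : x \in [set x in val I | (x <= r)%N] by rewrite inE => /andP[].
  have -> : [set x in val I | (x <= r)%N] = [set x : 'I_n | (x <= r)%N].
    apply/eqP; rewrite eqEcard cA -[X in (_ <= X)%N]/(count_le r I) e leqnn andbT.
    by apply/subsetP => y; rewrite !inE => /andP[].
  by rewrite inE.
rewrite /count_le -cA; apply: eq_card => x; rewrite !inE.
by apply/andb_idl => /h.
Qed.

(** By [root_coef_wt] each coefficient is minus a sum of nonnegative shortfalls, one for each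
    column, so its vanishing is a condition on every single column. *)
Lemma in_cone_low i l (b : tbasis l) : (i < n)%N ->
  `[< in_cone i (wt_basis K b - wt_of K l) >] = low i b.
Proof.
move=> ii; apply/asboolP/lowP => [/in_coneP H p x xi xp|H]; last first.
  apply/in_coneP => r; rewrite root_coef_wt oppr_le0 sumr_ge0 //; split=> // ri.
  rewrite big1 ?oppr0 // => p _; apply/eqP; rewrite pnatr_eq0 subn_eq0.
  pose m := minn (tag p) r.
  have mp : (m < (tag p).+1)%N by rewrite ltnS geq_minl.
  have -> : minn (tag p).+1 r.+1 = m.+1 by rewrite /m; lia.
  rewrite -((count_le_full (b p) mp).2 _); last first.
    by move=> x xm; apply: H; rewrite /m in xm; lia.
  apply: subset_leq_card; apply/subsetP => x; rewrite !inE => /andP[-> /=].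
  by move=> h; apply: leq_trans h (geq_minr _ _).
have xr : (x < n.-1)%N by apply: leq_ltn_trans xp (ltn_ord _).
have [_ /(_ xi)] := H (Ordinal xr); rewrite root_coef_wt => /eqP.
rewrite oppr_eq0 psumr_eq0 // => /allP/(_ p (mem_index_enum _)).
rewrite /= pnatr_eq0 subn_eq0 => h.
have xp' : (x < (tag p).+1)%N by rewrite ltnS.
apply: ((count_le_full (b p) xp').1 _ x) => //.
apply/eqP; rewrite eqn_leq; apply/andP; split.
  by apply: leq_trans (count_le_min _ _) (geq_minr _ _).
by apply: leq_trans h; rewrite leq_min ltnSn andbT.
Qed.

Lemma root_coef0 d : (forall r, root_coef r d = 0) -> d = 0.
Proof. by move=> h; rewrite [d]root_expand big1 // => r _; rewrite h scale0r. Qed.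

End Cones.

(** * Root operators in the standard basis *)

Section Phi.
Variables (K : numFieldType) (n : nat).
Implicit Types (l : dweight n).

Lemma cf_wt_proj l nu (u : Urep K l) b :
  cf (wt_proj l nu u) b = if wt_basis K b == nu then cf u b else 0.
Proof.
pose f (u : Urep K l) : Urep K l :=
  [ffun b : tbasis l => if wt_basis K b == nu then u b else 0].
have f_lin : linear f.
  move=> c x y; apply/cfP => b'; rewrite cfD cfZ /cf !ffunE.
  by case: ifP => _ //; rewrite mulr0 addr0.
pose fL : {linear Urep K l -> Urep K l} := HB.pack f (GRing.isLinear.Build _ _ _ _ f f_lin).
by rewrite -[LHS]/(cf (linfun fL u) b) lfunE /= /cf ffunE.
Qed.

Lemma mem_wts l (b : tbasis l) : wt_basis K b \in wts K l.
Proof. by rewrite mem_undup codom_f. Qed.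

Lemma phiE l (i j : 'I_n) (u : Urep K l) b' :
  cf (phi K l i j u) b' = \sum_(p : tpos l) \sum_(I : ksub n (tag p).+1)
    ext_lie (delta_mx j i) (b' p) I * (if low i (upd b' I) then cf u (upd b' I) else 0).
Proof.
rewrite /phi comp_lfunE lie_actE; apply: eq_bigr => p _; apply: eq_bigr => I _.
congr (_ * _); rewrite sum_lfunE cf_sum.
under eq_bigr do rewrite cf_wt_proj.
set b := upd b' I.
rewrite big_mkcond (bigD1_seq _ (mem_wts b) (undup_uniq _)) /= eqxx in_cone_low //.
by rewrite big1 ?addr0 // => nu /negbTE; rewrite eq_sym => ->; rewrite if_same.
Qed.

Lemma ext_lie_move k (J I : ksub n k) (i j : 'I_n) : i != j ->
  ext_lie (delta_mx j i : 'M[K]_n) J I != 0 ->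
  [/\ i \in val I, j \notin val I & val J = j |: (val I :\ i)].
Proof.
move=> ij; have [e0 nz|H] := EM (exists e : 'I_k, \det (\matrix_(c, d < k)
    if d == e then (delta_mx j i : 'M[K]_n) (kth J c) (kth I d)
    else (kth J c == kth I d)%:R) != 0); last first.
  move=> /eqP[]; rewrite /ext_lie big1 // => e _; apply/eqP/negPn/negP => h.
  by apply: H; exists e.
case: e0 => e; set M := \matrix_(c, d) _ => dM.
have colnz d : exists c, M c d != 0.
  apply: contra_notP (negP dM) => H; rewrite (expand_det_col M d) big1 // => c _.
  have [->|nz'] := eqVneq (M c d) 0; first by rewrite mul0r.
  by case: H; exists c.
have [ie jJ] : kth I e = i /\ j \in val J.
  have [c] := colnz e; rewrite !mxE eqxx.
  case: (kth J c =P j) => [<-|_] /=; last by rewrite eqxx.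
  by case: (kth I e =P i) => [->|_]; rewrite ?eqxx // kth_mem.
have IJ d : d != e -> kth I d \in val J.
  move=> de; have [c] := colnz d; rewrite !mxE (negbTE de).
  by case: (kth J c =P _) => [<- _|_]; rewrite ?eqxx // kth_mem.
have jI : j \notin val I.
  apply/negP => /mem_kth[d dj]; have de : d != e.
    by apply: contraNneq ij => de; rewrite -ie -de dj.
  move: dM; rewrite -det_tr (determinant_alternate de) ?eqxx // => c.
  by rewrite !mxE (negbTE de) eqxx ie eqxx andbT -dj.
have iI : i \in val I by rewrite -ie kth_mem.
split=> //; apply/esym/eqP; rewrite eqEcard; apply/andP; split.
  apply/subsetP => x; rewrite !inE => /predU1P[->//|/andP[xi /mem_kth[d dx]]].
  by rewrite dx IJ //; apply: contraNneq xi => de; rewrite dx de ie.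
rewrite cardsU1 !inE (negbTE jI) andbF /= (eqP (valP J)).
by rewrite -{1}(eqP (valP I)) (cardsD1 i) iI.
Qed.

(** The new entry takes the row of the old one, so no sorting sign appears. This +1 is the source of
    positivity in [mono_gt0]. *)
Lemma ext_lie_1 k (J I : ksub n k) (i j : 'I_n) (e : 'I_k) : kth I e = i -> kth J e = j ->
  (forall c, c != e -> kth J c = kth I c) -> ext_lie (delta_mx j i : 'M[K]_n) J I = 1.
Proof.
move=> Ie Je IJ; rewrite /ext_lie (bigD1 e) //= [X in _ + X]big1 ?addr0 => [|d de].
  rewrite -[RHS](det1 K k); congr (\det _); apply/matrixP => c d; rewrite !mxE.
  have [->|de] := eqVneq d e.
    by rewrite Ie eqxx andbT -Je (inj_eq (@kth_inj _ _ J)).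
  have [->|ce] := eqVneq c e; last by rewrite -IJ // (inj_eq (@kth_inj _ _ J)).
  by rewrite -IJ // (inj_eq (@kth_inj _ _ J)).
rewrite (expand_det_col _ d) big1 // => c _; rewrite !mxE eqxx.
case: (kth I d =P i) => [e'|_]; last by rewrite andbF mul0r.
by case/eqP: de; apply: (@kth_inj _ _ I); rewrite e' Ie.
Qed.

End Phi.

(** * Monomials in the root operators *)

Section Moves.
Variable n : nat.
Implicit Types (l : dweight n) (a : nat -> nat -> int).

Lemma degE a l (b : tbasis l) :
  deg (sigma a) b = \sum_p coldeg a 0 (vals (b p)).
Proof. by apply: eq_bigr => p _; exact: sigma_coldeg. Qed.

Lemma coldeg_kth a k (I : ksub n k) :
  coldeg a 0 (vals I) = \sum_(c < k) offdiag a c (kth I c).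
Proof.
by rewrite coldeg_nth size_vals; apply: eq_bigr => c _; rewrite add0n kth_vals.
Qed.

Definition moves (i j : 'I_n) l (b b' : tbasis l) p : Prop :=
  [/\ forall q, q != p -> b q = b' q, i \in val (b p), j \notin val (b p),
      val (b' p) = j |: (val (b p) :\ i) & low i b].

Variables (i j : 'I_n) (l : dweight n) (b b' : tbasis l) (p : tpos l).
Hypotheses (ij : (i < j)%N) (mv : moves i j b b' p).

(** [low] speaks only of indices that fit the height of the column. If [x] did not fit, the column
    would be the highest weight column, which is then too short to contain [i]. *)
Lemma moves_low (x : 'I_n) : (x < i)%N -> x \in val (b p).
Proof.
case: mv => _ iI _ _ /lowP h xi; apply: (h p x) => //.
rewrite leqNgt; apply/negP => px.
have std_sub y : y \in val (ksub_std (tag p)) -> y \in val (b p).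
  by rewrite inE => yp; apply: h => //; apply: leq_ltn_trans yp (ltn_trans px xi).
have : val (ksub_std (tag p)) = val (b p).
  apply/eqP; rewrite eqEcard (eqP (valP (ksub_std _))) (eqP (valP (b p))) leqnn andbT.
  exact/subsetP.
by move/setP/(_ i); rewrite iI inE leqNgt (ltn_trans px xi).
Qed.

Lemma moves_rest (h : nat -> nat -> int) :
  \sum_(q | q != p) coldeg h 0 (vals (b q)) = \sum_(q | q != p) coldeg h 0 (vals (b' q)).
Proof. by case: mv => e _ _ _ _; apply: eq_bigr => q qp; rewrite e. Qed.

Lemma moves_deg (h : nat -> nat -> int) d :
  (coldeg h 0 (vals (b' p)) = d + coldeg h 0 (vals (b p))) <->
  (deg (sigma h) b' = d + deg (sigma h) b).
Proof.
rewrite !degE (bigD1 p) //= [\sum_q coldeg h 0 (vals (b q))](bigD1 p) //= (moves_rest h).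
by rewrite addrA; split=> [->//|/addIr].
Qed.

Lemma moves_deg_le a : submod n a -> deg (sigma a) b' <= a i j + deg (sigma a) b.
Proof.
move=> ha; case: (mv) => e iI jI eI _.
rewrite !degE (bigD1 p) //= [\sum_q coldeg a 0 (vals (b q))](bigD1 p) //= addrA.
by rewrite moves_rest lerD2r; apply: move_le => //; exact: moves_low.
Qed.

(** Equality for one strict grading forces a replacement in place, which changes every grading [h]
    by exactly [h i j]. *)
Lemma moves_eq a : ssubmod n a -> deg (sigma a) b' = a i j + deg (sigma a) b ->
  (forall h, deg (sigma h) b' = h i j + deg (sigma h) b) /\
  exists e : 'I_(tag p).+1, [/\ kth (b p) e = i, kth (b' p) e = j &
    forall c, c != e -> kth (b' p) c = kth (b p) c].
Proof.
move=> ha /moves_deg; case: (mv) => e iI jI eI _.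
case/(move_eq iI jI ij eI moves_low ha) => zs [e1 e2]; split=> [h|].
  apply/moves_deg; rewrite e1 e2 !coldeg_iota /= offdiag_id add0r.
  by rewrite /offdiag ij.
have ip : (i < (tag p).+1)%N.
  by rewrite -(size_vals (b p)) e1 size_cat size_iota /= addnS ltnS leq_addr.
exists (Ordinal ip); split.
- by apply/val_inj; rewrite /= kth_vals e1 nth_cat size_iota ltnn subnn.
- by apply/val_inj; rewrite /= kth_vals e2 nth_cat size_iota ltnn subnn.
move=> c; rewrite -val_eqE /= => ci; apply/val_inj; rewrite /= !kth_vals e1 e2.
rewrite !nth_cat !size_iota; case: ltngtP ci => // ic _.
by rewrite -subn_gt0 in ic; case: (c - i)%N ic.
Qed.

End Moves.

Section Words.
Variables (K : numFieldType) (n : nat).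
Implicit Types (l : dweight n) (a : nat -> nat -> int).

Definition word : Type := seq ('I_n * 'I_n).
Implicit Type w : word.

(** The order of factors in which monomials of the algebra can be nonzero: the leftmost factor acts
    last and has the smallest first index. *)
Definition word_ok w : bool :=
  all (fun x : 'I_n * 'I_n => x.1 < x.2)%N w &&
  pairwise (fun x y : 'I_n * 'I_n => x.1 <= y.1)%N w.

Definition word_deg a w : int := \sum_(x <- w) a x.1 x.2.

Definition mono l w : Urep K l := foldr (fun x u => phi K l x.1 x.2 u) (vhw K l) w.

(** Quantifying over all gradings says that each letter (i,j) occurs in [w] as often as the entry j
    occurs in row i of [b], for i < j. *)
Definition same_content l (b : tbasis l) w : Prop :=
  forall h, deg (sigma h) b = word_deg h w.

Lemma phi_moves l (i j : 'I_n) (u : Urep K l) b' : (i < j)%N ->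
  cf (phi K l i j u) b' != 0 ->
  exists b p, moves i j b b' p /\ cf u b != 0.
Proof.
move=> ij; rewrite phiE => nz.
have [p [I]] : exists (p : tpos l) (I : ksub n (tag p).+1), ext_lie (delta_mx j i) (b' p) I *
    (if low i (upd b' I) then cf u (upd b' I) else 0) != 0.
  apply: contra_notP (negP nz) => H; rewrite big1 // => p _; rewrite big1 // => I _.
  by apply/eqP/negPn/negP => h; apply: H; exists p, I.
rewrite mulf_eq0 negb_or => /andP[/ext_lie_move h]; case: ifP => lo; last by rewrite eqxx.
move=> nzu; exists (upd b' I), p; split=> //.
have [iI jI eI] := h (negbT (ltn_eqF ij)).
by split; rewrite ?upd_in // => q qp; rewrite upd_out.
Qed.

Definition hw_basis l : tbasis l := [ffun p => ksub_std (tag p)].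

Lemma cf_vhw l (b : tbasis l) : cf (vhw K l) b = (b == hw_basis l)%:R.
Proof. exact: cf_ebasis. Qed.

Lemma vals_std k : vals (@ksub_std n k) = iota 0 k.+1.
Proof.
apply: (irr_sorted_eq ltn_trans ltnn (vals_sorted _) (iota_ltn_sorted _ _)) => x.
rewrite mem_iota /= add0n; apply/idP/idP => [/valsP[y]|xk].
  by rewrite inE => h ->.
have xn : (x < n)%N.
  by apply: leq_trans xk _; apply: leq_trans (ltn_ord k) (leq_pred n).
by rewrite -[x]/(val (Ordinal xn)) mem_vals inE.
Qed.

Lemma kth_std k c : kth (@ksub_std n k) c = c :> nat.
Proof. by rewrite kth_vals vals_std nth_iota // size_iota. Qed.

Lemma deg_hw a l : deg (sigma a) (hw_basis l) = 0.
Proof.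
rewrite degE big1 // => p _; rewrite ffunE vals_std.
by rewrite -[iota _ _]cats0 coldeg_iota.
Qed.

Lemma word_ok_cons x w : word_ok (x :: w) =
  [&& (x.1 < x.2)%N, all (fun y : 'I_n * 'I_n => x.1 <= y.1)%N w & word_ok w].
Proof. by rewrite /word_ok /= -!andbA; congr (_ && _); rewrite andbCA. Qed.

Lemma mono_deg_le l a w b : submod n a -> word_ok w ->
  cf (mono l w) b != 0 -> deg (sigma a) b <= word_deg a w.
Proof.
move=> ha; elim: w b => [|[i j] w IH] b.
  move=> _; rewrite /= cf_vhw; case: (b =P hw_basis l) => [->|_]; last by rewrite eqxx.
  by rewrite deg_hw /word_deg big_nil.
rewrite word_ok_cons /= => /and3P[ij _ ok] /(phi_moves ij)[b0 [p [mv /(IH _ ok)]]].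
have := moves_deg_le ij mv ha; rewrite /word_deg big_cons /=; lia.
Qed.

(** If the bound of [mono_deg_le] is attained at the end, every factor attains it along the way, and
    [moves_eq] applies to each. *)
Lemma mono_content l a w b : ssubmod n a -> word_ok w ->
  cf (mono l w) b != 0 -> deg (sigma a) b = word_deg a w -> same_content b w.
Proof.
move=> ha; elim: w b => [|[i j] w IH] b.
  move=> _; rewrite /= cf_vhw; case: (b =P hw_basis l) => [->|_]; last by rewrite eqxx.
  by move=> _ _ h; rewrite deg_hw /word_deg big_nil.
rewrite word_ok_cons /= => /and3P[ij _ ok] /(phi_moves ij)[b0 [p [mv nz]]].
have le1 := moves_deg_le ij mv (ssubmodW ha).
have le2 := mono_deg_le (ssubmodW ha) ok nz.
rewrite {1}/word_deg big_cons /= -/(word_deg _ _) => e.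
have e0 : deg (sigma a) b0 = word_deg a w by lia.
have [eh _] := moves_eq ij mv ha (etrans e (congr1 (fun x => _ + x) (esym e0))).
by move=> h; rewrite eh (IH _ ok nz e0) /word_deg big_cons.
Qed.

Lemma mono_low l w b (i : nat) : word_ok w -> all (fun y : 'I_n * 'I_n => i <= y.1)%N w ->
  cf (mono l w) b != 0 -> low i b.
Proof.
elim: w b => [|[i0 j] w IH] b.
  move=> _ _; rewrite /= cf_vhw; case: (b =P hw_basis l) => [->|_]; last by rewrite eqxx.
  by move=> _; apply/lowP => p x _ xp; rewrite ffunE inE.
rewrite word_ok_cons /= => /and3P[ij _ ok] /andP[ii0 ai] /(phi_moves ij)[b0 [p [mv nz]]].
have /lowP lo := IH _ ok ai nz; case: (mv) => e _ _ e' _.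
apply/lowP => q x xi xq; have [qp|qp] := eqVneq q p; last by rewrite -e // lo.
subst q; rewrite e' !inE; apply/orP; right; rewrite lo // andbT.
by apply: contraTneq xi => ->; rewrite -leqNgt.
Qed.

(** The factors applied before have first index at least [i], so all weights present lie in the i-th
    cone and the projection in [phi] does nothing. Hence monomials stay in [Lrep]. *)
Lemma phi_mono l (i j : 'I_n) w : word_ok ((i, j) :: w) ->
  phi K l i j (mono l w) = lie_act l (delta_mx j i) (mono l w).
Proof.
rewrite word_ok_cons => /and3P[/= _ ai ok]; apply: cfP => b.
rewrite phiE lie_actE; apply: eq_bigr => p _; apply: eq_bigr => I _; congr (_ * _).
case: ifP => // /negbT nlo; apply/esym/eqP/negPn/negP => nz; case/negP: nlo.
exact: mono_low ok ai nz.
Qed.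

Lemma mono_wt l w b : word_ok w -> cf (mono l w) b != 0 ->
  wt_basis K b = wt_of K l + \sum_(x <- w) (eps K n x.2 - eps K n x.1).
Proof.
elim: w b => [|[i j] w IH] b.
  move=> _; rewrite /= cf_vhw; case: (b =P hw_basis l) => [->|_]; last by rewrite eqxx.
  move=> _; rewrite big_nil addr0; apply/eqP; rewrite -subr_eq0; apply/eqP.
  apply: root_coef0 => r; rewrite root_coef_wt big1 ?oppr0 // => p _.
  apply/eqP; rewrite pnatr_eq0 subn_eq0 ffunE.
  pose m := minn (tag p) r; have mp : (m < (tag p).+1)%N by rewrite ltnS geq_minl.
  have -> : minn (tag p).+1 r.+1 = m.+1 by rewrite /m; lia.
  rewrite -((count_le_full (ksub_std (tag p)) mp).2 _) => [|x xm].
    apply: subset_leq_card; apply/subsetP => x; rewrite !inE => /andP[-> /=].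
    by move=> h; apply: leq_trans h (geq_minr _ _).
  by rewrite inE; apply: leq_trans xm (geq_minl _ _).
rewrite word_ok_cons /= => /and3P[ij _ ok] /(phi_moves ij)[b0 [p [mv nz]]].
rewrite big_cons /= addrCA -(IH _ ok nz); case: (mv) => e iI jI e' _.
rewrite /wt_basis (bigD1 p) //= [in RHS](bigD1 p) //= addrA; congr (_ + _); last first.
  by apply: eq_bigr => q qp; rewrite e.
rewrite e' big_setU1 ?inE ?negb_and ?jI ?orbT //=.
rewrite [X in _ = _ + X](big_setD1 _ iI) /=.
by rewrite addrA subrK.
Qed.

(** The word has a letter (c, x) for every entry x > c in row c, sorted by rows. *)
Lemma word_exists l (b : tbasis l) : exists w, word_ok w /\ same_content b w.
Proof.
pose T : finType := {p : tpos l & 'I_(tag p).+1}.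
pose g (x : T) : 'I_n * 'I_n :=
  (widen_ord (ksub_leq (b (tag x))) (tagged x), kth (b (tag x)) (tagged x)).
pose w0 := [seq g x | x <- enum T & (g x).1 < (g x).2]%N.
pose r (x y : 'I_n * 'I_n) := (x.1 <= y.1)%N.
have rt : total r by move=> x y; exact: leq_total.
have rtr : transitive r by move=> y x z; exact: leq_trans.
have pe : perm_eq (sort r w0) w0 by rewrite perm_sort.
exists (sort r w0); split.
  rewrite /word_ok (perm_all _ pe) -(sorted_pairwise rtr) sort_sorted // andbT.
  by apply/allP => x /mapP[y]; rewrite mem_filter => /andP[h _] ->.
move=> h; rewrite /word_deg (perm_big _ pe) /= big_map big_filter big_enum_cond /= degE.
transitivity (\sum_(p : tpos l) \sum_(c < (tag p).+1) offdiag h c (kth (b p) c)).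
  by apply: eq_bigr => p _; rewrite coldeg_kth.
rewrite (sig_big_dep predT (fun _ => predT)
  (fun (p : tpos l) (c : 'I_(tag p).+1) => offdiag h c (kth (b p) c))) /=.
by rewrite [RHS]big_mkcond.
Qed.

(** A strictly submodular choice, valid for every [n]. *)
Definition sqdiff (i j : nat) : int := (j%:Z - i%:Z) ^+ 2.

Lemma sqdiff_ssubmod m : ssubmod m sqdiff.
Proof.
move=> c x cx _; rewrite /offdiag /sqdiff !ltnS cx ltnW //.
case: ltnP => h; rewrite !expr2; nia.
Qed.

Lemma content_nil l (b : tbasis l) : same_content b [::] -> b = hw_basis l.
Proof.
(* The constant grading 1 counts the entries that exceed their row. *)
move=> h; have := h (fun _ _ => 1).
rewrite /word_deg big_nil degE => /eqP.
have ge0 p : 0 <= coldeg (fun _ _ => 1) 0 (vals (b p)).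
  by rewrite coldeg_kth sumr_ge0 // => c _; rewrite /offdiag; case: ifP.
rewrite psumr_eq0 // => /allP h0; apply/ffunP => p; rewrite ffunE.
have := h0 p (mem_index_enum _); rewrite coldeg_kth psumr_eq0 => [/allP hp|c _].
  apply: ksub_inj => c; apply/val_inj; rewrite /= kth_std.
  have := hp c (mem_index_enum _); rewrite /offdiag; case: ltnP => // le _.
  by apply/eqP; rewrite eqn_leq le kth_ge.
by rewrite /offdiag; case: ifP.
Qed.

(** No letter has first index below [i], so the rows before row [i] are those of the highest weight
    tableau. A column with [j] in row [i] therefore stays sorted when this [j] is turned back into
    [i]. *)
Lemma content_move l (b' : tbasis l) (i j : 'I_n) w : word_ok ((i, j) :: w) ->
  same_content b' ((i, j) :: w) ->
  exists (p : tpos l) (I : ksub n (tag p).+1), [/\ low i (upd b' I),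
    ext_lie (delta_mx j i : 'M[K]_n) (b' p) I = 1 & same_content (upd b' I) w].
Proof.
rewrite word_ok_cons => /and3P[/= ij ai ok] ct.
have lowk (p : tpos l) (c : 'I_(tag p).+1) : (c < i)%N -> kth (b' p) c = c :> nat.
  (* A probe counting the entries that exceed their row in the rows before [i]. *)
  pose h (c x : nat) : int := (c < i)%N%:Z.
  have h0 : deg (sigma h) b' = 0.
    rewrite ct /word_deg big_cons {1}/h /= ltnn add0r big_seq big1 // => x xw.
    by rewrite /h ltnNge (allP ai _ xw).
  have ge0 c' x : 0 <= offdiag h c' x by rewrite /offdiag /h; case: ifP => // _; case: ltnP.
  move: h0; rewrite degE => /eqP; rewrite psumr_eq0 => [/allP/(_ p (mem_index_enum _))|q _]; last first.
    by rewrite coldeg_kth sumr_ge0.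
  rewrite /= coldeg_kth psumr_eq0 // => /allP/(_ c (mem_index_enum _)) /=.
  rewrite /offdiag /h; case: ltnP => [_|le _] ci; first by move: ci; case: ltnP.
  by apply/eqP; rewrite eqn_leq le kth_ge.
have [p [e [ei ej]]] : exists (p : tpos l) (e : 'I_(tag p).+1), e = i :> nat /\ kth (b' p) e = j.
  (* A probe counting the entries [j] in row [i]. *)
  pose h (c x : nat) : int := ((c == i) && (x == j))%:Z.
  have h0 : deg (sigma h) b' != 0.
    rewrite ct /word_deg big_cons {1}/h /= !eqxx /=.
    by apply: lt0r_neq0; rewrite ltr_pwDl //; apply: sumr_ge0.
  apply: contra_notP (negP h0) => H; rewrite degE big1 // => p _.
  rewrite coldeg_kth big1 // => c _; rewrite /offdiag /h; case: ifP => // _.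
  case: eqP => //= ci; case: eqP => // kj; case: H; exists p, c; split=> //.
  exact: val_inj.
have jJ : j \in val (b' p) by rewrite -ej kth_mem.
have iJ : i \notin val (b' p).
  apply/negP => /mem_kth[c ic]; have : (kth (b' p) c < kth (b' p) e)%N by rewrite -ic ej.
  rewrite kth_mono ei => ci; have := lowk p c ci; rewrite -ic => ic'.
  by rewrite -ic' ltnn in ci.
have cI : #|i |: (val (b' p) :\ j)| == (tag p).+1.
  rewrite cardsU1 !inE (negbTE iJ) andbF /=.
  by have := eqP (valP (b' p)); rewrite (cardsD1 j) jJ => ->.
pose I : ksub n (tag p).+1 := exist (fun I : {set 'I_n} => #|I| == (tag p).+1) _ cI.
have kI c : kth I c = if c == e then i else kth (b' p) c.
  move: c; apply: kth_eq => [c d cd|c]; last first.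
    case: eqP => [_|/eqP ce]; rewrite !inE ?eqxx // kth_mem andbT -ej (inj_eq (@kth_inj _ _ _)).
    by rewrite ce orbT.
  have [ce|ce] := eqVneq c e; have [de|de] := eqVneq d e.
  - by rewrite ce de ltnn in cd.
  - by apply: ltn_trans ij _; rewrite -ej kth_mono -ce.
  - by rewrite lowk -?ei -?de.
  - by rewrite kth_mono.
exists p, I; split.
- apply/lowP => q x xi xq; have xb : x \in val (b' q).
    rewrite (_ : x = kth (b' q) (Ordinal (xq : x < (tag q).+1)%N)) ?kth_mem //.
    by apply/val_inj; rewrite /= lowk.
  have [qp|qp] := eqVneq q p; last by rewrite upd_out.
  subst q; rewrite upd_in !inE xb andbT.
  have -> : x != j by apply: contraTneq xi => ->; rewrite -leqNgt ltnW.
  by rewrite orbT.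
- apply: (@ext_lie_1 K n _ _ _ i j e) => //; first by rewrite kI eqxx.
  by move=> c ce; rewrite kI (negbTE ce).
move=> h; have := ct h; rewrite /word_deg big_cons /= !degE.
rewrite (sum_upd (fun (q : tpos l) (J : ksub n (tag q).+1) => coldeg h 0 (vals J))).
rewrite (bigD1 p) //= !coldeg_kth (bigD1 e) //= [X in _ -> X + _ = _](bigD1 e) //=.
rewrite kI eqxx ej ei offdiag_id add0r {1}/offdiag ij -!addrA => /addrI <-.
congr (_ + _); apply: eq_bigr => c ce; by rewrite kI (negbTE ce).
Qed.

(** There is no cancellation. Since [b] has the content of the word, the strict degree bound is
    attained, so every nonzero contribution is a replacement in place, with coefficient 1, from a
    tableau with the content of the shorter word. [content_move] supplies one such contribution. *)
Lemma mono_gt0 l w (b : tbasis l) : word_ok w -> same_content b w ->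
  0 < cf (mono l w) b.
Proof.
elim: w b => [|[i j] w IH] b ok ct.
  by rewrite /= (content_nil ct) cf_vhw eqxx.
have ok' := ok; rewrite word_ok_cons in ok'; case/and3P: ok' => [/= ij ai okw].
have [p0 [I0 [lo0 ext0 ct0]]] := content_move ok ct.
have ss := @sqdiff_ssubmod n.
have ge0 (p : tpos l) (I : ksub n (tag p).+1) : 0 <= ext_lie (delta_mx j i : 'M[K]_n) (b p) I *
    (if low i (upd b I) then cf (mono l w) (upd b I) else 0).
  have [->|nz] := eqVneq (ext_lie (delta_mx j i : 'M[K]_n) (b p) I) 0; first by rewrite mul0r.
  case: ifP => lo; last by rewrite mulr0.
  have [->|nzu] := eqVneq (cf (mono l w) (upd b I)) 0; first by rewrite mulr0.
  have [iI jI eI] := ext_lie_move (negbT (ltn_eqF ij)) nz.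
  have mv : moves i j (upd b I) b p.
    by split; rewrite ?upd_in // => q qp; rewrite upd_out.
  have le1 := moves_deg_le ij mv (ssubmodW ss).
  have le2 := mono_deg_le (ssubmodW ss) okw nzu.
  have := ct sqdiff; rewrite {1}/word_deg big_cons /= -/(word_deg _ _) => e.
  have e0 : deg (sigma sqdiff) (upd b I) = word_deg sqdiff w by lia.
  have [eh [e1 [k1 k2 k3]]] := moves_eq ij mv ss (etrans e (congr1 (fun x => _ + x) (esym e0))).
  rewrite upd_in in k1 k3.
  rewrite (ext_lie_1 K k1 k2 k3) mul1r ltW // IH // => h.
  by have := ct h; rewrite eh /word_deg big_cons /= => /addrI.
rewrite /= phiE (bigD1 p0) //= ltr_pwDl //; last by apply: sumr_ge0 => p _; apply: sumr_ge0.
rewrite (bigD1 I0) //= ltr_pwDl //; last by apply: sumr_ge0.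
by rewrite lo0 ext0 mul1r IH.
Qed.

End Words.

(** * The monomial basis *)

Section Triangular.
Variables (K : fieldType) (T : finType) (N : T -> T -> K) (d : T -> int).
Hypothesis Nd : forall t, N t t != 0.
Hypothesis Nu : forall s t, N s t != 0 -> s = t \/ d t < d s.

(** For a vector in the left kernel, take an index of greatest [d] in its support: only the diagonal
    term survives there, so the matrix is invertible. *)
Lemma triangular_solve (f : T -> K) : exists c : T -> K, forall t, f t = \sum_s c s * N s t.
Proof.
pose A : 'M[K]_#|T| := \matrix_(i, j) N (enum_val i) (enum_val j).
have sumE (v : 'rV[K]_#|T|) t :
    (v *m A) 0 (enum_rank t) = \sum_s v 0 (enum_rank s) * N s t.
  rewrite mxE (reindex (@enum_rank T)) /=; last first.
    by exists enum_val => x _; rewrite ?enum_rankK ?enum_valK.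
  by apply: eq_bigr => s _; rewrite mxE !enum_rankK.
have Au : A \in unitmx.
  rewrite -row_free_unit; apply: inj_row_free => v vA.
  apply/rowP => i; rewrite mxE; apply/eqP/negPn/negP => vi.
  have vi' : v 0 (enum_rank (enum_val i)) != 0 by rewrite enum_valK.
  case: (@Order.TotalTheory.arg_maxP _ _ _ (enum_val i) (fun t => v 0 (enum_rank t) != 0) d vi') => t vt max_t.
  have := sumE v t; rewrite vA mxE (bigD1 t) //= big1 ?addr0 => [/esym/eqP|s st].
    by rewrite mulf_eq0 (negbTE vt) (negbTE (Nd t)).
  have [->|vs] := eqVneq (v 0 (enum_rank s)) 0; first by rewrite mul0r.
  have [->|/Nu[e|lt]] := eqVneq (N s t) 0; first by rewrite mulr0.
    by rewrite e eqxx in st.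
  by have := lt_le_trans lt (max_t s vs); rewrite ltxx.
exists (fun s => ((\row_i f (enum_val i)) *m invmx A) 0 (enum_rank s)) => t.
by rewrite -sumE mulmxKV // mxE enum_rankK.
Qed.

End Triangular.

Section StdInjective.
Variable n : nat.
Implicit Types (l : dweight n).

Lemma coldeg_count c x k (I : ksub n k) : (c < x)%N ->
  coldeg (fun c' x' => ((c' == c) && (x <= x')%N)%:Z) 0 (vals I) =
  ((c < k) && (x <= nth 0 (vals I) c))%N%:Z.
Proof.
move=> cx; rewrite coldeg_nth size_vals.
case: (ltnP c k) => ck /=; last first.
  rewrite big1 // => e _; rewrite add0n /offdiag; case: eqP => [e'|_]; last by rewrite if_same.
  by have := ltn_ord e; rewrite e' ltnNge ck.
rewrite (bigD1 (Ordinal ck)) //= big1 ?addr0.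
  rewrite add0n /offdiag eqxx /=; case: (leqP x) => h; last by rewrite if_same.
  by rewrite (leq_trans cx h).
move=> e; rewrite -val_eqE /= => /negbTE ec.
by rewrite add0n /offdiag ec /= if_same.
Qed.

Lemma std_inj l (b b' : tbasis l) : std b -> std b' ->
  (forall h, deg (sigma h) b = deg (sigma h) b') -> b = b'.
Proof.
pose A c x (b : tbasis l) := [set q : tpos l | (c < (tag q).+1)%N && (x <= nth 0 (vals (b q)) c)%N].
have cA c x (b1 : tbasis l) : (c < x)%N ->
    deg (sigma (fun c' x' => ((c' == c) && (x <= x')%N)%:Z)) b1 = #|A c x b1|%:Z.
  move=> cx; rewrite degE; under eq_bigr do rewrite coldeg_count //.
  rewrite -(big_morph Posz PoszD (erefl _)) -sum1dep_card [in RHS]big_mkcond /=.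
  by congr Posz; apply: eq_bigr => q _; case: ifP.
have upA c x (b1 : tbasis l) q q' : std b1 -> q \in A c x b1 ->
    (pos_rank q < pos_rank q')%N -> (c < (tag q').+1)%N -> q' \in A c x b1.
  move=> /stdP sb; rewrite !inE => /andP[cq xq] qq' cq'; rewrite cq' /=.
  by apply: leq_trans xq _; have := sb q q' (Ordinal cq) (Ordinal cq') qq' (erefl _); rewrite !kth_vals.
have subA c x (b1 b2 : tbasis l) : std b1 -> std b2 -> #|A c x b1| = #|A c x b2| ->
    A c x b1 \subset A c x b2.
  move=> s1 s2 e; apply/negPn/negP => ns.
  have [q q1 q2] := subsetPn ns.
  have [q' q'2 q'1] : exists2 q', q' \in A c x b2 & q' \notin A c x b1.
    apply/subsetPn; apply: contra ns => s21.
    have /eqP <- : A c x b2 == A c x b1 by rewrite eqEcard s21 e /=.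
    exact: subxx.
  have cq : (c < (tag q).+1)%N by move: q1; rewrite inE => /andP[].
  have cq' : (c < (tag q').+1)%N by move: q'2; rewrite inE => /andP[].
  case: (ltngtP (pos_rank q) (pos_rank q')) => [lt|lt|/pos_rank_inj e'].
  - by rewrite (upA _ _ _ _ _ s1 q1 lt cq') in q'1.
  - by rewrite (upA _ _ _ _ _ s2 q'2 lt cq) in q2.
  - by rewrite e' q'2 in q2.
have le (b1 b2 : tbasis l) : std b1 -> std b2 ->
    (forall h, deg (sigma h) b1 = deg (sigma h) b2) ->
    forall q c, (kth (b1 q) c <= kth (b2 q) c)%N.
  move=> s1 s2 e q c; rewrite leqNgt; apply/negP => lt.
  have cx : (c < kth (b1 q) c)%N by apply: leq_ltn_trans (kth_ge _ _) lt.
  have eA : #|A c (kth (b1 q) c) b1| = #|A c (kth (b1 q) c) b2|.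
    by have := e (fun c' x' => ((c' == c) && (kth (b1 q) c <= x')%N)%:Z); rewrite !cA // => -[].
  have := subA _ _ _ _ s1 s2 eA => /subsetP/(_ q); rewrite !inE ltn_ord /= -kth_vals leqnn.
  by rewrite -kth_vals leqNgt lt => /(_ isT).
move=> s1 s2 e; apply/ffunP => q; apply: ksub_inj => c; apply/val_inj/eqP.
by rewrite eqn_leq !le.
Qed.

End StdInjective.

Section Basis.
Variables (K : numFieldType) (n : nat).
Implicit Types (l : dweight n).

Definition bword l (b : tbasis l) : word n := sval (cid (word_exists b)).

Lemma bword_ok l (b : tbasis l) : word_ok (bword b).
Proof. by have [] := svalP (cid (word_exists b)). Qed.

Lemma bword_content l (b : tbasis l) : same_content b (bword b).
Proof. by have [] := svalP (cid (word_exists b)). Qed.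

Definition bmono l (b : tbasis l) : Urep K l := mono K l (bword b).

Lemma bmono_neq0 l (b : tbasis l) : cf (bmono b) b != 0.
Proof. by apply: lt0r_neq0; apply: mono_gt0 (bword_ok b) (bword_content b). Qed.

Lemma bmono_deg_le a l (b b' : tbasis l) : submod n a -> cf (bmono b) b' != 0 ->
  deg (sigma a) b' <= deg (sigma a) b.
Proof. by move=> ha /(mono_deg_le ha (bword_ok b)); rewrite (bword_content b a). Qed.

Lemma bmono_std l (b b' : tbasis l) : std b -> std b' -> cf (bmono b) b' != 0 ->
  b = b' \/ deg (sigma sqdiff) b' < deg (sigma sqdiff) b.
Proof.
move=> sb sb' nz; have ss := @sqdiff_ssubmod n.
have := bmono_deg_le (ssubmodW ss) nz; rewrite le_eqVlt => /predU1P[e|]; last by right.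
left; apply: std_inj => // h.
have -> := mono_content ss (bword_ok b) nz; first exact: bword_content.
by rewrite e; exact: bword_content.
Qed.

Lemma std_interp l (u : Urep K l) : exists c : tbasis l -> K,
  forall b, std b -> cf u b = cf (\sum_(b' | std b') c b' *: bmono b') b.
Proof.
(* Completed by the identity outside the semistandard tableaux, to have a triangular matrix on the
   whole index type. *)
pose N (s t : tbasis l) : K := if std s && std t then cf (bmono s) t else (s == t)%:R.
have Nd t : N t t != 0 by rewrite /N; case: ifP => _; rewrite ?bmono_neq0 // eqxx oner_eq0.
have Nu s t : N s t != 0 -> s = t \/ deg (sigma sqdiff) t < deg (sigma sqdiff) s.
  rewrite /N; case: ifP => [/andP[ss st]|_]; first exact: bmono_std.
  by case: (s =P t) => [|_]; [left|rewrite eqxx].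
have [c hc] := triangular_solve Nd Nu (cf u); exists c => b sb.
rewrite cf_sum hc (bigID (@std n l)) /= [X in _ + X]big1 ?addr0 => [|b' nb'].
  by apply: eq_bigr => b' sb'; rewrite cfZ /N sb sb'.
rewrite /N (negbTE nb') /=; case: eqP => [e|]; last by rewrite mulr0.
by rewrite e sb in nb'.
Qed.

(** The combination matching the semistandard coordinates of [u] differs from [u] by a vector of the
    hull without such coordinates, hence by 0. *)
Lemma hull_span l (u : Urep K l) : in_hull (fun=> True) u ->
  (forall b, in_hull (fun=> True) (@bmono l b)) ->
  exists c : tbasis l -> K, u = \sum_(b | std b) c b *: bmono b.
Proof.
move=> hu hm; have [c hc] := std_interp u; exists c.
apply/eqP; rewrite -subr_eq0 -scaleN1r addrC; apply/eqP/hull_std0; last first.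
  by move=> b sb; rewrite cfD cfZ mulN1r -hc // addNr.
apply: in_hull_lincomb => //.
elim/big_ind: _ => [f _|x y hx hy|b _].
- by rewrite big1 // => b _; rewrite cf0 mulr0.
- by rewrite -[x]scale1r; apply: in_hull_lincomb.
- by rewrite -[_ *: _]addr0; apply: in_hull_lincomb => // f _;
    rewrite big1 // => b' _; rewrite cf0 mulr0.
Qed.

Lemma vhw_uvec l : vhw K l = uvec l (fun i s => (i == s :> nat)%:R).
Proof.
pose h (i : 'I_n) (s : nat) : K := (i == s :> nat)%:R.
apply: cfP => b; rewrite cf_vhw cf_uvec -/h.
have minor_std (k : 'I_n.-1) (I : ksub n k.+1) : minor h I = (I == ksub_std k)%:R.
  have [->|nI] := eqVneq I (ksub_std k).
    rewrite -[RHS](det1 K k.+1); congr (\det _); apply/matrixP => r s.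
    by rewrite !mxE /h kth_std.
  apply/eqP; apply: contra_neqT nI => dI; apply/val_inj/esym/eqP.
  rewrite eqEcard (eqP (valP I)) (eqP (valP (ksub_std k))) leqnn andbT.
  apply/subsetP => y; rewrite inE -ltnS => yk.
  apply: contra_neqT dI => yI; rewrite /minor /rowdet (expand_det_col _ (Ordinal yk)).
  rewrite big1 // => r _; rewrite mxE /h /=; case: eqP => [/val_inj e|]; last by rewrite mul0r.
  by rewrite -e kth_mem in yI.
have [->|nb] := eqVneq b (hw_basis l).
  by rewrite big1 // => p _; rewrite minor_std ffunE eqxx.
have [p np] : exists p, b p != ksub_std (tag p).
  apply: contra_notP (negP nb) => H; apply/eqP/ffunP => p; rewrite ffunE.
  by apply/eqP/negPn/negP => h'; apply: H; exists p.
by rewrite (bigD1 p) //= minor_std (negbTE np) mul0r.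
Qed.

Lemma L_sub_hull l (u : Urep K l) : u \in Lrep K l -> in_hull (fun=> True) u.
Proof.
have hull0 : in_hull (fun=> True) (0 : Urep K l).
  by move=> f _; rewrite big1 // => b _; rewrite cf0 mulr0.
have [W hW] := pred_vspace hull0 (@in_hull_lincomb K n l (fun=> True)).
have [_ _ min] := gensubP [set lie_act l X | X in [set X : 'M[K]_n | \tr X = 0]]%classic (vhw K l).
move=> uL; apply/hW; apply: subvP uL; apply: min; first by apply/hW; rewrite vhw_uvec => f; apply.
move=> _ [X _ <-]; apply/subvP => _ /memv_imgP[v /hW vW ->]; apply/hW.
exact: in_hull_lie.
Qed.

Lemma lie_delta_L l (i j : 'I_n) (u : Urep K l) : (i < j)%N -> u \in Lrep K l ->
  lie_act l (delta_mx j i) u \in Lrep K l.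
Proof.
move=> ij uL; have [_ st _] :=
  gensubP [set lie_act l X | X in [set X : 'M[K]_n | \tr X = 0]]%classic (vhw K l).
apply: (subvP (st (lie_act l (delta_mx j i)) _)); last exact: memv_img.
exists (delta_mx j i) => //=; rewrite /mxtrace big1 // => k _; rewrite mxE.
by case: eqP => // ->; case: eqP => // e; rewrite e ltnn in ij.
Qed.

Lemma vhw_L l : vhw K l \in Lrep K l.
Proof. by have [] := gensubP [set lie_act l X | X in [set X : 'M[K]_n | \tr X = 0]]%classic (vhw K l). Qed.

Lemma mono_L l w : word_ok w -> mono K l w \in Lrep K l.
Proof.
elim: w => [|[i j] w IH] ok; first exact: vhw_L.
rewrite /= phi_mono //; move: ok; rewrite word_ok_cons => /and3P[ij _ ok].
by apply: lie_delta_L => //; exact: IH.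
Qed.

(** The hull is stable and contains the highest weight vector, so it contains [Lrep]; it is spanned
    by monomials, which lie in [Lrep]. *)
Lemma hullP l (u : Urep K l) : reflect (in_hull (fun=> True) u) (u \in Lrep K l).
Proof.
apply: (iffP idP) => [|hu]; first exact: L_sub_hull.
have [|c ->] := hull_span hu; first by move=> b; apply/L_sub_hull/mono_L/bword_ok.
by apply: memv_suml => b _; apply/memvZ/mono_L/bword_ok.
Qed.

Lemma L_span l (u : Urep K l) : u \in Lrep K l ->
  exists c : tbasis l -> K, u = \sum_(b | std b) c b *: bmono b.
Proof.
move=> /hullP hu; apply: hull_span => // b; apply/hullP/mono_L/bword_ok.
Qed.

Definition in_SL (h : 'I_n -> nat -> K) : Prop :=
  exists g : 'M[K]_n, \det g = 1 /\ forall i s : 'I_n, h i s = g i s.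

(** Starting from the identity matrix, a monomial uses only lines h + tXh with X a strictly lower
    triangular matrix unit. Passing along such a line multiplies by 1 + tX, of determinant 1, so it
    never leaves [in_SL]. *)
Lemma L_hull_SL l (u : Urep K l) : u \in Lrep K l -> in_hull in_SL u.
Proof.
have hull0 : in_hull in_SL (0 : Urep K l).
  by move=> f _; rewrite big1 // => b _; rewrite cf0 mulr0.
case/L_span => c ->; elim/big_ind: _ => [//|x y hx hy|b _].
  by rewrite -[x]scale1r; apply: in_hull_lincomb.
rewrite -[_ *: _]addr0; apply: in_hull_lincomb => //.
rewrite /bmono; elim: (bword b) (bword_ok b) => [|[i j] w IH] ok.
  move=> f; rewrite /= vhw_uvec; apply; exists 1%:M; rewrite det1; split=> // i s.
  by rewrite mxE.
rewrite /= phi_mono //; move: ok; rewrite word_ok_cons => /and3P[/= ij _ ok].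
apply: in_hull_lie (IH ok) => h t [g [dg eg]].
exists ((1%:M + t *: delta_mx j i) *m g); split.
  rewrite det_mulmx dg mulr1 det_trig.
    rewrite big1 // => k _; rewrite !mxE eqxx.
    by case: (k =P j) => [->|_]; rewrite /= ?(gtn_eqF ij) ?mulr0 ?addr0 // -val_eqE /= gtn_eqF // mulr0 addr0.
  apply/is_trig_mxP => p q pq; rewrite !mxE -val_eqE (ltn_eqF pq) add0r.
  by case: (p =P j) => [e|_]; case: (q =P i) => [e'|_]; rewrite ?mulr0 //;
     move: pq; rewrite e e' ltnNge (ltnW ij).
move=> p s; rewrite mulmxDl mul1mx mxE eg -scalemxAl mxE; congr (_ + _ * _).
by rewrite mxE; apply: eq_bigr => x _; rewrite eg.
Qed.

Lemma memUfil (s : pidx n -> int) l m (u : Urep K l) :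
  u \in Ufil K s l m <-> forall b, cf u b != 0 -> deg s b <= m.
Proof.
split=> [/memv_sumP[f hf ->] b nz|h].
  have : \sum_(b' | deg s b' <= m) cf (f b') b != 0 by rewrite -cf_sum.
  apply: contraNT => ndeg; rewrite big1 // => b' hb'.
  have /vlineP[c ->] := hf b' hb'; rewrite cfZ cf_ebasis.
  by case: eqP => [e|_]; rewrite ?mulr0 //; rewrite -e (negbTE ndeg) in hb'.
rewrite [u]urepE; apply: memv_suml => b _.
have [->|nz] := eqVneq (cf u b) 0; first by rewrite scale0r mem0v.
by apply: memvZ; apply: (subvP (sumv_sup b _ (subvv _))) (memv_line _); exact: h.
Qed.

Section Filtration.
Variables (a : nat -> nat -> int) (l : dweight n).
Hypothesis ha : submod n a.
Local Notation S := (sigma a).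

(** Suppose that terms of degree above m occur. Among them choose one of greatest degree for [a],
    and among those one of greatest degree for [sqdiff]. No other term reaches its tableau, so [u]
    has a nonzero coordinate of degree above m. *)
Lemma Lfil_span m (u : Urep K l) : u \in Lfil K S l m ->
  exists c : tbasis l -> K, u = \sum_(b | std b) c b *: bmono b /\
    forall b, std b -> c b != 0 -> deg S b <= m.
Proof.
rewrite memv_cap => /andP[/L_span[c eu] /memUfil hu]; exists c; split=> // b0 sb0 cb0.
apply/negPn/negP; rewrite -ltNge => lt0.
pose P b := [&& std b, c b != 0 & m < deg S b].
have P0 : P b0 by rewrite /P sb0 cb0.
case: (@Order.TotalTheory.arg_maxP _ _ _ b0 P (fun b => deg S b) P0) => b1 P1 max1.
pose Q b := P b && (deg S b == deg S b1).
have Q1 : Q b1 by rewrite /Q P1 eqxx.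
case: (@Order.TotalTheory.arg_maxP _ _ _ b1 Q (fun b => deg (sigma sqdiff) b) Q1) => b Qb max2.
have /andP[/and3P[sb cb mb] /eqP eb] := Qb.
have ub0 : cf u b = 0 by apply/eqP/negPn/negP => /hu; rewrite leNgt mb.
have := cf_sum (index_enum _) (@std n l) (fun b => c b *: bmono b) b.
rewrite -eu ub0 (bigD1 b) //= cfZ big1 ?addr0.
  by move/esym/eqP; rewrite mulf_eq0 (negbTE cb) (negbTE (bmono_neq0 b)).
move=> b' /andP[sb' nb']; rewrite cfZ.
have [->|cb'] := eqVneq (c b') 0; first by rewrite mul0r.
have [->|nz] := eqVneq (cf (bmono b') b) 0; first by rewrite mulr0.
have d1 := bmono_deg_le ha nz.
have Pb' : P b' by rewrite /P sb' cb' (lt_le_trans mb d1).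
have d2 : deg S b' == deg S b1 by rewrite eq_le -eb d1 andbT eb; exact: max1 Pb'.
have Qb' : Q b' by rewrite /Q Pb'.
case: (bmono_std sb' sb nz) => [e|lt]; first by rewrite e eqxx in nb'.
by have := lt_le_trans lt (max2 _ Qb'); rewrite ltxx.
Qed.

Lemma bmono_Lfil m (b : tbasis l) : deg S b <= m -> bmono b \in Lfil K S l m.
Proof.
move=> bm; rewrite memv_cap mono_L ?bword_ok //=; apply/memUfil => b' nz.
exact: le_trans (bmono_deg_le ha nz) bm.
Qed.

Lemma wt_proj_L nu (u : Urep K l) : u \in Lrep K l -> wt_proj l nu u \in Lrep K l.
Proof.
case/L_span => c ->; rewrite linear_sum; apply: memv_suml => b _.
rewrite linearZ; apply: memvZ => /=.
pose W := wt_of K l + \sum_(x <- bword b) (eps K n x.2 - eps K n x.1).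
suff -> : wt_proj l nu (bmono b) = if W == nu then bmono b else 0.
  by case: ifP => _; rewrite ?mem0v // mono_L ?bword_ok.
apply: cfP => b'; rewrite cf_wt_proj.
have [e|nz] := eqVneq (cf (bmono b) b') 0.
  by rewrite e if_same; case: ifP; rewrite ?cf0 // e.
by rewrite (mono_wt (bword_ok b) nz) -/W; case: ifP; rewrite ?cf0.
Qed.

Lemma wt_proj_Lfil nu m (u : Urep K l) :
  u \in Lfil K S l m -> wt_proj l nu u \in Lfil K S l m.
Proof.
rewrite !memv_cap => /andP[uL /memUfil um]; rewrite wt_proj_L //=.
apply/memUfil => b; rewrite cf_wt_proj; case: ifP => _; last by rewrite eqxx.
exact: um.
Qed.

Lemma phi_Lfil (i j : 'I_n) m (u : Urep K l) : (i < j)%N ->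
  u \in Lfil K S l m -> phi K l i j u \in Lfil K S l (m + a i j).
Proof.
move=> ij; rewrite !memv_cap => /andP[uL /memUfil um]; apply/andP; split.
  rewrite /phi comp_lfunE; apply: lie_delta_L => //.
  by rewrite sum_lfunE; apply: memv_suml => nu _; exact: wt_proj_L.
apply/memUfil => b' /(phi_moves ij)[b [p [mv /um h]]].
by have := moves_deg_le ij mv ha; lia.
Qed.

End Filtration.
End Basis.

(** * Coordinates on the degenerate representations *)

Section GradedCoordinates.
Variables (K : numFieldType) (n : nat) (s : pidx n -> int) (l : dweight n).
Local Notation gr := (gr K s l).
Local Notation Lfil := (Lfil K s l).

Definition deg_of (b : tbasis l) : degs s l := SeqSub (codom_f (@deg n s l) b).

(** The coefficient at [e_b] of an element of [gr l], seen inside the graded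
    space [U_l]. *)
Definition xi (b : tbasis l) (y : gr) : K :=
  cf (quot_rep (dprodv_fun y (deg_of b))) b.

Lemma xi_is_linear b : linear (xi b : gr -> K^o).
Proof.
by move=> c x y; rewrite /xi dprodvD dprodvZ /quot_rep linearP cfD cfZ.
Qed.

Definition xi_lin b : {linear gr -> K^o} := HB.pack (xi b : gr -> K^o)
  (GRing.isLinear.Build _ _ _ _ (xi b : gr -> K^o) (xi_is_linear b)).

Lemma xiD b x y : xi b (x + y) = xi b x + xi b y.
Proof. exact: (linearD (xi_lin b)). Qed.

Lemma xiZ b c x : xi b (c *: x) = c * xi b x.
Proof. exact: (linearZ_LR (xi_lin b)). Qed.

Lemma xi0 b : xi b 0 = 0.
Proof. exact: (linear0 (xi_lin b)). Qed.

Lemma xi_sum b I (r : seq I) (P : pred I) F :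
  xi b (\sum_(i <- r | P i) F i) = \sum_(i <- r | P i) xi b (F i).
Proof. exact: (linear_sum (xi_lin b)). Qed.

Lemma xi_symb m x b : x \in Lfil m ->
  xi b (symb s m x) = if deg s b == m then cf x b else 0.
Proof.
move=> hx; rewrite /xi dprodv_ofE /=; case: eqP => [e|_]; last first.
  by rewrite /quot_rep linear0 cf0.
rewrite e; set q := quot_map _ _ x.
have : x - quot_rep q \in Lfil (m - 1).
  rewrite -(quot_map_eq0 (Lfil_sub K s l m)) ?rpredB ?quot_rep_mem //.
  by rewrite linearB /= quot_repK subrr.
rewrite memv_cap => /andP[_ /memUfil/(_ b)].
rewrite -[x in RHS](subrK (quot_rep q)) [in RHS]cfD.
have [->|nz /(_ isT)] := eqVneq (cf (x - quot_rep q) b) 0; first by rewrite add0r.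
by rewrite e; lia.
Qed.

(** The associated graded space of [Lrep] embeds into that of the ambient space: an element of
    [Lfil l m] without coordinates of degree m lies in [Lfil l (m - 1)]. *)
Lemma xi_inj y : (forall b, xi b y = 0) -> y = 0.
Proof.
move=> h; apply: dprodvP => d; rewrite [RHS]dprodv_ofE.
rewrite -[LHS]quot_repK; apply/eqP.
rewrite quot_map_eq0 ?Lfil_sub ?quot_rep_mem //.
have := quot_rep_mem (dprodv_fun y d); rewrite !memv_cap => /andP[-> /memUfil hU] /=.
apply/memUfil => b nz; have le := hU b nz.
suff : deg s b != ssval d by move: le; case: ltgtP => // lt _ _; lia.
apply: contraNneq nz => e; have := h b; rewrite /xi.
have -> : deg_of b = d by apply/val_inj.
by move/eqP.
Qed.

Lemma xi_ext x y : (forall b, xi b x = xi b y) -> x = y.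
Proof.
move=> h; apply/eqP; rewrite -subr_eq0; apply/eqP/xi_inj => b.
by rewrite -scaleN1r xiD xiZ h mulN1r subrr.
Qed.

Lemma gr_ind (P : gr -> Prop) : P 0 -> (forall x y, P x -> P y -> P (x + y)) ->
  (forall m x, x \in Lfil m -> P (symb s m x)) -> forall y, P y.
Proof.
move=> P0 PD PS y; rewrite (gr_sum y); elim/big_ind: _ => // d _.
apply: PS; exact: quot_rep_mem.
Qed.

End GradedCoordinates.

Section GradedAction.
Variables (K : numFieldType) (n : nat) (a : nat -> nat -> int).
Hypothesis ha : submod n a.
Local Notation S := (sigma a).
Implicit Types (l : dweight n).

(** The formula [phiE] restricted to the moves that raise the degree by exactly [a i j]. *)
Definition graded_coef l (i j : 'I_n) (b' : tbasis l) (x : tbasis l -> K) : K :=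
  \sum_(p : tpos l) \sum_(I : ksub n (tag p).+1)
    ext_lie (delta_mx j i : 'M[K]_n) (b' p) I *
    (if low i (upd b' I) && (deg S b' == deg S (upd b' I) + a i j)
     then x (upd b' I) else 0).

Lemma phiS_symb l (i j : 'I_n) m (x : Urep K l) : (i < j)%N -> x \in Lfil K S l m ->
  phiS K a l i j (symb S m x) = symb S (m + a i j) (phi K l i j x).
Proof. by move=> ij; apply: gr_map_symb => p y; exact: phi_Lfil. Qed.

Lemma wt_projS_symb l nu m (x : Urep K l) : x \in Lfil K S l m ->
  wt_projS S l nu (symb S m x) = symb S m (wt_proj l nu x).
Proof.
move=> hx; rewrite -[X in symb S X (wt_proj _ _ _)]addr0.
by apply: gr_map_symb => // p y hy; rewrite addr0; exact: wt_proj_Lfil.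
Qed.

(** On an element of filtration degree m, a move landing in degree m + [a i j] starts in degree at
    least m, hence exactly m: precisely the coordinates of the symbol contribute. *)
Lemma xi_phiS l (i j : 'I_n) (y : gr K S l) b' : (i < j)%N ->
  xi b' (phiS K a l i j y) = graded_coef i j b' (fun b => xi b y).
Proof.
move=> ij; rewrite /graded_coef; move: y; apply: gr_ind => [|x y hx hy|m x hx].
- rewrite linear0 xi0 big1 // => p _; rewrite big1 // => I _.
  by rewrite xi0 if_same mulr0.
- rewrite linearD xiD hx hy -big_split; apply: eq_bigr => p _ /=.
  rewrite -big_split; apply: eq_bigr => I _ /=; rewrite -mulrDr xiD.
  by case: ifP => //; rewrite addr0.
rewrite phiS_symb // xi_symb ?phi_Lfil // phiE.
case: eqP => [e|ne]; last first.
  rewrite big1 // => p _; rewrite big1 // => I _.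
  rewrite xi_symb //; case: ifP => [/andP[_ /eqP e]|_]; last by rewrite mulr0.
  by case: eqP => [e'|_]; rewrite ?mulr0 //; case: ne; rewrite e e'.
apply: eq_bigr => p _; apply: eq_bigr => I _.
have [->|nz] := eqVneq (ext_lie (delta_mx j i : 'M[K]_n) (b' p) I) 0.
  by rewrite !mul0r.
congr (_ * _); case: ifP => //= lo; rewrite xi_symb // e (inj_eq (addIr _)) [m == _]eq_sym.
case: eqP => // ne; apply/eqP/negPn/negP => nzx; case: ne; apply: le_anti.
have [iI jI eI] := ext_lie_move (negbT (ltn_eqF ij)) nz.
have mv : moves i j (upd b' I) b' p.
  by split; rewrite ?upd_in // => q qp; rewrite upd_out.
have := moves_deg_le ij mv ha.
move: hx; rewrite memv_cap => /andP[_ /memUfil/(_ _ nzx) ->] /=.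
by rewrite e addrC lerD2l.
Qed.

Lemma xi_wt_projS l nu (y : gr K S l) b :
  xi b (wt_projS S l nu y) = if wt_basis K b == nu then xi b y else 0.
Proof.
move: y; apply: gr_ind => [|x y hx hy|m x hx].
- by rewrite linear0 xi0 if_same.
- by rewrite linearD !xiD hx hy; case: ifP => //; rewrite addr0.
rewrite wt_projS_symb // !xi_symb ?wt_proj_Lfil // cf_wt_proj.
by case: ifP; case: ifP.
Qed.

Lemma vhw_Lfil l : vhw K l \in Lfil K S l 0.
Proof.
rewrite memv_cap vhw_L; apply/memUfil => b; rewrite cf_vhw.
by case: (b =P _) => [->|_]; rewrite ?deg_hw // eqxx.
Qed.

Lemma xi_vhwS l (b : tbasis l) : xi b (vhwS K S l) = (b == hw_basis l)%:R.
Proof.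
rewrite xi_symb ?vhw_Lfil // cf_vhw; case: (b =P _) => [->|_]; last by rewrite if_same.
by rewrite deg_hw eqxx.
Qed.

Lemma gr_generated l (W : {vspace gr K S l}) : vhwS K S l \in W ->
  (forall i j : 'I_n, (i < j)%N -> forall y, y \in W -> phiS K a l i j y \in W) ->
  forall y, y \in W.
Proof.
move=> vW sW y.
have monoW w : word_ok w ->
    symb S (word_deg a w) (mono K l w) \in W /\ mono K l w \in Lfil K S l (word_deg a w).
  elim: w => [|[i j] w IH] ok; first by rewrite /word_deg big_nil vhw_Lfil.
  have := ok; rewrite word_ok_cons => /and3P[/= ij _ /IH[IH1 IH2]].
  rewrite /word_deg big_cons addrC -/(word_deg a w) -phiS_symb // phi_Lfil //.
  by split=> //; apply: sW.
move: y; apply: gr_ind => [|x y hx hy|m x hx]; [exact: mem0v|exact: memvD|].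
have [c [-> hc]] := Lfil_span ha hx.
pose sL : {linear Urep K l -> gr K S l} :=
  HB.pack (@symb K n S l m) (GRing.isLinear.Build _ _ _ _ _ (@symb_linear K n S l m)).
rewrite -[symb S m _]/(sL _) linear_sum; apply: memv_suml => b sb; rewrite linearZ /=.
have [->|cb] := eqVneq (c b) 0; first by rewrite scale0r mem0v.
(* Monomials of degree exactly m are reached from the highest weight vector by the operators; those
   of smaller degree have symbol 0 in degree m. *)
apply: memvZ; have := hc b sb cb; rewrite le_eqVlt => /predU1P[e|lt].
  by have [] := monoW _ (bword_ok b); rewrite -(bword_content b a) e.
suff /eqP -> : symb S m (bmono K b) == 0 by exact: mem0v.
by rewrite symb_eq0; apply: bmono_Lfil => //; lia.
Qed.

End GradedAction.

(** * Juxtaposition of tensor factors *)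

Section Join.
Variables (n : nat) (l m r : dweight n).
Hypothesis hr : forall k, r k = (l k + m k)%N.

Fact posl_subproof (p : tpos l) : (tagged p < r (tag p))%N.
Proof. by rewrite hr; apply: leq_trans (ltn_ord _) (leq_addr _ _). Qed.
Fact posr_subproof (p : tpos m) : (l (tag p) + tagged p < r (tag p))%N.
Proof. by rewrite hr ltn_add2l. Qed.

Definition posl (p : tpos l) : tpos r :=
  Tagged (fun k => 'I_(r k)) (Ordinal (posl_subproof p)).
Definition posr (p : tpos m) : tpos r :=
  Tagged (fun k => 'I_(r k)) (Ordinal (posr_subproof p)).

Lemma posl_inj : injective posl.
Proof.
move=> [k i] [k' i'] e; have ek : k = k' := congr1 (fun x => tag x) e; subst k'.
by move/eqP: e; rewrite -tag_eqE /tag_eq /= eqxx /= tagged_asE => /eqP[/val_inj ->].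
Qed.

Lemma posr_inj : injective posr.
Proof.
move=> [k i] [k' i'] e; have ek : k = k' := congr1 (fun x => tag x) e; subst k'.
by move/eqP: e; rewrite -tag_eqE /tag_eq /= eqxx /= tagged_asE => /eqP[/addnI/val_inj ->].
Qed.

Lemma posl_neq_posr p q : posl p != posr q.
Proof.
case: p q => [k i] [k' i']; apply/eqP => e.
have ek : k = k' := congr1 (fun x => tag x) e; subst k'.
move/eqP: e; rewrite -tag_eqE /tag_eq /= eqxx /= tagged_asE => /eqP[e].
by have := ltn_ord i; rewrite e ltnNge leq_addr.
Qed.

Lemma pos_split (p : tpos r) : (exists q, p = posl q) \/ (exists q, p = posr q).
Proof.
case: p => [k i]; case: (ltnP i (l k)) => h; [left|right].
  exists (Tagged (fun k => 'I_(l k)) (Ordinal h)).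
  by congr existT; apply/val_inj.
have h' : (i - l k < m k)%N by rewrite ltn_subLR // -hr.
exists (Tagged (fun k => 'I_(m k)) (Ordinal h')).
by congr existT; apply/val_inj; rewrite /= subnKC.
Qed.

Lemma sum_ord_cast (V : nmodType) N L M (e : N = (L + M)%N) (G : 'I_N -> V)
    (hl : forall i : 'I_L, (i < N)%N) (hm : forall i : 'I_M, (L + i < N)%N) :
  \sum_i G i = \sum_(i < L) G (Ordinal (hl i)) + \sum_(i < M) G (Ordinal (hm i)).
Proof.
by subst N; rewrite big_split_ord; congr (_ + _); apply: eq_bigr => i _;
   congr G; apply/val_inj.
Qed.

Lemma sum_pos (V : nmodType) (F : tpos r -> V) :
  \sum_p F p = \sum_p F (posl p) + \sum_p F (posr p).
Proof.
have E (x : dweight n) (G : tpos x -> V) :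
    \sum_p G p = \sum_k \sum_(i < x k) G (Tagged (fun k => 'I_(x k)) i).
  rewrite (sig_big_dep predT (fun _ => predT)
    (fun k (i : 'I_(x k)) => G (Tagged (fun k => 'I_(x k)) i))) /=.
  by apply: eq_bigr => -[].
rewrite !E -big_split; apply: eq_bigr => k _ /=.
have hl (i : 'I_(l k)) : (i < r k)%N := posl_subproof (Tagged (fun k => 'I_(l k)) i).
have hm (i : 'I_(m k)) : (l k + i < r k)%N := posr_subproof (Tagged (fun k => 'I_(m k)) i).
rewrite (sum_ord_cast (hr k) _ hl hm); congr (_ + _); apply: eq_bigr => i _;
  by congr F; congr existT; apply/val_inj.
Qed.

(** For each k the first [l k] positions belong to [b1] and the following [m k] to [b2]. The last
    branch is a default value, never reached when [r] is the sum of [l] and [m]. *)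
Definition join (b1 : tbasis l) (b2 : tbasis m) : tbasis r :=
  [ffun p : tpos r =>
    if insub (tagged p : nat) is Some i
    then b1 (Tagged (fun k => 'I_(l k)) (i : 'I_(l (tag p))))
    else if insub (tagged p - l (tag p))%N is Some i
    then b2 (Tagged (fun k => 'I_(m k)) (i : 'I_(m (tag p))))
    else ksub_std (tag p)].

Lemma joinl b1 b2 p : join b1 b2 (posl p) = b1 p.
Proof.
case: p => k i; rewrite ffunE /= insubT //= => h.
by congr (b1 (existT _ _ _)); apply/val_inj.
Qed.

Lemma joinr b1 b2 p : join b1 b2 (posr p) = b2 p.
Proof.
case: p => k i; rewrite ffunE /= insubN /=; last by rewrite -leqNgt leq_addr.
have h : (l k + i - l k < m k)%N by rewrite addKn.
rewrite (insubT (fun x => x < m k)%N h) /=.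
by have -> : Sub (l k + i - l k)%N h = i by apply/val_inj; rewrite /= addKn.
Qed.

Lemma join_updl b1 b2 (p : tpos l) (I : ksub n (tag p).+1) :
  @upd n r (join b1 b2) (posl p) I = join (upd b1 I) b2.
Proof.
apply/ffunP => q; case: (pos_split q) => [[q' ->]|[q' ->]].
  rewrite joinl; have [->|ne] := eqVneq q' p; first by rewrite !upd_in.
  by rewrite !upd_out ?joinl // (inj_eq posl_inj).
by rewrite joinr upd_out ?joinr // eq_sym posl_neq_posr.
Qed.

Lemma join_updr b1 b2 (p : tpos m) (I : ksub n (tag p).+1) :
  @upd n r (join b1 b2) (posr p) I = join b1 (upd b2 I).
Proof.
apply/ffunP => q; case: (pos_split q) => [[q' ->]|[q' ->]].
  by rewrite joinl upd_out ?joinl // posl_neq_posr.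
rewrite joinr; have [->|ne] := eqVneq q' p; first by rewrite !upd_in.
by rewrite !upd_out ?joinr // (inj_eq posr_inj).
Qed.

Lemma deg_join s b1 b2 : deg s (join b1 b2) = deg s b1 + deg s b2.
Proof.
rewrite /deg sum_pos; congr (_ + _); apply: eq_bigr => p _.
  by rewrite joinl.
by rewrite joinr.
Qed.

Lemma low_join i b1 b2 : low i (join b1 b2) = low i b1 && low i b2.
Proof.
apply/lowP/andP => [h|[/lowP h1 /lowP h2] p x xi].
  split; apply/lowP => p x xi xp.
    by have := h (posl p) x xi xp; rewrite joinl.
  by have := h (posr p) x xi xp; rewrite joinr.
case: (pos_split p) => [[q ->]|[q ->]]; rewrite ?joinl ?joinr; [exact: h1|exact: h2].
Qed.

Lemma join_hw b1 b2 :
  (join b1 b2 == hw_basis r) = (b1 == hw_basis l) && (b2 == hw_basis m).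
Proof.
apply/eqP/andP => [e|[/eqP -> /eqP ->]].
  split; apply/eqP/ffunP => p; rewrite ffunE.
    by rewrite -(joinl b1 b2) e ffunE.
  by rewrite -(joinr b1 b2) e ffunE.
apply/ffunP => p.
by case: (pos_split p) => [[q ->]|[q ->]]; rewrite ?joinl ?joinr !ffunE.
Qed.

Lemma wt_join (K : numFieldType) b1 b2 :
  wt_basis K (join b1 b2) = wt_basis K b1 + wt_basis K b2.
Proof.
rewrite /wt_basis sum_pos; congr (_ + _); apply: eq_bigr => p _.
  by rewrite joinl.
by rewrite joinr.
Qed.

Lemma wt_of_add (K : numFieldType) : wt_of K r = wt_of K l + wt_of K m.
Proof. by apply/rowP => k; rewrite !mxE hr natrD. Qed.

Lemma join_surj (c : tbasis r) : exists b1 b2, c = join b1 b2.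
Proof.
exists [ffun p => c (posl p)], [ffun p => c (posr p)]; apply/ffunP => p.
by case: (pos_split p) => [[q ->]|[q ->]]; rewrite ?joinl ?joinr ffunE.
Qed.

End Join.

(** * The comultiplication *)

Section TensorPairing.
Variables (K : fieldType) (V W : vectType K).

Definition pairing (f : V -> K) (g : W -> K) (M : tens V W) : K :=
  tens_lift (fun v w => f v * g w : K^o) M.

Lemma pairingE f g M : pairing f g M =
  \sum_i \sum_j M i j * (f (vbasis {:V})`_i * g (vbasis {:W})`_j).
Proof. by []. Qed.

Lemma pairing_is_linear f g : linear (pairing f g : tens V W -> K^o).
Proof.
move=> c M N; rewrite !pairingE scaler_sumr -big_split; apply: eq_bigr => i _ /=.
rewrite scaler_sumr -big_split; apply: eq_bigr => j _ /=.
by rewrite !mxE mulrDl -mulrA.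
Qed.

Definition pairing_lin f g : {linear tens V W -> K^o} := HB.pack (pairing f g : tens V W -> K^o)
  (GRing.isLinear.Build _ _ _ _ (pairing f g : tens V W -> K^o) (pairing_is_linear f g)).

Lemma pairingD f g M N : pairing f g (M + N) = pairing f g M + pairing f g N.
Proof. exact: (linearD (pairing_lin f g)). Qed.

Lemma pairingZ f g c M : pairing f g (c *: M) = c * pairing f g M.
Proof. exact: (linearZ_LR (pairing_lin f g)). Qed.

Lemma pairing_sum f g I (r : seq I) (P : pred I) F :
  pairing f g (\sum_(i <- r | P i) F i) = \sum_(i <- r | P i) pairing f g (F i).
Proof. exact: (linear_sum (pairing_lin f g)). Qed.

Lemma pairing_tensv (f : V -> K) (g : W -> K) v w :
  linear (f : V -> K^o) -> linear (g : W -> K^o) -> pairing f g (tensv v w) = f v * g w.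
Proof.
move=> lf lg; rewrite /pairing (tens_liftE v w) // => x c u v' /=.
  by rewrite lf mulrDl -[_ *: _]/(c * _) -mulrA.
by rewrite lg mulrDr mulrCA.
Qed.

Lemma pairing_tens_map (f : V -> K) (g : W -> K) (F : 'End(V)) (G : 'End(W)) M :
  linear (f : V -> K^o) -> linear (g : W -> K^o) ->
  pairing f g (tens_map F G M) = pairing (f \o F) (g \o G) M.
Proof.
move=> lf lg; rewrite /tens_map {1}/tens_lift pairing_sum pairingE.
apply: eq_bigr => i _; rewrite pairing_sum; apply: eq_bigr => j _.
by rewrite pairingZ pairing_tensv.
Qed.

Lemma tens_map_is_linear (F : 'End(V)) (G : 'End(W)) : linear (tens_map F G).
Proof.
move=> c M N; rewrite /tens_map /tens_lift scaler_sumr -big_split.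
apply: eq_bigr => i _ /=; rewrite scaler_sumr -big_split; apply: eq_bigr => j _ /=.
by rewrite !mxE scalerDl scalerA.
Qed.

Lemma pairing_suml (I : Type) (r : seq I) (c : I -> K) (f : I -> V -> K) g M :
  pairing (fun v => \sum_(i <- r) c i * f i v) g M = \sum_(i <- r) c i * pairing (f i) g M.
Proof.
under [RHS]eq_bigr do rewrite pairingE mulr_sumr.
rewrite exchange_big pairingE; apply: eq_bigr => i _.
under [RHS]eq_bigr do rewrite mulr_sumr.
rewrite exchange_big; apply: eq_bigr => j _ /=.
rewrite mulr_suml mulr_sumr; apply: eq_bigr => x _.
by rewrite -mulrA mulrCA.
Qed.

Lemma pairing_sumr (I : Type) (r : seq I) (c : I -> K) (f : V -> K) (g : I -> W -> K) M :
  pairing f (fun w => \sum_(i <- r) c i * g i w) M = \sum_(i <- r) c i * pairing f (g i) M.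
Proof.
under [RHS]eq_bigr do rewrite pairingE mulr_sumr.
rewrite exchange_big pairingE; apply: eq_bigr => i _.
under [RHS]eq_bigr do rewrite mulr_sumr.
rewrite exchange_big; apply: eq_bigr => j _ /=.
rewrite !mulr_sumr; apply: eq_bigr => x _.
by rewrite (mulrCA (f _)) (mulrCA (M i j)).
Qed.

Lemma free_vbasis (U : vectType K) (c : 'I_(\dim {:U}) -> K) :
  \sum_i c i *: (vbasis {:U})`_i = 0 -> forall i, c i = 0.
Proof.
move=> e i; have /freeP := basis_free (vbasisP {:U}); apply; exact: e.
Qed.

(** For fixed j, applying [y j] to the second factor leaves a vector killed by all [x i], hence 0.
    So every row of [M] is a vector killed by all [y j]. *)
Lemma pairing_inj (I J : Type) (x : I -> V -> K) (y : J -> W -> K) M :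
  (forall i, linear (x i : V -> K^o)) -> (forall j, linear (y j : W -> K^o)) ->
  (forall v, (forall i, x i v = 0) -> v = 0) ->
  (forall w, (forall j, y j w = 0) -> w = 0) ->
  (forall i j, pairing (x i) (y j) M = 0) -> M = 0.
Proof.
move=> lx ly xi yi h.
have lsum (U : vectType K) (f : U -> K) : linear (f : U -> K^o) ->
    forall k (c : 'I_k -> K) (u : 'I_k -> U),
    f (\sum_e c e *: u e) = \sum_e c e * f (u e).
  move=> lf k c u; pose fL : {linear U -> K^o} := HB.pack (f : U -> K^o)
    (GRing.isLinear.Build _ _ _ _ (f : U -> K^o) lf).
  rewrite -[LHS]/(fL _) linear_sum; apply: eq_bigr => e _.
  exact: (linearZ_LR fL).
have h1 j i : \sum_k M i k * y j (vbasis {:W})`_k = 0.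
  apply: (free_vbasis (c := fun i => \sum_k M i k * y j (vbasis {:W})`_k)).
  apply: xi => i'; rewrite lsum // -[RHS](h i' j) pairingE; apply: eq_bigr => k _.
  by rewrite mulr_suml; apply: eq_bigr => e _; rewrite -mulrA [y _ _ * _]mulrC.
apply/matrixP => i k; rewrite mxE; move: k.
apply: free_vbasis; apply: yi => j; rewrite lsum //; exact: h1.
Qed.

End TensorPairing.

(** * Maps out of a cyclic module that preserve coordinates *)

Section Transport.
Variables (K : fieldType) (V T : vectType K) (B I : Type).
Variables (x : B -> V -> K) (y : B -> T -> K).
Hypotheses (lx : forall b, linear (x b : V -> K^o)) (ly : forall b, linear (y b : T -> K^o)).
Hypotheses (x_inj : forall v, (forall b, x b v = 0) -> v = 0).
Hypotheses (y_inj : forall t, (forall b, y b t = 0) -> t = 0).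
Variables (P : I -> Prop) (f : I -> 'End(V)) (g : I -> 'End(T)) (A : I -> B -> (B -> K) -> K).
Hypothesis xf : forall i, P i -> forall b v, x b (f i v) = A i b (x^~ v).
Hypothesis yg : forall i, P i -> forall b t, y b (g i t) = A i b (y^~ t).
Variables (v0 : V) (t0 : T).
Hypothesis x0 : forall b, x b v0 = y b t0.
Hypothesis gen : forall W : {vspace V}, v0 \in W ->
  (forall i, P i -> forall v, v \in W -> f i v \in W) -> forall v, v \in W.

Lemma gen_ind (Q : V -> Prop) : Q v0 -> (forall c u v, Q u -> Q v -> Q (c *: u + v)) ->
  (forall i, P i -> forall v, Q v -> Q (f i v)) -> forall v, Q v.
Proof.
move=> Q0 QL Qf; have Qz : Q 0 by rewrite -[0](addNr v0) -scaleN1r; exact: QL.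
have [W hW] := pred_vspace Qz QL.
move=> v; apply/hW; apply: gen; first exact/hW.
by move=> i Pi u /hW Qu; apply/hW/Qf.
Qed.

Lemma coord_ext t t' : (forall b, y b t = y b t') -> t = t'.
Proof.
move=> h; apply/eqP; rewrite -subr_eq0 -scaleN1r addrC; apply/eqP/y_inj => b.
by rewrite ly h -[_ *: _]/(-1 * _) mulN1r addNr.
Qed.

Lemma intertwine_unique (h : 'Hom(V, T)) : h v0 = t0 ->
  (forall i, P i -> forall v, h (f i v) = g i (h v)) -> forall b v, y b (h v) = x b v.
Proof.
move=> h0 hf b v; move: v b; apply: gen_ind => [b|c u v hu hv b|i Pi v hv b].
- by rewrite h0 x0.
- by rewrite linearP ly hu hv lx.
- by rewrite hf // yg // xf //; congr A; apply/funext => b'.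
Qed.

(** Both families of operators are the same formula [A] in coordinates, so the vectors whose
    coordinates are realized in [T] form a stable subspace containing the generator. Since
    coordinates separate points of [T], the resulting map is unique and linear. *)
Lemma intertwine_exists : exists h : 'Hom(V, T), forall b v, y b (h v) = x b v.
Proof.
have ex v : exists t, forall b, y b t = x b v.
  move: v; apply: gen_ind => [|c u v [t ht] [t' ht']|i Pi v [t ht]].
  - by exists t0 => b; rewrite x0.
  - by exists (c *: t + t') => b; rewrite ly lx ht ht'.
  - by exists (g i t) => b; rewrite yg // xf //; congr A; apply/funext => b'.
have [h hP] := boolp.choice ex.
have h_lin : linear h.
  by move=> c u v; apply: coord_ext => b; rewrite hP ly lx !hP.
pose hL : {linear V -> T} := HB.pack h (GRing.isLinear.Build _ _ _ _ h h_lin).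
by exists (linfun hL) => b v; rewrite lfunE /= hP.
Qed.

Lemma intertwine_props (h : 'Hom(V, T)) (ops : set 'End(T)) :
  (forall F, ops F <-> exists2 i, P i & F = g i) ->
  (forall b v, y b (h v) = x b v) ->
  [/\ lker h = 0%VS, limg h = gensub ops t0, h v0 = t0
    & forall i, P i -> forall v, h (f i v) = g i (h v)].
Proof.
move=> opsP hP.
have h0 : h v0 = t0 by apply: coord_ext => b; rewrite hP x0.
have hf i : P i -> forall v, h (f i v) = g i (h v).
  move=> Pi v; apply: coord_ext => b; rewrite hP xf // yg //.
  by congr A; apply/funext => b'; rewrite hP.
split=> //.
  apply/eqP; rewrite -subv0; apply/subvP => v; rewrite memv_ker => /eqP hv.
  rewrite memv0; apply/eqP/x_inj => b; rewrite -hP hv.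
  by rewrite -[X in y b X](addNr (0 : T)) -scaleN1r ly -[_ *: _]/(-1 * _) mulN1r addNr.
have [tG sG minG] := gensubP ops t0.
apply/eqP; rewrite eqEsubv; apply/andP; split.
  apply/subvP => _ /memv_imgP[v _ ->]; move: v; apply: gen_ind => [|c u v hu hv|i Pi v hv].
  - by rewrite h0.
  - by rewrite linearP memvD // memvZ.
  - rewrite hf //; apply: (subvP (sG (g i) _)); last exact: memv_img.
    by apply/opsP; exists i.
apply: minG; first by rewrite -h0 memv_img ?memvf.
move=> F /opsP[i Pi ->]; apply/subvP => _ /memv_imgP[_ /memv_imgP[v _ ->] ->].
by rewrite -hf // memv_img ?memvf.
Qed.

End Transport.

Section Comultiplication.
Variables (K : numFieldType) (n : nat) (a : nat -> nat -> int).
Hypothesis ha : submod n a.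
Local Notation S := (sigma a).
Local Notation gr l := (gr K S l).
Variables (l m r : dweight n).
Hypothesis hr : forall k, r k = (l k + m k)%N.

Definition tens_coord (b : tbasis l * tbasis m) (M : tens (gr l) (gr m)) : K :=
  pairing (xi b.1) (xi b.2) M.

Definition join_coord (b : tbasis l * tbasis m) (y : gr r) : K :=
  xi (join r b.1 b.2) y.

(** The Leibniz rule in coordinates. The cone condition concerns the total weight, so [low] is
    required of the factor that stays unchanged as well. *)
Definition tens_coef (ij : 'I_n * 'I_n) (b : tbasis l * tbasis m)
    (x : tbasis l * tbasis m -> K) : K :=
  graded_coef a ij.1 ij.2 b.1 (fun b1 => if low ij.1 b.2 then x (b1, b.2) else 0) +
  graded_coef a ij.1 ij.2 b.2 (fun b2 => if low ij.1 b.1 then x (b.1, b2) else 0).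

Lemma join_coord_phi (ij : 'I_n * 'I_n) : (ij.1 < ij.2)%N -> forall b (v : gr r),
  join_coord b (phiS K a r ij.1 ij.2 v) = tens_coef ij b (join_coord^~ v).
Proof.
case: ij => i j /= lij [b1 b2] v.
rewrite /join_coord xi_phiS // /tens_coef /graded_coef /= (sum_pos hr).
congr (_ + _); apply: eq_bigr => p _; apply: eq_bigr => I _.
  rewrite (joinl hr) (join_updl hr) (low_join hr) !(deg_join hr).
  congr (_ * _); rewrite addrAC (inj_eq (addIr _)).
  by case: (low i (upd b1 I)); case: (low i b2); case: (_ == _).
rewrite (joinr hr) (join_updr hr) (low_join hr) !(deg_join hr).
congr (_ * _); rewrite -addrA (inj_eq (addrI _)).
by case: (low i (upd b2 I)); case: (low i b1); case: (_ == _).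
Qed.

Lemma in_cone_join (i : 'I_n) (b1 : tbasis l) (b2 : tbasis m) :
  `[< in_cone i (wt_basis K b1 + wt_basis K b2 - (wt_of K l + wt_of K m)) >] =
  low i b1 && low i b2.
Proof.
by rewrite -(wt_join hr K b1 b2) -(wt_of_add hr K) in_cone_low // (low_join hr).
Qed.

Definition cone_part (i : 'I_n) (M : tens (gr l) (gr m)) : tens (gr l) (gr m) :=
  \sum_(nu1 <- wts K l)
      \sum_(nu2 <- wts K m |
            `[< in_cone i (nu1 + nu2 - (wt_of K l + wt_of K m)) >])
        tens_map (wt_projS S l nu1) (wt_projS S m nu2) M.

Lemma cone_part_coord i b M : tens_coord b (cone_part i M) =
  if low i b.1 && low i b.2 then tens_coord b M else 0.
Proof.
case: b => b1 b2; rewrite /tens_coord /= /cone_part pairing_sum.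
have E nu1 nu2 : pairing (xi b1) (xi b2) (tens_map (wt_projS S l nu1) (wt_projS S m nu2) M) =
    if (wt_basis K b1 == nu1) && (wt_basis K b2 == nu2) then pairing (xi b1) (xi b2) M else 0.
  rewrite pairing_tens_map; try exact: xi_is_linear.
  rewrite !pairingE /=.
  under eq_bigr do under eq_bigr do rewrite !xi_wt_projS //.
  case: eqP => _ /=; last first.
    by rewrite big1 // => e _; rewrite big1 // => e' _; rewrite mul0r mulr0.
  case: eqP => _ //; by rewrite big1 // => e _; rewrite big1 // => e' _; rewrite !mulr0.
under eq_bigr do rewrite pairing_sum.
under eq_bigr do under eq_bigr do rewrite E.
rewrite (bigD1_seq _ (mem_wts K b1) (undup_uniq _)) /= [X in _ + X]big1 ?addr0; last first.
  by move=> nu1 /negbTE; rewrite eq_sym => ->; rewrite big1.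
rewrite eqxx /= big_mkcond (bigD1_seq _ (mem_wts K b2) (undup_uniq _)) /= eqxx.
rewrite in_cone_join big1 ?addr0 // => nu2 /negbTE; rewrite eq_sym => ->.
by rewrite if_same.
Qed.

Lemma phi_tensE (i j : 'I_n) M : phi_tens K a l m i j M =
  tens_map (phiS K a l i j) \1%VF (cone_part i M) +
  tens_map \1%VF (phiS K a m i j) (cone_part i M).
Proof.
pose F (M : tens (gr l) (gr m)) : tens (gr l) (gr m) :=
  tens_map (phiS K a l i j) \1%VF (cone_part i M) +
  tens_map \1%VF (phiS K a m i j) (cone_part i M).
have cp_lin c (M1 M2 : tens (gr l) (gr m)) :
    cone_part i (c *: M1 + M2) = c *: cone_part i M1 + cone_part i M2.
  rewrite /cone_part scaler_sumr -big_split; apply: eq_bigr => nu1 _ /=.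
  rewrite scaler_sumr -big_split; apply: eq_bigr => nu2 _ /=.
  exact: tens_map_is_linear.
have F_lin : linear F.
  move=> c M1 M2; rewrite /F cp_lin !tens_map_is_linear scalerDr.
  by rewrite addrACA.
pose FL : {linear tens (gr l) (gr m) -> tens (gr l) (gr m)} :=
  HB.pack F (GRing.isLinear.Build _ _ _ _ F F_lin).
by rewrite -[LHS]/(linfun FL M) lfunE.
Qed.

(** Writes [graded_coef] as a linear combination with explicit coefficients, which can be pulled out
    of a pairing. *)
Lemma graded_coefE i j (l' : dweight n) (b' : tbasis l') (x : tbasis l' -> K) :
  graded_coef a i j b' x = \sum_b graded_coef a i j b' (fun b'' => (b'' == b)%:R) * x b.
Proof.
rewrite /graded_coef.
under [RHS]eq_bigr do rewrite mulr_suml.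
rewrite exchange_big; apply: eq_bigr => p _ /=.
under [RHS]eq_bigr do rewrite mulr_suml.
rewrite exchange_big; apply: eq_bigr => I _ /=.
under [RHS]eq_bigr do rewrite -mulrA.
rewrite -mulr_sumr; congr (_ * _).
case: ifP => _; last by rewrite big1 // => b _; rewrite mul0r.
rewrite (bigD1 (upd b' I)) //= eqxx mul1r big1 ?addr0 // => b.
by rewrite eq_sym => /negbTE ->; rewrite mul0r.
Qed.

Lemma tens_coord_phi (ij : 'I_n * 'I_n) : (ij.1 < ij.2)%N -> forall b (M : tens (gr l) (gr m)),
  tens_coord b (phi_tens K a l m ij.1 ij.2 M) = tens_coef ij b (tens_coord^~ M).
Proof.
case: ij => i j /= lij [b1 b2] M.
rewrite phi_tensE /tens_coord /= pairingD !pairing_tens_map; try exact: xi_is_linear.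
rewrite /tens_coef /=; congr (_ + _).
  transitivity (pairing (fun v => \sum_b graded_coef a i j b1 (fun b'' => (b'' == b)%:R) * xi b v)
     (xi b2) (cone_part i M)).
    rewrite !pairingE; apply: eq_bigr => e _; apply: eq_bigr => e' _ /=.
    by rewrite xi_phiS // graded_coefE id_lfunE.
  rewrite pairing_suml -graded_coefE /graded_coef.
  apply: eq_bigr => p _; apply: eq_bigr => I _; congr (_ * _).
  rewrite -[pairing _ _ _]/(tens_coord (upd b1 I, b2) _) cone_part_coord /=.
  by case: (low i (upd b1 I)); case: (low i b2).
transitivity (pairing (xi b1)
   (fun v => \sum_b graded_coef a i j b2 (fun b'' => (b'' == b)%:R) * xi b v) (cone_part i M)).
  rewrite !pairingE; apply: eq_bigr => e _; apply: eq_bigr => e' _ /=.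
  by rewrite xi_phiS // [X in _ * (_ * X) = _]graded_coefE id_lfunE.
rewrite pairing_sumr -graded_coefE /graded_coef.
apply: eq_bigr => p _; apply: eq_bigr => I _; congr (_ * _).
rewrite -[pairing _ _ _]/(tens_coord (b1, upd b2 I) _) cone_part_coord /=.
by case: (low i (upd b2 I)); case: (low i b1).
Qed.

(** [comul] is chosen by [xget], hence known only through [is_comul]. A map with the right
    coordinates exists and has these properties, and the properties force the coordinates of the
    chosen map. *)
Lemma comul_coord b (y : gr r) : tens_coord b (comul K a l m r y) = join_coord b y.
Proof.
have lx b' : linear (join_coord b' : gr r -> K^o) by exact: xi_is_linear.
have ly b' : linear (tens_coord b' : tens (gr l) (gr m) -> K^o) by exact: pairing_is_linear.
have x_inj v : (forall b', join_coord b' v = 0) -> v = 0.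
  by move=> h; apply: xi_inj => c; have [b1 [b2 ->]] := join_surj hr c; exact: (h (b1, b2)).
have y_inj t : (forall b', tens_coord b' t = 0) -> t = 0.
  move=> h; apply: (pairing_inj (x := fun b1 : tbasis l => xi b1)
    (y := fun b2 : tbasis m => xi b2)) => [b1|b2|v|w|b1 b2].
  - exact: xi_is_linear.
  - exact: xi_is_linear.
  - exact: xi_inj.
  - exact: xi_inj.
  - exact: (h (b1, b2)).
have x0 b' : join_coord b' (vhwS K S r) = tens_coord b' (tensv (vhwS K S l) (vhwS K S m)).
  case: b' => b1 b2; rewrite /join_coord /tens_coord /= pairing_tensv; try exact: xi_is_linear.
  by rewrite !xi_vhwS (join_hw hr) -natrM mulnb.
pose P (ij : 'I_n * 'I_n) := (ij.1 < ij.2)%N : Prop.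
pose f (ij : 'I_n * 'I_n) := phiS K a r ij.1 ij.2.
pose g (ij : 'I_n * 'I_n) := phi_tens K a l m ij.1 ij.2.
have gen (W : {vspace gr r}) : vhwS K S r \in W ->
    (forall i, P i -> forall v, v \in W -> f i v \in W) -> forall v, v \in W.
  by move=> vW sW; apply: gr_generated => // i j ij v; exact: (sW (i, j)).
have ex : is_comul (comul K a l m r).
  have [h hP] := intertwine_exists lx ly y_inj
    (P := P) (f := f) (g := g) (A := tens_coef) (@join_coord_phi) (@tens_coord_phi) x0 gen.
  have : is_comul h.
    have [|h1 h2 h3 h4] := intertwine_props ly x_inj y_inj
      (P := P) (f := f) (g := g) (A := tens_coef) (@join_coord_phi) (@tens_coord_phi) x0 gen
      (ops := [set F | exists i j : 'I_n, (i < j)%N /\ F = phi_tens K a l m i j]%classic) _ hP.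
      move=> F; split=> [[i [j [ij ->]]]|[[i j] ij ->]]; first by exists (i, j).
      by exists i, j.
    by split=> // i j ij v; exact: (h4 (i, j)).
  exact: xgetI.
case: ex => _ _ e0 ef.
apply: (intertwine_unique lx ly (P := P) (f := f) (g := g) (A := tens_coef)
  (@join_coord_phi) (@tens_coord_phi) x0 gen) => // -[i j] ij v; exact: ef.
Qed.

Definition xi_dual (l' : dweight n) (b : tbasis l') : dual K S l' := linfun (xi_lin K S b).

Lemma dual_mul_xi (b1 : tbasis l) (b2 : tbasis m) :
  dual_mul r (xi_dual b1) (xi_dual b2) = xi_dual (join r b1 b2).
Proof.
apply/lfunP => y.
pose F (y : gr r) : K^o := tens_lift (fun v w => xi_dual b1 v * xi_dual b2 w : K^o)
  (comul K a l m r y).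
have FE y' : F y' = tens_coord (b1, b2) (comul K a l m r y').
  rewrite /F /tens_coord /pairing; congr tens_lift.
  by apply/funext => v; apply/funext => w; rewrite !lfunE.
have F_lin : linear F.
  by move=> c u v; rewrite !FE linearP; exact: pairing_is_linear.
pose FL : {linear gr r -> K^o} := HB.pack F (GRing.isLinear.Build _ _ _ _ F F_lin).
by rewrite -[LHS]/(linfun FL y) lfunE /= FE comul_coord lfunE.
Qed.

End Comultiplication.

(** * Monomials of Pluecker coordinates *)

Section LinearExtension.
Variables (R : nzRingType) (N : nat) (V : lmodType R) (f : 'X_{1..N} -> V).

Definition mlin (p : {mpoly R[N]}) : V := \sum_(m <- msupp p) p@_m *: f m.

Lemma mlin_wide (r : seq 'X_{1..N}) p : uniq r -> {subset msupp p <= r} ->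
  mlin p = \sum_(m <- r) p@_m *: f m.
Proof.
move=> ur sr; rewrite (bigID (mem (msupp p))) /= [X in _ + X]big1 ?addr0 => [|m hm]; last first.
  by rewrite memN_msupp_eq0 // scale0r.
rewrite -big_filter; apply: perm_big; apply: uniq_perm => [||m].
- exact: msupp_uniq.
- exact: filter_uniq.
by rewrite mem_filter /=; case: (boolP (m \in msupp p)) => // /sr ->.
Qed.

Lemma mlin_is_linear : linear mlin.
Proof.
move=> c p q; pose r := undup (msupp (c *: p + q) ++ msupp p ++ msupp q).
rewrite !(@mlin_wide r) ?undup_uniq //; try by move=> m hm; rewrite mem_undup !mem_cat hm ?orbT.
rewrite scaler_sumr -big_split; apply: eq_bigr => m _ /=.
by rewrite mcoeffD mcoeffZ scalerDl scalerA.
Qed.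

Definition mlin_lin : {linear {mpoly R[N]} -> V} :=
  HB.pack mlin (GRing.isLinear.Build _ _ _ _ mlin mlin_is_linear).

End LinearExtension.

Lemma mlinX (R : nzRingType) (N : nat) (V : lmodType R) (f : 'X_{1..N} -> V) m :
  mlin f 'X_[m] = f m.
Proof. by rewrite /mlin msuppX big_seq1 mcoeffX eqxx scale1r. Qed.

Section Monomials.
Variable n : nat.
Implicit Types (l : dweight n).
Local Notation multi := 'X_{1..#|pidx n|}.

Definition colidx (k : 'I_n.-1) (I : ksub n k.+1) : pidx n :=
  Tagged (fun k : 'I_n.-1 => ksub n k.+1) I.

Definition mon l (b : tbasis l) : multi :=
  [multinom (\sum_p (colidx (b p) == enum_val i))%N | i < #|pidx n|].

Definition mtype (m : multi) : dweight n :=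
  [ffun k => (\sum_(x : pidx n | tag x == k) m (enum_rank x))%N].

Lemma monE l (b : tbasis l) x : mon b (enum_rank x) = (\sum_p (colidx (b p) == x))%N.
Proof. by rewrite mnmE enum_rankK. Qed.

Lemma prod_mon (R : comNzRingType) (F : pidx n -> R) l (b : tbasis l) :
  \prod_p F (colidx (b p)) = \prod_i F (enum_val i) ^+ mon b i.
Proof.
under [RHS]eq_bigr do rewrite mnmE -prodrXr.
rewrite exchange_big; apply: eq_bigr => p _ /=.
rewrite (bigD1 (enum_rank (colidx (b p)))) //= enum_rankK eqxx expr1 big1 ?mulr1 // => i ne.
case: eqP => [e|]; last by rewrite expr0.
by rewrite e enum_valK eqxx in ne.
Qed.

Lemma deg_mon s l (b : tbasis l) : deg s b = mgrade s (mon b).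
Proof.
rewrite /mgrade; under eq_bigr do rewrite mnmE (big_morph Posz PoszD (erefl _)) mulr_sumr.
rewrite exchange_big; apply: eq_bigr => p _ /=.
rewrite (bigD1 (enum_rank (colidx (b p)))) //= enum_rankK eqxx mulr1 big1 ?addr0 // => i ne.
case: eqP => [e|]; last by rewrite mulr0.
by rewrite e enum_valK eqxx in ne.
Qed.

Lemma mtype_mon l (b : tbasis l) : mtype (mon b) = l.
Proof.
apply/ffunP => k; rewrite ffunE.
under eq_bigr do rewrite monE.
rewrite exchange_big /=.
transitivity (\sum_(p : tpos l) (tag p == k))%N.
  apply: eq_bigr => p _; case: eqP => [e|ne].
    rewrite (bigD1 (colidx (b p))) /=; last by rewrite e.
    rewrite eqxx big1 // => x /andP[_ /negbTE]; by rewrite eq_sym => ->.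
  rewrite big1 // => x /eqP xk; case: eqP => // e; case: ne; by rewrite -xk -e.
rewrite (@big_tpos n nat l (fun k' => (k' == k) : nat)) (bigD1 k) //= eqxx.
rewrite big1 ?addr0 => [|k' /negbTE ->]; last by rewrite mul0rn.
by elim: (l k) => // x IH; rewrite mulrS IH.
Qed.

Lemma mtypeD m m' k : mtype (m + m')%MM k = (mtype m k + mtype m' k)%N.
Proof. by rewrite !ffunE -big_split; apply: eq_bigr => x _; rewrite mnmDE. Qed.

Lemma mon_join l l' (r : dweight n) (hr : forall k, r k = (l k + l' k)%N)
    (b : tbasis l) (b' : tbasis l') : mon (join r b b') = (mon b + mon b')%MM.
Proof.
apply/mnmP => i; rewrite mnmDE !mnmE (sum_pos hr); congr (_ + _)%N;
  apply: eq_bigr => p _.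
  by rewrite (joinl hr).
by rewrite (joinr hr).
Qed.

Section Single.
Variables (k : 'I_n.-1).

Lemma tag_omega (p : tpos (omega k)) : tag p = k.
Proof. by case: p => k' [i h] /=; move: h; rewrite ffunE; case: eqP. Qed.

Lemma omega_lt : (0 < omega k k)%N. Proof. by rewrite ffunE eqxx. Qed.

Definition pos0 : tpos (omega k) := Tagged (fun j => 'I_(omega k j)) (Ordinal omega_lt).

Lemma pos0P p : p = pos0.
Proof.
have := tag_omega p; case: p => k' i /= e; subst k'; congr existT; apply/val_inj => /=.
by have := ltn_ord i; rewrite [X in (_ < X)%N]ffunE eqxx ltnS leqn0 => /eqP.
Qed.

(** At a position [p] the equality [tag p = k] is only propositional; [insub] moves the underlying
    set to the required type, and its default value is never taken. *)
Definition bsingle (I : ksub n k.+1) : tbasis (omega k) :=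
  [ffun p => odflt (ksub_std (tag p)) (insub (val I))].

Lemma val_bsingle I p : val (bsingle I p) = val I.
Proof.
have h : #|val I| == (tag p).+1 by rewrite (tag_omega p) (valP I).
by rewrite ffunE (insubT (fun A : {set 'I_n} => #|A| == (tag p).+1) h).
Qed.

Lemma bsingle0 I : bsingle I pos0 = I.
Proof. by apply/val_inj; rewrite val_bsingle. Qed.

Lemma bsingle_surj (b : tbasis (omega k)) : b = bsingle (b pos0).
Proof. by apply/ffunP => p; apply/val_inj; rewrite val_bsingle (pos0P p). Qed.

Lemma sum_pos0 (V : nmodType) (F : tpos (omega k) -> V) : \sum_p F p = F pos0.
Proof. by rewrite (bigD1 pos0) //= big1 ?addr0 // => p; rewrite (pos0P p) eqxx. Qed.

Lemma mon_single I : mon (bsingle I) = U_(enum_rank (colidx I))%MM.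
Proof.
apply/mnmP => i; rewrite mnmE mnm1E sum_pos0 bsingle0.
by rewrite (can2_eq enum_rankK enum_valK).
Qed.

Lemma std_single (b : tbasis (omega k)) : std b.
Proof. by apply/stdP => p q; rewrite (pos0P p) (pos0P q) ltnn. Qed.

End Single.

Lemma mon_exists m : exists b : tbasis (mtype m), mon b = m.
Proof.
suff H d l : mdeg m = d -> mtype m = l -> exists b : tbasis l, mon b = m by exact: H.
elim: d m l => [|d IH] m l dm <-.
  move: dm => /eqP; rewrite mdeg_eq0 => /eqP ->.
  have e0 : mtype 0%MM =1 fun=> 0%N by move=> k; rewrite ffunE big1 // => x _; rewrite mnm0E.
  exists (hw_basis _); apply/mnmP => i; rewrite mnmE mnm0E big1 // => -[k [i0 hi]] _.
  by exfalso; rewrite e0 in hi.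
have [i mi] : exists i, (0 < m i)%N.
  have : mdeg m != 0%N by rewrite dm.
  rewrite mdegE; apply: contra_neqP => H; rewrite big1 // => i _.
  by apply/eqP; rewrite -leqn0 leqNgt; apply/negP => h; apply: H; exists i.
have em : m = (U_(i) + (m - U_(i)))%MM.
  apply/mnmP => j; rewrite mnmDE mnmBE mnm1E; case: eqP => [<-|_]; last by rewrite subn0.
  by rewrite subnKC.
have dm' : mdeg (m - U_(i))%MM = d by move: dm; rewrite {1}em mdegD mdeg1 => -[].
have [b' eb'] := IH (m - U_(i))%MM _ dm' (erefl _).
have Ei : U_(i)%MM = mon (bsingle (tagged (enum_val i))).
  by rewrite mon_single /colidx; case: (enum_val i) (enum_valK i) => k I /= ->.
have hr k : mtype m k = (omega (tag (enum_val i)) k + mtype (m - U_(i))%MM k)%N.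
  by rewrite {1}em mtypeD Ei mtype_mon.
by exists (join _ (bsingle (tagged (enum_val i))) b'); rewrite (mon_join hr) eb' -Ei -em.
Qed.

(** An arbitrary order of the columns of [m]; by [cf_sym] and [xi_sym] coordinates do not depend on
    it. The default value is for [m] of another type. *)
Definition arr l (m : multi) : tbasis l :=
  odflt (hw_basis l) [pick b : tbasis l | mon b == m].

Lemma mon_arr l m : mtype m = l -> mon (arr l m) = m.
Proof.
move=> <-; rewrite /arr; case: pickP => [b /eqP //|H].
by have [b /eqP e] := mon_exists m; rewrite H in e.
Qed.

End Monomials.

(** * Independence of the order of the factors *)

Section Symmetry.
Variables (K : numFieldType) (n : nat).
Implicit Types (l : dweight n).

Lemma uvec_mon l h (b : tbasis l) : cf (uvec l h) b =
  \prod_i (minor h (tagged (enum_val i)) : K) ^+ mon b i.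
Proof. by rewrite cf_uvec -(prod_mon (fun x : pidx n => minor h (tagged x))). Qed.

(** The coordinates of [uvec l h] are products over the columns and ignore their order. This is a
    linear relation, so it holds on all of [Lrep]. *)
Lemma cf_sym l (u : Urep K l) b b' : u \in Lrep K l -> mon b = mon b' -> cf u b = cf u b'.
Proof.
move=> /hullP hu e; apply/eqP; rewrite -subr_eq0; apply/eqP.
have sumE (v : Urep K l) : \sum_c ((c == b)%:R - (c == b')%:R) * cf v c = cf v b - cf v b'.
  under eq_bigr do rewrite mulrBl.
  rewrite sumrB (bigD1 b) //= eqxx mul1r big1 => [|c /negbTE ->]; last by rewrite mul0r.
  rewrite (bigD1 b') //= eqxx mul1r [X in _ - (_ + X)]big1 => [|c /negbTE ->]; last by rewrite mul0r.
  by rewrite !addr0.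
by rewrite -sumE; apply: hu => h _; rewrite sumE !uvec_mon e subrr.
Qed.

Variable s : pidx n -> int.

Lemma xi_sym l (b b' : tbasis l) (y : gr K s l) : mon b = mon b' -> xi b y = xi b' y.
Proof.
move=> e; move: y; apply: gr_ind => [|x y hx hy|m x hx].
- by rewrite !xi0.
- by rewrite !xiD hx hy.
rewrite !xi_symb // !deg_mon e; case: ifP => // _; apply: cf_sym => //.
by move: hx; rewrite memv_cap => /andP[].
Qed.

Lemma dual_span l (f : dual K s l) :
  exists c : tbasis l -> K, f = \sum_b c b *: linfun (xi_lin K s b).
Proof.
pose X (y : gr K s l) : Urep K l := [ffun b => xi b y].
have XE y b : cf (X y) b = xi b y by exact: ffunE.
have X_lin : linear X.
  by move=> c x y; apply: cfP => b; rewrite cfD cfZ !XE xiD xiZ.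
pose XL : {linear gr K s l -> Urep K l} := HB.pack X (GRing.isLinear.Build _ _ _ _ X X_lin).
have kX : lker (linfun XL) == 0%VS.
  rewrite -subv0; apply/subvP => y; rewrite memv_ker lfunE /= => /eqP Xy.
  by rewrite memv0; apply/eqP/xi_inj => b; rewrite -XE Xy cf0.
exists (fun b => f ((linfun XL)^-1%VF (ebasis K b))); apply/lfunP => y.
rewrite -[in LHS](lker0_lfunK kX y) lfunE /= [X y]urepE !linear_sum sum_lfunE.
apply: eq_bigr => b _; rewrite !linearZ XE scale_lfunE.
rewrite (lfunE (xi_lin K s b)) /=.
exact: mulrC.
Qed.

End Symmetry.

(** * The surjection onto the algebra *)

Section Algebra.
Variables (K : numFieldType) (n : nat) (a : nat -> nat -> int).
Hypothesis ha : submod n a.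
Local Notation S := (@sigma n a).
Local Notation gr l := (gr K S l).
Local Notation multi := 'X_{1..#|pidx n|}.
Implicit Types (l : dweight n).

Lemma qin_in l (f : dual K S l) : qin (a := a) f l = f.
Proof. exact: dfwith_in. Qed.

Lemma qin_out l l' (f : dual K S l) : l' != l -> qin (a := a) f l' = 0.
Proof. by move=> ne; rewrite /qin /dsum_in /= dfwith_out // eq_sym. Qed.

Lemma QS_D (x y : QS K n a) l : (x + y) l = x l + y l.
Proof. by []. Qed.

Lemma QS_Z c (x : QS K n a) l : (c *: x) l = c *: x l.
Proof. by []. Qed.

Lemma QS_0 l : (0 : QS K n a) l = 0.
Proof. by []. Qed.

Lemma QS_sum I (r : seq I) (P : pred I) (F : I -> QS K n a) l :
  (\sum_(i <- r | P i) F i) l = \sum_(i <- r | P i) F i l.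
Proof. by apply: (big_morph (fun x : QS K n a => x l)). Qed.

Definition qxi l (b : tbasis l) : QS K n a := qin (xi_dual K a b).

Definition qm (m : multi) : QS K n a := qxi (arr (mtype m) m).

Lemma qxi_mon l l' (b : tbasis l) (b' : tbasis l') : mon b = mon b' -> qxi b = qxi b'.
Proof.
move=> e; have el : l = l' by rewrite -(mtype_mon b) e mtype_mon.
subst l'; congr qin; apply/lfunP => y.
by rewrite /xi_dual !(lfunE (xi_lin K S _)) /=; apply: xi_sym.
Qed.

Lemma qm_mon l (b : tbasis l) : qm (mon b) = qxi b.
Proof. by apply: qxi_mon; rewrite mon_arr. Qed.

Lemma dual_mulE l m r (f : dual K S l) (g : dual K S m) x :
  dual_mul r f g x = pairing (f : gr l -> K) (g : gr m -> K) (comul K a l m r x).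
Proof.
pose F (x : gr r) : K^o := pairing (f : gr l -> K) (g : gr m -> K) (comul K a l m r x).
have F_lin : linear F by move=> c u v; rewrite /F linearP; exact: pairing_is_linear.
pose FL : {linear gr r -> K^o} := HB.pack F (GRing.isLinear.Build _ _ _ _ F F_lin).
by rewrite -[LHS]/(linfun FL x) lfunE.
Qed.

Lemma dual_mul_linl l m r c (f f' : dual K S l) (g : dual K S m) :
  dual_mul r (c *: f + f') g = c *: dual_mul r f g + dual_mul r f' g.
Proof.
apply/lfunP => x; rewrite add_lfunE scale_lfunE !dual_mulE !pairingE.
rewrite scaler_sumr -big_split; apply: eq_bigr => i _ /=.
rewrite scaler_sumr -big_split; apply: eq_bigr => j _ /=.
rewrite add_lfunE scale_lfunE -[_ *: _ in RHS]/(c * _) -[_ *: _ in LHS]/(c * _).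
by rewrite mulrDl mulrDr -!mulrA mulrCA.
Qed.

Lemma dual_mul_linr l m r c (f : dual K S l) (g g' : dual K S m) :
  dual_mul r f (c *: g + g') = c *: dual_mul r f g + dual_mul r f g'.
Proof.
apply/lfunP => x; rewrite add_lfunE scale_lfunE !dual_mulE !pairingE.
rewrite scaler_sumr -big_split; apply: eq_bigr => i _ /=.
rewrite scaler_sumr -big_split; apply: eq_bigr => j _ /=.
rewrite add_lfunE scale_lfunE -[_ *: _ in RHS]/(c * _) -[_ *: _ in LHS]/(c * _).
by rewrite !mulrDr !(mulrCA _ c).
Qed.

Lemma dual_mul0l l m r (g : dual K S m) : dual_mul r (0 : dual K S l) g = 0.
Proof. by have := @dual_mul_linl l m r (-1) 0 0 g; rewrite scaler0 addr0 scaleN1r addNr. Qed.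

Lemma dual_mul0r l m r (f : dual K S l) : dual_mul r f (0 : dual K S m) = 0.
Proof. by have := @dual_mul_linr l m r (-1) f 0 0; rewrite scaler0 addr0 scaleN1r addNr. Qed.

Lemma qmul_linl c (x y z : QS K n a) : qmul (c *: x + y) z = c *: qmul x z + qmul y z.
Proof.
apply: dsumP => r; rewrite [RHS]QS_D QS_Z /= /qmul_fun scaler_sumr -big_split.
by apply: eq_bigr => p _; exact: dual_mul_linl.
Qed.

Lemma qmul_linr c (x y z : QS K n a) : qmul z (c *: x + y) = c *: qmul z x + qmul z y.
Proof.
apply: dsumP => r; rewrite [RHS]QS_D QS_Z /= /qmul_fun scaler_sumr -big_split.
by apply: eq_bigr => p _; exact: dual_mul_linr.
Qed.

(** Among the splittings of the total type just one matches both factors; it contributes the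
    juxtaposition, and all others give 0. *)
Lemma qmul_qxi l m (b : tbasis l) (b' : tbasis m) :
  qmul (qxi b) (qxi b') = qm (mon b + mon b')%MM.
Proof.
pose r : dweight n := [ffun k => (l k + m k)%N].
have hr k : r k = (l k + m k)%N by rewrite ffunE.
have <- : mon (join r b b') = (mon b + mon b')%MM by exact: mon_join.
rewrite qm_mon; apply: dsumP => r'.
have castE (l1 l2 : dweight n) : l = l1 -> m = l2 ->
    dual_mul r' (qxi b l1) (qxi b' l2) = dual_mul r' (xi_dual K a b) (xi_dual K a b').
  by move=> <- <-; rewrite /qxi !qin_in.
have zero (p : splitting r') : (Defs.split1 p != l) || (Defs.split2 p != m) ->
    dual_mul r' (qxi b (Defs.split1 p)) (qxi b' (Defs.split2 p)) = 0.
  by case/orP => ne; [rewrite {1}/qxi qin_out // dual_mul0l|rewrite {2}/qxi qin_out // dual_mul0r].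
rewrite /= /qmul_fun; have [e|ne] := eqVneq r' r; last first.
  rewrite [RHS]qin_out // big1 // => p _; apply: zero; rewrite -negb_and.
  apply: contra ne => /andP[/eqP e1 /eqP e2]; apply/eqP/ffunP => k.
  by rewrite hr -e1 -e2 Defs.splitK.
subst r'; rewrite [RHS]qin_in -(dual_mul_xi K ha hr).
have hp0 k : (l k < (r k).+1)%N by rewrite hr ltnS leq_addr.
pose p0 : splitting r := [ffun k => Ordinal (hp0 k)].
have p0E k : p0 k = l k :> nat by have -> : p0 k = Ordinal (hp0 k) by exact: ffunE.
have s1 : Defs.split1 p0 = l by apply/ffunP => k; rewrite ffunE p0E.
have s2 : Defs.split2 p0 = m by apply/ffunP => k; rewrite ffunE p0E hr addKn.
rewrite (bigD1 p0) //= castE // big1 ?addr0 // => p np; apply: zero; apply/orP; left.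
apply: contra np => /eqP e; apply/eqP/ffunP => k; apply/val_inj.
rewrite /= p0E; apply: etrans (congr1 (fun f : dweight n => f k) e).
by apply/esym; exact: ffunE.
Qed.

Definition rho : {linear pring K n -> QS K n a} := mlin_lin qm.

Lemma rhoX m : rho 'X_[m] = qm m.
Proof. exact: mlinX. Qed.

Lemma rho_Xmon l (b : tbasis l) : rho 'X_[mon b] = qxi b.
Proof. by rewrite rhoX qm_mon. Qed.

Lemma rhoM p q : rho (p * q) = qmul (rho p) (rho q).
Proof.
have q0l (y : QS K n a) : qmul 0 y = 0.
  by have := qmul_linl (-1) 0 0 y; rewrite scaler0 addr0 scaleN1r addNr.
have q0r (y : QS K n a) : qmul y 0 = 0.
  by have := qmul_linr (-1) 0 0 y; rewrite scaler0 addr0 scaleN1r addNr.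
have lin_ind (P : pring K n -> Prop) : P 0 -> (forall m, P 'X_[m]) ->
    (forall c x y, P x -> P y -> P (c *: x + y)) -> forall x, P x.
  move=> P0 PX PL x; rewrite [x]mpolyE; elim/big_rec: _ => // m y _; exact: PL.
move: p; apply: (@lin_ind _) => [|m|c x y hx hy]; first by rewrite mul0r linear0 q0l.
  move: q; apply: (@lin_ind _) => [|m'|c x y hx hy]; first by rewrite mulr0 linear0 q0r.
    rewrite -mpolyXD !rhoX -(mon_arr (erefl (mtype m))) -(mon_arr (erefl (mtype m'))).
    by rewrite -qmul_qxi !qm_mon.
  by rewrite mulrDr -scalerAr !linearP hx hy qmul_linr.
by rewrite mulrDl -scalerAl !linearP hx hy qmul_linl.
Qed.

Lemma coord1 (V : vectType K) (v y : V) (c : K) : v != 0 -> y = c *: v ->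
  coord [tuple v] ord0 y = c.
Proof.
move=> v0 ->; rewrite linearZ /= -[v in coord _ _ v]/([tuple v]`_(ord0 : 'I_1)).
by rewrite coord_free ?eqxx ?mulr1 // seq1_free.
Qed.

Lemma rho1 : rho 1 = qone K n a.
Proof.
have e0 : mon (hw_basis (dw0 n)) = 0%MM.
  apply/mnmP => i; rewrite mnmE mnm0E big1 // => -[k [i0 hi]] _.
  by exfalso; rewrite ffunE in hi.
rewrite -mpolyX0 -e0 rho_Xmon; congr qin; apply/lfunP => y.
rewrite /xi_dual (lfunE (xi_lin K S _)) /=.
have bstd (b : tbasis (dw0 n)) : b = hw_basis (dw0 n).
  by apply/ffunP => -[k [i0 hi]]; exfalso; rewrite ffunE in hi.
rewrite lfunE /= (coord1 (c := xi (hw_basis (dw0 n)) y)) //.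
  apply/eqP => v0; have : xi (hw_basis (dw0 n)) (vhwS K S (dw0 n)) = 1.
    by rewrite xi_vhwS // eqxx.
  by rewrite v0 xi0 => /eqP; rewrite eq_sym oner_eq0.
by apply: xi_ext => b; rewrite xiZ (bstd b) xi_vhwS // eqxx mulr1.
Qed.

(** Tableaux with one column are all semistandard, so the monomials already realize every coordinate
    vector. *)
Lemma omega_full (k : 'I_n.-1) (u : Urep K (omega k)) : u \in Lrep K (omega k).
Proof.
have [c hc] := std_interp u.
have -> : u = \sum_(b' | std b') c b' *: bmono K b'.
  by apply: cfP => b; apply: hc; exact: std_single.
by apply: memv_suml => b _; apply/memvZ/mono_L/bword_ok.
Qed.

Lemma xi_evecS (k : 'I_n.-1) (I J : ksub n k.+1) : xi (bsingle J) (evecS K S I) = (J == I)%:R.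
Proof.
have cfe b : cf (evec K I) b = (b == bsingle I)%:R.
  rewrite [LHS]ffunE; congr ((nat_of_bool _)%:R); apply/forallP/eqP => [h|-> p].
    by apply/ffunP => p; apply/val_inj; rewrite val_bsingle (eqP (h p)).
  by rewrite val_bsingle.
have degE1 L : deg S (bsingle L) = S (colidx L).
  by rewrite /deg sum_pos0 bsingle0.
rewrite xi_symb; last first.
  rewrite memv_cap omega_full /=; apply/memUfil => b; rewrite cfe.
  by case: (b =P _) => [->|_]; rewrite ?degE1 ?eqxx.
rewrite degE1 cfe; have [->|ne] := eqVneq J I; first by rewrite !eqxx.
rewrite [_ == bsingle I]negbTE ?if_same //; apply: contra ne => /eqP e.
by rewrite -(bsingle0 J) e bsingle0.
Qed.

Lemma edual_xi (k : 'I_n.-1) (I : ksub n k.+1) : edual K S I = xi_dual K a (bsingle I).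
Proof.
apply/lfunP => y; rewrite /xi_dual (lfunE (xi_lin K S _)) /edual lfunE /=.
set X := [tuple _ | _ < _].
have XE (i : 'I_#|{: ksub n k.+1}|) : X`_i = evecS K S (enum_val i) by rewrite -tnth_nth tnth_mktuple.
have freeX : free X.
  apply/freeP => c e i; have := xi0 K S (bsingle (enum_val i)).
  rewrite -e xi_sum (bigD1 i) //= xiZ XE xi_evecS eqxx mulr1 big1 ?addr0 // => j ji.
  by rewrite xiZ XE xi_evecS (inj_eq enum_val_inj) eq_sym (negbTE ji) mulr0.
have yE : y = \sum_(i < #|{: ksub n k.+1}|) xi (bsingle (enum_val i)) y *: X`_i.
  apply: xi_ext => b; rewrite (bsingle_surj b); set J := b _.
  rewrite xi_sum (bigD1 (enum_rank J)) //= xiZ XE xi_evecS enum_rankK eqxx mulr1.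
  rewrite big1 ?addr0 // => j; rewrite -(inj_eq enum_val_inj) enum_rankK => /negbTE ne.
  by rewrite xiZ XE xi_evecS eq_sym ne mulr0.
by rewrite {1}yE coord_sum_free // enum_rankK.
Qed.

Lemma rho_Xv x : rho (Xv K x) = qvar K a x.
Proof.
have e : U_(enum_rank x)%MM = mon (bsingle (tagged x)).
  by rewrite mon_single; case: x.
by rewrite /Xv e rho_Xmon /qxi /qvar edual_xi.
Qed.

Lemma rho_surj y : exists p, rho p = y.
Proof.
have qsum l (c : tbasis l -> K) : qin (a := a) (\sum_b c b *: xi_dual K a b) =
    \sum_b c b *: qxi b.
  apply: dsumP => l'; rewrite QS_sum; have [->|ne] := eqVneq l' l.
    by rewrite qin_in; apply: eq_bigr => b _; rewrite QS_Z [qxi b l]qin_in.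
  by rewrite qin_out // big1 // => b _; rewrite QS_Z [qxi b l']qin_out // scaler0.
have onto l (f : dual K S l) : exists p, rho p = qin (a := a) f.
  have [c ->] := dual_span f; exists (\sum_b c b *: 'X_[mon b]).
  rewrite linear_sum qsum; apply: eq_bigr => b _.
  by rewrite linearZ -rho_Xmon.
have [s hs] := dsum_supp y.
have yE : y = \sum_(l <- undup s) qin (a := a) (y l).
  apply: dsumP => l'; rewrite QS_sum; have [ls|ls] := boolP (l' \in undup s).
    rewrite (bigD1_seq l') ?undup_uniq // qin_in big1 => [|l ne]; first exact/esym/addr0.
    by rewrite qin_out // eq_sym.
  have ls' : l' \notin s by rewrite -mem_undup.
  rewrite (hs _ ls') big_seq big1 // => l hl; rewrite qin_out //.
  by apply: contraNneq ls => ->.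
have [p hp] := boolp.choice (fun l => onto l (y l)).
exists (\sum_(l <- undup s) p l); rewrite linear_sum [RHS]yE.
by apply: eq_bigr.
Qed.

Lemma rho_generates (P : set (QS K n a)) : subalgebra P ->
  (forall (k : 'I_n.-1) (f : dual K S (omega k)), P (qin (a := a) f)) -> forall x, P x.
Proof.
move=> [P1 PL PM] Pv y; have [p <-] := rho_surj y.
have P0 : P 0 by rewrite -[0](addNr (qone K n a)) -scaleN1r; exact: PL.
rewrite [p]mpolyE linear_sum; elim/big_rec: _ => // m x _ Px.
suff PX : P (rho 'X_[m]) by rewrite linearZ; apply: PL.
rewrite mpolyXE_id.
elim/big_rec: _ => [|i q _ Pq]; first by rewrite rho1.
rewrite rhoM; apply: (PM) => //.
have Pi : P (rho 'X_i).
  have -> : 'X_i = Xv K (enum_val i) by rewrite /Xv enum_valK.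
  by rewrite rho_Xv; exact: Pv.
elim: (m i) => [|d IH]; first by rewrite expr0 rho1.
by rewrite exprS rhoM; apply: PM.
Qed.

End Algebra.

(** * The kernel and the initial ideal *)

Lemma poly_vanish_neq0 (K : numDomainType) (p : {poly K}) :
  (forall t, t != 0 -> p.[t] = 0) -> p = 0.
Proof.
move=> h; have : 'X * p = 0.
  apply: poly_vanish => t; rewrite hornerM hornerX.
  by have [->|/h ->] := eqVneq t 0; rewrite ?mul0r ?mulr0.
by move/eqP; rewrite mulf_eq0 polyX_eq0 => /eqP.
Qed.

(** The characters of a torus are linearly independent; the coordinates of the exponent are fixed
    one after another. *)
Lemma torus_separate (K : numFieldType) (J : finType) (r : seq {ffun J -> nat})
    (e : {ffun J -> nat} -> K) : uniq r ->
  (forall t : J -> K, (forall k, t k != 0) ->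
     \sum_(l <- r) (\prod_k t k ^+ l k) * e l = 0) ->
  forall l, l \in r -> e l = 0.
Proof.
move=> ur H l0 l0r.
have step (s : seq J) (t : J -> K) : (forall k, t k != 0) ->
    \sum_(l <- r | all (fun k => l k == l0 k) s) (\prod_k t k ^+ l k) * e l = 0.
  elim: s t => [|k s IH] t t0; first exact: H.
  (* The sum as a polynomial in the value of [t k]; its coefficient at [l0 k] selects the exponents
     that agree with [l0] at [k]. *)
  pose Q : {poly K} := \sum_(l <- r | all (fun k => l k == l0 k) s)
    (\prod_(j | j != k) t j ^+ l j * e l) *: 'X^(l k).
  have Q0 : Q = 0.
    apply: poly_vanish_neq0 => x x0.
    pose t' j := if j == k then x else t j.
    have t'0 j : t' j != 0 by rewrite /t'; case: ifP.
    rewrite horner_sum -[RHS](IH t' t'0); apply: eq_bigr => l _.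
    rewrite hornerZ hornerXn [in RHS](bigD1 k) //= {1}/t' eqxx.
    rewrite (eq_bigr (fun j => t' j ^+ l j)) => [|j /negbTE jk]; last by rewrite /t' jk.
    by rewrite mulrC mulrA.
  have := congr1 (fun q : {poly K} => q`_(l0 k)) Q0; rewrite coef0 coef_sum => E.
  rewrite -[RHS](mulr0 (t k ^+ l0 k)) -[X in _ = _ * X]E mulr_sumr big_mkcond [RHS]big_mkcond.
  apply: eq_bigr => l _ /=; case: (all _ s); rewrite ?andbF ?andbT //.
  rewrite coefZ coefXn eq_sym; case: eqP => [lk|_]; last by rewrite !mulr0.
  by rewrite mulr1 mulrA (bigD1 k) //= lk.
have := step (enum J) (fun=> 1) (fun=> oner_neq0 _).
rewrite big_mkcond (bigD1_seq l0) //= ifT; last by apply/allP.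
rewrite big1 ?mul1r => [|k _]; last by rewrite expr1n.
rewrite big1 ?addr0 // => l ne; case: ifP => // /allP h; case/eqP: ne.
by apply/ffunP => k; apply/eqP/h; rewrite mem_enum.
Qed.

Section KernelIdeal.
Variables (K : numFieldType) (n : nat) (a : nat -> nat -> int).
Hypothesis ha : submod n a.
Local Notation S := (@sigma n a).
Local Notation gr l := (gr K S l).
Local Notation multi := 'X_{1..#|pidx n|}.
Local Notation pring := (pring K n).
Local Notation rho := (rho K n a).
Implicit Types (l : dweight n) (p q : pring).

Definition restrict (c : pred multi) : pring -> pring :=
  mlin (fun m => if c m then 'X_[m] else 0).

Lemma mlin_restrict (V : lmodType K) (f : multi -> V) c p :
  mlin f (restrict c p) = mlin (fun m => if c m then f m else 0) p.
Proof.
rewrite /restrict {2}/mlin -[mlin f _]/(mlin_lin f _) linear_sum.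
apply: eq_bigr => m _; rewrite linearZ /=; congr (_ *: _).
by case: ifP => _; [exact: mlinX|exact: (linear0 (mlin_lin f))].
Qed.

Lemma mcoeff_restrict c p m : (restrict c p)@_m = if c m then p@_m else 0.
Proof.
rewrite /restrict /mlin raddf_sum /=.
transitivity (\sum_(m' <- msupp p | m' == m) (if c m then p@_m else 0)).
  rewrite [RHS]big_mkcond; apply: eq_bigr => m' _; rewrite mcoeffZ.
  case: eqP => [->|/eqP ne]; case: ifP => _; rewrite ?mcoeffX ?mcoeff0 ?mulr0 //.
    by rewrite eqxx mulr1.
  by rewrite (negbTE ne) mulr0.
have [mp|mp] := boolP (m \in msupp p).
  by rewrite big_mkcond (bigD1_seq m) ?msupp_uniq //= eqxx big1 ?addr0 // => m' /negbTE ->.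
by rewrite big1 ?memN_msupp_eq0 ?if_same // => m' _; rewrite if_same.
Qed.

Lemma gcomp_restrict d p : gcomp S d p = restrict (fun m => mgrade S m == d) p.
Proof.
rewrite /gcomp big_mkcond; apply: eq_bigr => m _.
by case: ifP; rewrite ?scaler0.
Qed.

(** The value at [u] of the component of type [l] of [p], a linear form on the
    symmetric tensors in [U_l]. *)
Definition type_eval l (x : tbasis l -> K) p : K :=
  mlin (V := K^o) (fun m => if mtype m == l then x (arr l m) else 0) p.

Lemma type_evalE l (x : tbasis l -> K) p : type_eval x p =
  \sum_b (\sum_(m <- msupp p) p@_m * ((mtype m == l) && (arr l m == b))%:R) * x b.
Proof.
under eq_bigr do rewrite mulr_suml.
rewrite exchange_big; apply: eq_bigr => m _ /=.
case: eqP => _ /=; last first.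
  by rewrite scaler0 big1 // => b _; rewrite mulr0 mul0r.
rewrite (bigD1 (arr l m)) //= eqxx mulr1 big1 ?addr0 // => b.
by rewrite eq_sym => /negbTE ->; rewrite mulr0 mul0r.
Qed.

Lemma type_eval_lin l (x : tbasis l -> K) : linear (type_eval x : pring -> K^o).
Proof. exact: mlin_is_linear. Qed.

Lemma type_evalD l (x : tbasis l -> K) p q :
  type_eval x (p + q) = type_eval x p + type_eval x q.
Proof. by have := type_eval_lin x 1 p q; rewrite !scale1r. Qed.

Lemma type_eval0 l (x : tbasis l -> K) : type_eval x 0 = 0.
Proof. by apply: (addIr (type_eval x 0)); rewrite -type_evalD !add0r. Qed.

Lemma type_evalZ l (x : tbasis l -> K) c p : type_eval x (c *: p) = c * type_eval x p.
Proof. by have := type_eval_lin x c p 0; rewrite !addr0 type_eval0 addr0. Qed.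

Lemma type_evalX l (x : tbasis l -> K) m :
  type_eval x 'X_[m] = if mtype m == l then x (arr l m) else 0.
Proof. by rewrite /type_eval mlinX. Qed.

Lemma type_eval_restrict l (x : tbasis l -> K) c p :
  type_eval x (restrict c p) =
  mlin (V := K^o) (fun m => if (mtype m == l) && c m then x (arr l m) else 0) p.
Proof.
rewrite /type_eval mlin_restrict; apply: eq_bigr => m _.
by case: (_ == _); case: (c m).
Qed.

Lemma rhoE p l (y : gr l) : rho p l y = type_eval (fun b => xi b y) p.
Proof.
rewrite /rho /= /mlin QS_sum sum_lfunE; apply: eq_bigr => m _.
rewrite QS_Z scale_lfunE; congr (_ *: _).
have [e|ne] := eqVneq (mtype m) l.
  have -> : qm K a m = qxi K a (arr l m) by apply: qxi_mon; rewrite !mon_arr.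
  by rewrite /qxi qin_in /xi_dual (lfunE (xi_lin K S _)).
by rewrite /qm /qxi qin_out ?zero_lfunE // eq_sym.
Qed.

Lemma rho_eq0 p : rho p = 0 <-> forall l (y : gr l), type_eval (fun b => xi b y) p = 0.
Proof.
split=> [e l y|h]; first by rewrite -rhoE e QS_0 zero_lfunE.
by apply: dsumP => l; apply/lfunP => y; rewrite rhoE h QS_0 zero_lfunE.
Qed.

(** The value 0 beyond the last column is a default: minors on row sets in ['I_n] have size at most
    n and do not read it. *)
Definition entries (g : 'M[K]_n) (i : 'I_n) (s : nat) : K :=
  if insub s is Some s' then g i s' else 0.

Lemma entriesE (g : 'M[K]_n) i (s : 'I_n) : entries g i s = g i s.
Proof. by rewrite /entries valK. Qed.

Lemma minor_entries (g : 'M[K]_n) (h : 'I_n -> nat -> K) k (I : ksub n k) : (forall i (s : 'I_n), h i s = g i s) ->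
  minor h I = minor (entries g) I.
Proof.
move=> hg; congr (\det _); apply/matrixP => i j; rewrite !mxE.
have jn : (j < n)%N by apply: leq_trans (ltn_ord j) (ksub_leq I).
by rewrite -[nat_of_ord j]/(nat_of_ord (Ordinal jn)) hg entriesE.
Qed.

Lemma minor_ext (g : 'M[K]_n) (k : 'I_n.-1) (I : ksub n k.+1) :
  minor (entries g) I = ext_grp g I (ksub_std k).
Proof.
congr (\det _); apply/matrixP => i j; rewrite !mxE.
by rewrite -(kth_std j) entriesE.
Qed.

Lemma uvec_L l h : uvec l h \in Lrep K l.
Proof. by apply/hullP => f; apply. Qed.

Definition flag_coord (g : 'M[K]_n) (x : pidx n) : K := ext_grp g (tagged x) (ksub_std (tag x)).

(** Rescaling the blocks of coordinates by [t] multiplies the component of each type by its own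
    character, which is what [torus_separate] needs. *)
Lemma peval_torus (t : 'I_n.-1 -> K) g p :
  peval (fun x => t (tag x) * flag_coord g x) p =
  \sum_(l <- undup [seq mtype m | m <- msupp p])
     (\prod_k t k ^+ l k) * type_eval (cf (uvec l (entries g))) p.
Proof.
rewrite /peval mevalE.
transitivity (\sum_(m <- msupp p) (\prod_k t k ^+ mtype m k) *
    (p@_m * cf (uvec (mtype m) (entries g)) (arr (mtype m) m))).
  apply: eq_bigr => m _; rewrite mulrCA; congr (_ * _).
  under eq_bigr do rewrite exprMn.
  rewrite big_split uvec_mon mon_arr //; congr (_ * _).
    rewrite (reindex (@enum_rank (pidx n))) /=; last first.
      by exists enum_val => x _; rewrite ?enum_rankK ?enum_valK.
    rewrite (partition_big (fun x : pidx n => tag x) predT) //=; apply: eq_bigr => k _.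
    by rewrite ffunE -prodrXr; apply: eq_bigr => x /eqP xk; rewrite enum_rankK xk.
  by apply: eq_bigr => i _; rewrite minor_ext.
under [RHS]eq_bigr do rewrite /type_eval /mlin mulr_sumr.
rewrite exchange_big big_seq [RHS]big_seq; apply: eq_bigr => m mp /=.
rewrite (bigD1_seq (mtype m)) ?undup_uniq ?mem_undup ?map_f //= eqxx.
rewrite [X in _ = _ + X]big1 ?addr0 // => l.
by rewrite eq_sym => /negbTE ->; rewrite scaler0 mulr0.
Qed.

Lemma uvec_SL l (h : 'I_n -> nat -> K) (g : 'M[K]_n) : (forall i s : 'I_n, h i s = g i s) ->
  uvec l h = uvec l (entries g).
Proof.
by move=> hg; apply: cfP => b; rewrite !cf_uvec; apply: eq_bigr => p _; apply: minor_entries.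
Qed.

(** Otherwise Cauchy-Binet, applied to the first k+1 rows of the inverse and the first k+1 columns
    of [g], would make the determinant of an identity matrix vanish. *)
Lemma flag_coord_neq0 (g : 'M[K]_n) (k : 'I_n.-1) : \det g = 1 ->
  exists I : ksub n k.+1, ext_grp g I (ksub_std k) != 0.
Proof.
move=> dg; apply: contrapT => H.
have gu : g \in unitmx by rewrite unitmxE dg unitr1.
have kn : (k.+1 <= n)%N by apply: leq_trans (ltn_ord k) (leq_pred n).
pose w (c : 'I_k.+1) : 'I_n := widen_ord kn c.
have := @cauchy_binet n K k.+1 (fun c x => invmx g (w c) x) (entries g).
rewrite big1 => [|I _]; last first.
  suff -> : minor (entries g) I = 0 by rewrite mulr0.
  by rewrite minor_ext; apply/eqP/negPn/negP => nz; apply: H; exists I.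
rewrite (_ : \matrix_(c, s) _ = 1%:M) ?det1 => [/esym/eqP|]; first by rewrite oner_eq0.
apply/matrixP => c s; rewrite !mxE.
have := congr1 (fun M : 'M[K]_n => M (w c) (w s)) (mulVmx gu).
rewrite !mxE -(inj_eq (@ord_inj _)) /= => <-; apply: eq_bigr => x _; congr (_ * _).
by rewrite -[nat_of_ord s]/(nat_of_ord (w s)) entriesE.
Qed.

(** A representative of a flag is a blockwise rescaling of minors of some [g]. Varying the scalars
    separates the types, so [p] vanishes at every [uvec] of a matrix in [SL_n], and [L_hull_SL]
    extends this to [Lrep]. *)
Lemma pluecker_idealP p : pluecker_ideal p <->
  forall l (u : Urep K l), u \in Lrep K l -> type_eval (cf u) p = 0.
Proof.
split=> [Ip l u uL|h P [g [dg hP]] z zP]; last first.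
  have /boolp.choice[t ht] (k : 'I_n.-1) : exists c : K,
      forall I : ksub n k.+1, z (colidx I) = c * flag_coord g (colidx I).
    have [_] := zP k; rewrite hP => /vlineP[c e]; exists c => I.
    by have := congr1 (fun f : ext K k => f I) e; rewrite !ffunE.
  have zE : z = fun x => t (tag x) * flag_coord g x.
    by apply/funext => -[k I]; rewrite -(ht k I).
  rewrite zE peval_torus big1 // => l _; rewrite h ?mulr0 //; exact: uvec_L.
have kill (g : 'M[K]_n) l' : \det g = 1 -> type_eval (cf (uvec l' (entries g))) p = 0.
  move=> dg; have [lr|lr] := boolP (l' \in undup [seq mtype m | m <- msupp p]); last first.
    rewrite /type_eval /mlin big_seq big1 // => m mp; case: eqP => [e|_]; last by rewrite scaler0.
    by case/negP: lr; rewrite mem_undup -e map_f.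
  move: lr; apply: (torus_separate (e := fun l => type_eval (cf (uvec l (entries g))) p)).
    exact: undup_uniq.
  move=> t t0; rewrite -peval_torus.
  pose v (k : 'I_n.-1) : ext K k := [ffun J => ext_grp g J (ksub_std k)].
  have v0 k : v k != 0.
    have [I nz] := flag_coord_neq0 k dg; apply: contra_neq nz => e.
    by have := congr1 (fun f : ext K k => f I) e; rewrite !ffunE.
  have dv k : \dim <[v k]>%VS == 1%N by rewrite dim_vline v0.
  pose P : Defs.point K n := fun k => exist (fun W : {vspace ext K k} => \dim W == 1%N) <[v k]>%VS (dv k).
  apply: (Ip P); first by exists g.
  move=> k; have -> : coords (fun x => t (tag x) * flag_coord g x) k = t k *: v k.
    by apply/ffunP => I; rewrite !ffunE.
  by rewrite scaler_eq0 negb_or t0 v0 /= memvZ // memv_line.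
rewrite type_evalE; apply: (L_hull_SL uL) => h [g [dg hg]].
by rewrite (uvec_SL l hg) -type_evalE; exact: kill.
Qed.

(** Let x have filtration degree d, the lowest degree occurring in [p]. Then [p] has no component
    below d and x no coordinate above d, so evaluating [q] at the symbol of x is evaluating [p] at
    x, which gives 0. *)
Lemma initial_in_kernel p q : pluecker_ideal p -> is_initial S p q -> rho q = 0.
Proof.
move=> /pluecker_idealP Ip [d [-> _ low_d]]; apply/rho_eq0 => l; apply: gr_ind => [|x y hx hy|m x hx].
- rewrite /type_eval /mlin big1 // => m _.
  by case: ifP; rewrite ?xi0 ?scaler0.
- rewrite type_evalE; under eq_bigr do rewrite xiD mulrDr.
  by rewrite big_split /= -!type_evalE hx hy addr0.
have [xL xm] : x \in Lrep K l /\ forall b, cf x b != 0 -> deg S b <= m.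
  by move: hx; rewrite memv_cap => /andP[-> /memUfil].
rewrite gcomp_restrict type_eval_restrict.
have [e|ne] := eqVneq d m; last first.
  rewrite /mlin big1 // => mu _; case: ifP => [/andP[/eqP tm /eqP gm]|_]; last by rewrite scaler0.
  rewrite xi_symb // deg_mon mon_arr // gm (negbTE ne); exact: scaler0.
rewrite -[RHS](Ip l x xL); apply: eq_bigr => mu _.
case: eqP => //= tm; rewrite xi_symb // deg_mon mon_arr // -e.
case: eqP => //= gm.
have [lt|ge] := ltP (mgrade S mu) d.
  have := congr1 (mcoeff mu) (low_d _ lt).
  by rewrite gcomp_restrict mcoeff_restrict eqxx mcoeff0 => ->; rewrite !scale0r.
have [->|nz] := eqVneq (cf x (arr l mu)) 0; first by rewrite scaler0.
by have := xm _ nz; rewrite deg_mon mon_arr // -e => le; case: gm; apply/le_anti; rewrite le ge.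
Qed.

Definition tcomp (x : dweight n * int) : pring -> pring :=
  restrict (fun m => (mtype m == x.1) && (mgrade S m == x.2)).

Lemma tcomp_sum p : p = \sum_(x <- undup [seq (mtype m, mgrade S m) | m <- msupp p]) tcomp x p.
Proof.
apply/mpolyP => m; rewrite raddf_sum /=.
under eq_bigr do rewrite mcoeff_restrict.
have [mp|mp] := boolP (m \in msupp p); last first.
  by rewrite memN_msupp_eq0 // big1 // => x _; rewrite if_same.
rewrite (bigD1_seq (mtype m, mgrade S m)) ?undup_uniq ?mem_undup //=; last first.
  by apply/mapP; exists m.
rewrite !eqxx /= big1 ?addr0 // => -[l d]; rewrite xpair_eqE /= [_ == l]eq_sym [_ == d]eq_sym.
by move/negbTE->.
Qed.

Lemma gr_component l (y : gr l) d : exists y' : gr l,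
  forall b, xi b y' = if deg S b == d then xi b y else 0.
Proof.
move: y; apply: gr_ind => [|x y [x' hx] [y' hy]|m x hx].
- by exists 0 => b; rewrite xi0 if_same.
- by exists (x' + y') => b; rewrite !xiD hx hy; case: ifP; rewrite ?addr0.
have [->|ne] := eqVneq d m.
  by exists (symb S m x) => b; rewrite xi_symb //; case: ifP.
exists 0 => b; rewrite xi0 xi_symb //; case: eqP => // ->.
by rewrite (negbTE ne).
Qed.

(** The kernel splits by type since [QS] is a direct sum, and by degree since [gr l] contains the
    homogeneous parts of its elements. *)
Lemma tcomp_kernel x p : rho p = 0 -> rho (tcomp x p) = 0.
Proof.
move=> /rho_eq0 h; apply/rho_eq0 => l y; have [y' hy'] := gr_component y x.2.
rewrite type_eval_restrict; have [e|ne] := eqVneq l x.1; last first.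
  rewrite /mlin big1 // => m _; case: ifP => [/andP[/eqP e1 /andP[/eqP e2 _]]|_].
    by rewrite -e1 -e2 eqxx in ne.
  exact: scaler0.
rewrite -[RHS](h l y'); apply: eq_bigr => m _.
case: eqP => //= tm; have e1 : mtype m == x.1 by rewrite tm e.
by rewrite e1 /= hy' deg_mon mon_arr.
Qed.

(** On [Lrep] the form [phi] given by [q] vanishes on the part of filtration degree d, so there it
    depends only on the coordinates of degree above d. Subtracting a polynomial that expresses it
    through these coordinates gives an element of the Pluecker ideal with initial component [q]. *)
Lemma tcomp_initial x p : rho (tcomp x p) = 0 -> tcomp x p != 0 ->
  exists2 p', pluecker_ideal p' & is_initial S p' (tcomp x p).
Proof.
case: x => l d; set q := tcomp _ _ => /rho_eq0 q0 qn0.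
pose phi (u : Urep K l) : K := type_eval (cf u) q.
have phi_lin : linear (phi : Urep K l -> K^o).
  move=> c u v; rewrite /phi !type_evalE scaler_sumr -big_split; apply: eq_bigr => b _ /=.
  by rewrite cfD cfZ mulrDr mulrCA.
pose phiL : {linear Urep K l -> K^o} := HB.pack (phi : Urep K l -> K^o)
  (GRing.isLinear.Build _ _ _ _ (phi : Urep K l -> K^o) phi_lin).
pose top (u : Urep K l) : Urep K l := [ffun b => if d < deg S b then cf u b else 0].
have topE u b : cf (top u) b = if d < deg S b then cf u b else 0 by exact: ffunE.
have top_lin : linear top.
  by move=> c u v; apply: cfP => b; rewrite cfD cfZ !topE cfD cfZ; case: ifP => // _; rewrite mulr0 addr0.
pose topL : {linear Urep K l -> Urep K l} := HB.pack top (GRing.isLinear.Build _ _ _ _ top top_lin).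
have phi0 u : u \in Lfil K S l d -> phi u = 0.
  move=> ud; rewrite -[RHS](q0 l (symb S d u)) /phi !type_eval_restrict.
  apply: eq_bigr => m _; case: ifP => // /andP[/eqP tm /andP[_ /eqP /= gm]].
  by rewrite xi_symb // deg_mon mon_arr // gm eqxx.
(* The projection onto [Lrep] extends both maps from [Lrep] to the ambient space without changing
   them on [Lrep]. *)
pose F := (linfun topL \o projv (Lrep K l))%VF.
pose G := (linfun phiL \o projv (Lrep K l))%VF.
have FG u : F u = 0 -> G u = 0.
  rewrite /F /G !comp_lfunE; set w := projv _ u; rewrite (lfunE topL) (lfunE phiL) /= => tw.
  apply: phi0; rewrite memv_cap memv_proj; apply/memUfil => b nz; rewrite leNgt.
  apply/negP => db; have := topE w b; rewrite tw cf0 db => e; by rewrite -e eqxx in nz.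
(* [F^-1] inverts [F] only on its image; by [FG] the choice of preimage does not affect [G], so [G]
   is a form in the values of [F]. *)
pose h b := G (F^-1%VF (ebasis K b)).
have phiE u : u \in Lrep K l -> phi u = \sum_(b | d < deg S b) cf u b * h b.
  move=> uL; have Gu : G u = phi u by rewrite /G comp_lfunE projv_id // (lfunE phiL).
  have Fu : F u = top u by rewrite /F comp_lfunE projv_id // (lfunE topL).
  have : G (u - F^-1%VF (F u)) = 0.
    by apply: FG; rewrite linearB /= limg_lfunVK ?memv_img ?memvf // subrr.
  rewrite linearB /= => /eqP; rewrite subr_eq0 Gu => /eqP ->.
  rewrite Fu [top u]urepE !linear_sum [RHS]big_mkcond; apply: eq_bigr => b _.
  rewrite !linearZ topE; case: ifP => _ //=.
  exact: mul0r (G _ : K).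
(* The correction consists of monomials of degree above d, so it leaves the initial component
   alone. *)
pose p' : pring := q - \sum_(b : tbasis l | d < deg S b) h b *: 'X_[mon b].
have coefp' m : p'@_m = q@_m - \sum_(b : tbasis l | d < deg S b) h b * (mon b == m)%:R.
  rewrite mcoeffB; congr (_ - _); rewrite (raddf_sum (mcoeff m)) /=; apply: eq_bigr => b _.
  by rewrite /= mcoeffZ mcoeffX.
have qgrade m : mgrade S m != d -> q@_m = 0.
  by rewrite mcoeff_restrict /= => /negbTE ->; rewrite andbF.
have low_p' m : mgrade S m <= d -> p'@_m = q@_m.
  move=> md; rewrite coefp' big1 ?subr0 // => b db; case: eqP => [e|]; last by rewrite mulr0.
  by move: db; rewrite deg_mon e ltNge md.
exists p'.
  apply/pluecker_idealP => l' u uL.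
  rewrite type_evalD -scaleN1r type_evalZ mulN1r.
  have -> : type_eval (cf u) (\sum_(b : tbasis l | d < deg S b) h b *: 'X_[mon b]) =
      \sum_(b : tbasis l | d < deg S b) h b * (if l == l' then cf u (arr l' (mon b)) else 0).
    rewrite (big_morph (type_eval (cf u)) (type_evalD (cf u)) (type_eval0 (cf u))).
    by apply: eq_bigr => b _; rewrite type_evalZ type_evalX mtype_mon.
  have [e|ne] := eqVneq l' l; last first.
    rewrite [X in _ - X]big1 ?subr0 => [|b _]; last by rewrite mulr0.
    rewrite type_eval_restrict /mlin big1 // => m _; case: ifP => [/andP[/eqP e1 /andP[/eqP /= e2 _]]|_].
      by rewrite -e1 -e2 eqxx in ne.
    exact: scaler0.
  subst l'; rewrite -/(phi u) phiE // -sumrB big1 // => b _; rewrite ?eqxx.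
  apply/eqP; rewrite subr_eq0; apply/eqP; rewrite [LHS]mulrC.
  by congr (_ * _); apply: cf_sym => //; rewrite mon_arr ?mtype_mon.
exists d; split=> //.
  apply/mpolyP => m; rewrite gcomp_restrict [RHS]mcoeff_restrict.
  case: (mgrade S m =P d) => [e|/eqP ne]; first by rewrite low_p' // e.
  exact: qgrade.
move=> e ed; apply/mpolyP => m; rewrite gcomp_restrict mcoeff_restrict mcoeff0.
case: eqP => // me; have md : mgrade S m < d by rewrite me.
by rewrite low_p' ?qgrade // ?lt_eqF // ltW.
Qed.

(** An equality of ideals, from which that of the zero sets follows at once. *)
Lemma kernel_initial_ideal :
  [set p | rho p = 0]%classic = initial_ideal S (@pluecker_ideal K n).
Proof.
apply/funext => p; apply/propext; split=> [p0|[t [ht ->]]]; last first.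
  change (rho (\sum_(cq <- t) cq.1 * cq.2) = 0).
  rewrite linear_sum big_seq big1 // => cq /ht[p' Ip' init].
  rewrite rhoM // (initial_in_kernel Ip' init).
  by have := qmul_linr (-1) 0 0 (rho cq.1); rewrite scaler0 addr0 scaleN1r addNr.
have sumI (r : seq (dweight n * int)) :
    ideal_span [set q | exists2 p, pluecker_ideal p & is_initial S p q]%classic (\sum_(x <- r) tcomp x p).
  elim: r => [|x r [t [ht et]]]; first by exists [::]; rewrite !big_nil.
  rewrite big_cons et; have [->|nz] := eqVneq (tcomp x p) 0; first by exists t; rewrite add0r.
  exists ((1, tcomp x p) :: t); split; last by rewrite big_cons mul1r.
  move=> cq; rewrite inE => /predU1P[->|]; last exact: ht.
  have [p' Ip' init] := tcomp_initial (tcomp_kernel x p0) nz; by exists p'.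
rewrite [p]tcomp_sum; exact: sumI.
Qed.

End KernelIdeal.

Lemma submod_of_relations (n : nat) (a : nat -> nat -> int) :
  (forall i : nat, (i + 2 < n)%N ->
     a i (i + 1)%N + a (i + 1)%N (i + 2)%N <= a i (i + 2)%N) ->
  (forall i j : nat, (i + 1 < j)%N -> (j + 1 < n)%N ->
     a i j + a (i + 1)%N (j + 1)%N <= a i (j + 1)%N + a (i + 1)%N j) ->
  submod n a.
Proof.
move=> ha hb c x cx xn; rewrite /offdiag !ltnS cx (ltnW cx).
case: ltnP => [cx'|xc].
  by have := hb c x; rewrite !addn1; apply.
have e : x = c.+1 by apply/eqP; rewrite eqn_leq xc cx.
subst x.
by have := ha c; rewrite !addn1 !addn2 addr0; apply.
Qed.

Local Open Scope complex_scope.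

Theorem theoremB (R : realType) (n : nat) (a : nat -> nat -> int)
  (hn : (2 <= n)%N)
  (ha : forall i : nat, (i + 2 < n)%N ->
     a i (i + 1)%N + a (i + 1)%N (i + 2)%N <= a i (i + 2)%N)
  (hb : forall i j : nat, (i + 1 < j)%N -> (j + 1 < n)%N ->
     a i j + a (i + 1)%N (j + 1)%N <= a i (j + 1)%N + a (i + 1)%N j) :
  (forall P : set (QS R[i] n a), subalgebra P ->
     (forall (k : 'I_n.-1) (f : dual R[i] (@sigma n a) (omega k)), P (qin f)) ->
     forall x, P x)
  /\
  exists rho : {linear pring R[i] n -> QS R[i] n a},
    [/\ rho 1 = qone R[i] n a,
        forall p q, rho (p * q) = qmul (rho p) (rho q),
        forall x : pidx n, rho (Xv R[i] x) = qvar R[i] a x,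
        forall y, exists p, rho p = y
      & zeros [set p | rho p = 0]%classic = FS (@sigma n a)].
Proof.
have sa := submod_of_relations ha hb.
split; first exact: (rho_generates sa).
exists (rho R[i] n a); split.
- exact: rho1.
- exact: rhoM.
- exact: rho_Xv.
- exact: rho_surj.
by rewrite kernel_initial_ideal.
Qed.
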